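(* Let $n\ge 2$, $0<r<1$, $Q=(0,0,\dots,0,r)\in\mathbb{C}^n$, and let $\epsilon>0$ be sufficiently small such that $B^n(Q,\epsilon)\subset B^n$. Denote $A=(\partial B^n_r)\setminus B^n(Q,\epsilon)$ and $D=B^n\setminus A$. Then $s_D(z)$ and $\tilde e_D(z)$ are not plurisubharmonic.
   Context: $B^n$ is the open Euclidean unit ball in $\mathbb{C}^n$, $B^n(p,\delta)$ is the open Euclidean ball with centre $p$ and radius $\delta$, $B^n_r=\{z\in\mathbb{C}^n:\|z\|<r\}$, and $\mathbb{D}$ is the unit disk in $\mathbb{C}$; $O(X,Y)$ is the set of holomorphic maps from $X$ into $Y$. The Carathéodory pseudodistance on a domain $D$ is $c_D(z,w)=\sup\{\tanh^{-1}|\lambda| : f\in O(D,\mathbb{D}),\ f(z)=0,\ f(w)=\lambda\}$, with balls $B^c_D(z,t)=\{w\in D: c_D(z,w)<t\}$. For a bounded domain $D\subset\mathbb{C}^n$ and $z\in D$: the squeezing function is $s_D(z)=\sup\{t:\ tB^n\subset f(D),\ f\in O(D,B^n),\ f(z)=0,\ f \text{ injective}\}$; the Fridman invariant (with respect to the Carathéodory pseudodistance and the unit ball) is $\tilde e_D(z)=\sup\{\tanh(t):\ B^c_D(z,t)\subset f(B^n),\ f\in O(B^n,D),\ f\text{ injective}\}$.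
   Formalization: ''ε sufficiently small'' is made precise by also requiring ε < 2r: for r < 1/3 the inclusion B^n(Q,ε) ⊂ B^n alone allows ε > 2r, where A is empty, D = B^n and both invariants are constantly 1, hence plurisubharmonic (at ε = 2r, A = {-Q}, they are plurisubharmonic too). *)

(* Defs.v *)
From HB Require Import structures.
From mathcomp Require Import all_boot all_order all_algebra.
From mathcomp Require Import complex.
From mathcomp Require Import all_classical all_reals all_analysis.

Set Implicit Arguments.
Unset Strict Implicit.
Unset Printing Implicit Defensive.

Import Order.TTheory GRing.Theory Num.Theory numFieldNormedType.Exports.

Local Open Scope classical_set_scope.
Local Open Scope ring_scope.

(* R[i] receives from its regular module R[i]^o the topology and norm that
   numFieldNormedType gives to variables of type numFieldType. *)
#[export, non_forgetful_inheritance]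
HB.instance Definition _ (R : realType) := GRing.ComAlgebra.copy R[i] R[i]^o.
#[export, non_forgetful_inheritance]
HB.instance Definition _ (R : realType) := Vector.copy R[i] R[i]^o.
#[export, non_forgetful_inheritance]
HB.instance Definition _ (R : realType) := NormedModule.copy R[i] R[i]^o.

(* The norm of R[i] takes its (real) values in R[i]; cmod takes them in R. *)
Definition cmod (R : realType) (z : R[i]) : R := ComplexField.Normc.normc z.

Definition cdisc (R : realType) : set R[i] := [set z | cmod z < 1].

(* The library norm on 'rV[R[i]]_n is the maximum norm, which induces the
   standard topology; enorm is the Euclidean norm. *)
Definition enorm (R : realType) (n : nat) (z : 'rV[R[i]]_n) : R :=
  Num.sqrt (\sum_(j < n) cmod (z ord0 j) ^+ 2).

Definition eball (R : realType) (n : nat) (p : 'rV[R[i]]_n) (delta : R) :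
  set 'rV[R[i]]_n := [set z | enorm (z - p) < delta].

Definition frontier (T : topologicalType) (X : set T) : set T :=
  closure X `\` interior X.

(* The set O(X, Y), for X open.  A map is a total function whose values outside
   X are irrelevant; over the field R[i], Frechet differentiability is complex
   differentiability. *)
Definition holo (R : realType) (V W : normedModType R[i])
    (X : set V) (Y : set W) : set (V -> W) :=
  [set f | (forall z, X z -> differentiable f z) /\ f @` X `<=` Y].

Definition tanh (R : realType) (t : R) : R :=
  (expR t - expR (- t)) / (expR t + expR (- t)).

Definition artanh (R : realType) (x : R) : R := ln ((1 + x) / (1 - x)) / 2.

Definition caratheodory (R : realType) (n : nat) (D : set 'rV[R[i]]_n)
    (z w : 'rV[R[i]]_n) : \bar R :=
  ereal_sup [set (artanh (cmod (f w)))%:E |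
             f in [set f | holo D (@cdisc R) f /\ f z = 0]].

Definition caratheodory_ball (R : realType) (n : nat) (D : set 'rV[R[i]]_n)
    (z : 'rV[R[i]]_n) (t : R) : set 'rV[R[i]]_n :=
  [set w | D w /\ (caratheodory D z w < t%:E)%E].

(* The two invariants are suprema of subsets of ]0, 1]; they are extended reals
   because plurisubharmonic functions may take the value -oo. *)
Definition squeezing (R : realType) (n : nat) (D : set 'rV[R[i]]_n)
    (z : 'rV[R[i]]_n) : \bar R :=
  ereal_sup [set t%:E | t in [set t : R | 0 < t /\
    exists f : 'rV[R[i]]_n -> 'rV[R[i]]_n,
      [/\ holo D (eball 0 1) f, f z = 0, set_inj D f &
          eball 0 t `<=` f @` D]]].

Definition fridman (R : realType) (n : nat) (D : set 'rV[R[i]]_n)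
    (z : 'rV[R[i]]_n) : \bar R :=
  ereal_sup [set (tanh t)%:E | t in [set t : R | 0 < t /\
    exists f : 'rV[R[i]]_n -> 'rV[R[i]]_n,
      [/\ holo (eball 0 1) D f, set_inj (eball 0 1) f &
          caratheodory_ball D z t `<=` f @` eball 0 1]]].

(* Upper semicontinuous on X with values in [-oo, +oo[. *)
Definition usc_on (R : realType) (T : topologicalType) (X : set T)
    (u : T -> \bar R) : Prop :=
  forall x, X x -> (u x < +oo)%E /\
    forall a : R, (u x < a%:E)%E ->
      \forall y \near within X (nbhs x), (u y < a%:E)%E.

(* Sub-mean value inequality on every closed disc contained in X; the function
   identically -oo is allowed. *)
Definition subharmonic (R : realType) (X : set R[i]) (v : R[i] -> \bar R) :
    Prop :=
  usc_on X v /\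
  forall (c : R[i]) (rho : R), 0 < rho ->
    [set x | cmod (x - c) <= rho] `<=` X ->
    (v c <= (2 * pi)^-1%:E *
      \int[lebesgue_measure]_(t in `[0%R, (2 * pi)%R])
         v (c + Complex (rho * cos t) (rho * sin t))%R)%E.

Definition plurisubharmonic (R : realType) (n : nat) (D : set 'rV[R[i]]_n)
    (u : 'rV[R[i]]_n -> \bar R) : Prop :=
  usc_on D u /\
  forall a b : 'rV[R[i]]_n,
    subharmonic [set x : R[i] | D (a + x *: b)] (fun x => u (a + x *: b)).

(* Main.v *)
(* Put c = r - eps^2/(2r); on the sphere |z| = r the set A is {Re z_n <= c}, and the
   rim of the hole is {Re z_n = c}.  Let a be a point of the rim and e orthogonal to a
   with |e| = r.  A holomorphic f on D bounded by 1 has a Hartogs extension F to a ball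
   of radius delta about a, with delta depending only on r: F(y) is the mean of f over
   the circle y + rho e^{it} e, which lies outside the sphere.  By the mean value property
   F = f beyond the tangent hyperplane Re <y,a> = r^2, and by the identity theorem,
   through the hole, also inside the sphere.  By Cauchy's estimates F is Lipschitz with a constant
   depending only on r.
   Let now |z| < r with z close to a.
   - If f embeds D into the ball with f(z) = 0 and tB in f(D), then t <= L |z - a|:
     otherwise F(a) lies in tB, so F(a) = f(w) for some w in D; as injective
     holomorphic maps are open, points close to a are taken to values that f also
     takes near w, contradicting injectivity.
   - If f embeds B into D and f(B) contains the Caratheodory ball of radius t about z,
     then tanh t <= L |z - a|: otherwise f(B) contains small discs p + l e with p
     beyond the tangent hyperplane and p -> a, and the circle a + l e.  The maximum
     principle for the inverse map keeps the preimages of p in a compact part of B,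
     and an accumulation point of them is mapped to a, which is not in D.
   So both invariants are O(|z - a|) inside the sphere near the rim.  Affine maps show that at
   p0 = (0,...,0,c) they are at least (r - |c|)/2, and the discs centred at p0 in the plane
   of z_1 whose boundary approaches the rim violate the sub-mean value inequality. *)

Require Import Defs.
From mathcomp Require Import all_boot all_order all_algebra.
From mathcomp Require Import complex.
From mathcomp Require Import all_classical all_reals all_analysis.
From mathcomp Require Import perm ring lra.

Set Implicit Arguments.
Unset Strict Implicit.
Unset Printing Implicit Defensive.

Import Order.TTheory GRing.Theory Num.Theory numFieldNormedType.Exports.

Local Open Scope classical_set_scope.
Local Open Scope ring_scope.

(** The obstacle is that an injective holomorphic map f is not known to have an invertible Jacobian
    matrix at every point, so its inverse g cannot be treated as a holomorphic map. What is
    available is weaker: by the constant rank theorem [\det (jac f)] vanishes on no ball, and g is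
    continuous on images of compact sets and holomorphic at values taken where the determinant is
    not 0. Hence the maximum and identity principles are proved for continuous functions that are
    differentiable off their zeros, and are applied to functions with the factor [\det (jac f)]
    composed with g, which vanish where g may fail to be holomorphic. In the bound for g this factor
    is removed by taking N-th roots. The complex line a + l e is tangent to the sphere and |a + l
    e|^2 = r^2 (1 + |l|^2), so it leaves the closed ball at once; this is what makes room for the
    circles of the extension. Both invariants enter the last step only through a linear bound near
    the rim and a lower bound at p0, so one lemma refutes plurisubharmonicity for both. *)

Arguments cmod : simpl never.
Arguments enorm : simpl never.

(** * Continuity and derivatives with respect to a norm *)

Section Differential.
Context {R : realType}.
Local Notation C := R[i].

(* The norms are parameters because neither cmod nor enorm is the norm of a library
   structure. *)
Definition real_norm (X : zmodType) (N : X -> R) :=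
  [/\ N 0 = 0, forall x, N (- x) = N x & forall x y, N (x + y) <= N x + N y].

Definition contat (X Y : zmodType) (NX : X -> R) (NY : Y -> R) (f : X -> Y) x :=
  forall e : R, 0 < e -> exists2 d : R, 0 < d &
    forall y, NX (y - x) < d -> NY (f y - f x) < e.

(** Only additivity and a bound are asked of [L]; complex linearity comes from the shape given to
    [L] in [cderiv] and [hderiv]. Curves, functions of one variable and functions of several
    variables thus share one chain rule and one product rule. *)
Definition deriv_at (X Y : zmodType) (NX : X -> R) (NY : Y -> R) (f : X -> Y)
    x (L : X -> Y) :=
  [/\ forall u v, L (u - v) = L u - L v,
      exists K, forall u, NY (L u) <= K * NX u &
      forall e : R, 0 < e -> exists2 d : R, 0 < d & forall y, NX (y - x) < d ->
        NY (f y - f x - L (y - x)) <= e * NX (y - x)].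

Section Norm.
Context {X : zmodType} {N : X -> R}.
Hypothesis hN : real_norm N.

Lemma rn0 : N 0 = 0. Proof. by case: hN. Qed.
Lemma rnN x : N (- x) = N x. Proof. by case: hN. Qed.
Lemma rnD x y : N (x + y) <= N x + N y. Proof. by case: hN. Qed.
Lemma rn_ge0 x : 0 <= N x.
Proof. by have := rnD x (- x); rewrite subrr rn0 rnN -mulr2n pmulrn_lge0. Qed.
Lemma rn_distC x y : N (x - y) = N (y - x).
Proof. by rewrite -rnN opprB. Qed.
Lemma rn_dist x y : N x <= N y + N (x - y).
Proof. by have := rnD y (x - y); rewrite addrC subrK. Qed.
Lemma rn_dist3 x y z : N (x - z) <= N (x - y) + N (y - z).
Proof. by have := rnD (x - y) (y - z); rewrite addrA subrK. Qed.
Lemma rn_dist_abs x y : `|N x - N y| <= N (x - y).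
Proof.
rewrite ler_norml; have := rn_dist x y; have := rn_dist y x.
rewrite rn_distC; lra.
Qed.

End Norm.

Lemma rn_abs : real_norm (fun x : R => `|x|).
Proof. by split; [exact: normr0|exact: normrN|exact: ler_normD]. Qed.

Lemma cmodE (x y : R) : cmod (Complex x y) = Num.sqrt (x ^+ 2 + y ^+ 2).
Proof. by []. Qed.

Lemma cmodM (x y : C) : cmod (x * y) = cmod x * cmod y.
Proof. exact: ComplexField.Normc.normcM. Qed.

Lemma cmodV (x : C) : cmod x^-1 = (cmod x)^-1.
Proof. exact: ComplexField.Normc.normcV. Qed.

Lemma cmod0 : cmod (0 : C) = 0.
Proof. exact: ComplexField.Normc.normc0. Qed.

Lemma cmod1 : cmod (1 : C) = 1.
Proof. exact: ComplexField.Normc.normc1. Qed.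

Lemma rn_cmod : real_norm (@cmod R).
Proof. by split; [exact: cmod0|exact: normcN|exact: le_normcD]. Qed.

Lemma cmod_ge0 (x : C) : 0 <= cmod x.
Proof. exact: rn_ge0 rn_cmod x. Qed.

Lemma cmod_eq0 (x : C) : (cmod x == 0) = (x == 0).
Proof.
by apply/eqP/eqP => [/ComplexField.Normc.eq0_normc//|->]; exact: cmod0.
Qed.

Lemma cmod_gt0 (x : C) : (0 < cmod x) = (x != 0).
Proof. by rewrite lt0r cmod_ge0 cmod_eq0 andbT. Qed.

Lemma cmodX (x : C) k : cmod (x ^+ k) = cmod x ^+ k.
Proof.
by elim: k => [|k IH]; rewrite ?expr0 ?cmod1// !exprS cmodM IH.
Qed.

Lemma cmodR (x : R) : cmod (x%:C)%C = `|x|.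
Proof. by rewrite cmodE expr0n addr0 sqrtr_sqr. Qed.

Lemma cmodi : cmod ('i%C : C) = 1.
Proof. by rewrite cmodE expr0n add0r expr1n sqrtr1. Qed.

Lemma cmod_sqr (z : C) : cmod z ^+ 2 = complex.Re z ^+ 2 + complex.Im z ^+ 2.
Proof.
by case: z => a b; rewrite cmodE sqr_sqrtr//= addr_ge0// sqr_ge0.
Qed.

Lemma ler_abs_sqr (x y : R) : 0 <= y -> x ^+ 2 <= y ^+ 2 -> `|x| <= y.
Proof.
by move=> y0 xy; rewrite -(ler_pXn2r (n := 2))// ?nnegrE// real_normK ?num_real.
Qed.

Lemma Re_le_cmod (z : C) : `|complex.Re z| <= cmod z.
Proof. by apply: ler_abs_sqr (cmod_ge0 z) _; rewrite cmod_sqr lerDl sqr_ge0. Qed.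

Lemma Im_le_cmod (z : C) : `|complex.Im z| <= cmod z.
Proof. by apply: ler_abs_sqr (cmod_ge0 z) _; rewrite cmod_sqr lerDr sqr_ge0. Qed.

Lemma cmod_le_ReIm (z : C) : cmod z <= `|complex.Re z| + `|complex.Im z|.
Proof.
rewrite {1}(complexE z); apply: le_trans (rnD rn_cmod _ _) _.
by rewrite cmodM cmodi mul1r !cmodR.
Qed.

Lemma cmodJ (z : C) : cmod (z^*)%C = cmod z.
Proof. by case: z => a b; rewrite !cmodE sqrrN. Qed.

Section Cont.
Context {X Y : zmodType} {NX : X -> R} {NY : Y -> R}.
Hypotheses (hX : real_norm NX) (hY : real_norm NY).

Lemma contat_cst (y : Y) x : contat NX NY (fun=> y) x.
Proof. by move=> e e0; exists 1 => // z _; rewrite subrr (rn0 hY). Qed.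

Lemma contat_ext (f g : X -> Y) x r : 0 < r ->
  (forall y, NX (y - x) < r -> f y = g y) -> contat NX NY f x -> contat NX NY g x.
Proof.
move=> r0 fg cf e e0; have [d d0 h] := cf e e0.
exists (Num.min d r); first by rewrite lt_min d0.
move=> y; rewrite lt_min => /andP[yd yr].
by rewrite -!fg// ?subrr ?(rn0 hX)//; exact: h.
Qed.

Lemma contat_add (f g : X -> Y) x : contat NX NY f x -> contat NX NY g x ->
  contat NX NY (fun y => f y + g y) x.
Proof.
move=> cf cg e e0; have e2 : 0 < e / 2 by lra.
have [d1 d10 h1] := cf _ e2; have [d2 d20 h2] := cg _ e2.
exists (Num.min d1 d2); first by rewrite lt_min d10.
move=> y; rewrite lt_min => /andP[/h1 k1 /h2 k2].
rewrite opprD addrACA; have := rnD hY (f y - f x) (g y - g x); lra.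
Qed.

Lemma contat_opp (f : X -> Y) x :
  contat NX NY f x -> contat NX NY (fun y => - f y) x.
Proof.
move=> cf e e0; have [d d0 h] := cf e e0; exists d => // y yd.
by rewrite -opprD (rnN hY); exact: h.
Qed.

Lemma deriv_contat (f : X -> Y) x L : deriv_at NX NY f x L -> contat NX NY f x.
Proof.
move=> [_ [K hK] h] e e0; have [d d0 hd] := h 1 ltr01.
have K0 : 0 < `|K| + 1 by rewrite ltr_wpDl.
exists (Num.min d (e / (`|K| + 2))); first by rewrite lt_min d0 divr_gt0// ltr_wpDl.
move=> y; rewrite lt_min => /andP[/hd k]; rewrite ltr_pdivlMr ?ltr_wpDl// => k2.
have := rnD hY (f y - f x - L (y - x)) (L (y - x)); rewrite subrK => k3.
apply: le_lt_trans k3 _.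
have k4 : K * NX (y - x) <= `|K| * NX (y - x).
  by rewrite ler_wpM2r ?(rn_ge0 hX)// ler_norm.
have := hK (y - x); have := rn_ge0 hX (y - x); nra.
Qed.

Lemma deriv_cst (y : Y) x : deriv_at NX NY (fun=> y) x (fun=> 0).
Proof.
split; first by move=> *; rewrite subr0.
  by exists 0 => u; rewrite mul0r (rn0 hY).
move=> e e0; exists 1 => // z _; rewrite subrr subr0 (rn0 hY).
by rewrite mulr_ge0 ?(rn_ge0 hX)// ltW.
Qed.

Lemma deriv_ext (f g : X -> Y) x L r : 0 < r ->
  (forall y, NX (y - x) < r -> f y = g y) ->
  deriv_at NX NY f x L -> deriv_at NX NY g x L.
Proof.
move=> r0 fg [L1 L2 L3]; split=> // e e0; have [d d0 h] := L3 e e0.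
exists (Num.min d r); first by rewrite lt_min d0.
move=> y; rewrite lt_min => /andP[yd yr].
by rewrite -!fg// ?subrr ?(rn0 hX)//; exact: h.
Qed.

Lemma deriv_extL (f : X -> Y) x L L' :
  L =1 L' -> deriv_at NX NY f x L -> deriv_at NX NY f x L'.
Proof. by move=> /funext ->. Qed.

Lemma deriv_add (f g : X -> Y) x L M :
  deriv_at NX NY f x L -> deriv_at NX NY g x M ->
  deriv_at NX NY (fun y => f y + g y) x (fun u => L u + M u).
Proof.
move=> [L1 [K1 hK1] L3] [M1 [K2 hK2] M3]; split.
- by move=> u v; rewrite L1 M1 opprD addrACA.
- exists (K1 + K2) => u; rewrite mulrDl.
  by apply: le_trans (rnD hY _ _) _; exact: lerD.
- move=> e e0; have e2 : 0 < e / 2 by lra.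
  have [d1 d10 h1] := L3 _ e2; have [d2 d20 h2] := M3 _ e2.
  exists (Num.min d1 d2); first by rewrite lt_min d10.
  move=> y; rewrite lt_min => /andP[/h1 k1 /h2 k2].
  have -> : f y + g y - (f x + g x) - (L (y - x) + M (y - x)) =
     (f y - f x - L (y - x)) + (g y - g x - M (y - x)).
    by rewrite !opprD (addrACA (f y)) (addrACA (f y - f x)).
  apply: le_trans (rnD hY _ _) _; lra.
Qed.

Lemma deriv_opp (f : X -> Y) x L :
  deriv_at NX NY f x L -> deriv_at NX NY (fun y => - f y) x (fun u => - L u).
Proof.
move=> [L1 [K1 hK1] L3]; split.
- by move=> u v; rewrite L1 opprD.
- by exists K1 => u; rewrite (rnN hY).
- move=> e e0; have [d d0 h] := L3 _ e0; exists d => // y /h.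
  by rewrite -!opprD (rnN hY).
Qed.

End Cont.

Lemma contat_comp (X Y Z : zmodType) (NX : X -> R) (NY : Y -> R) (NZ : Z -> R)
    (f : X -> Y) (g : Y -> Z) x :
  contat NX NY f x -> contat NY NZ g (f x) -> contat NX NZ (fun y => g (f y)) x.
Proof.
move=> cf cg e e0; have [d d0 h] := cg e e0; have [d' d'0 h'] := cf d d0.
by exists d' => // y /h' /h.
Qed.

Lemma deriv_comp (X Y Z : zmodType) (NX : X -> R) (NY : Y -> R) (NZ : Z -> R)
    (f : X -> Y) (g : Y -> Z) x L M :
  real_norm NX -> real_norm NY -> real_norm NZ ->
  deriv_at NX NY f x L -> deriv_at NY NZ g (f x) M ->
  deriv_at NX NZ (fun y => g (f y)) x (fun u => M (L u)).
Proof.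
move=> hX hY hZ Df [M1 [K2 hK2] M3].
have [L1 [K1 hK1] L3] := Df.
have hK1' u : NY (L u) <= `|K1| * NX u.
  by apply: le_trans (hK1 u) _; rewrite ler_wpM2r ?(rn_ge0 hX)// ler_norm.
have hK2' u : NZ (M u) <= `|K2| * NY u.
  by apply: le_trans (hK2 u) _; rewrite ler_wpM2r ?(rn_ge0 hY)// ler_norm.
split; first by move=> u v; rewrite L1 M1.
  exists (`|K2| * `|K1|) => u; apply: le_trans (hK2' _) _; rewrite -mulrA.
  by rewrite ler_wpM2l.
move=> e e0.
pose e1 := e / (2 * (`|K1| + 1)); pose e2 := e / (2 * (`|K2| + 1)).
have k10 : 0 <= `|K1| by []. have k20 : 0 <= `|K2| by [].
have e10 : 0 < e1 by rewrite divr_gt0// mulr_gt0// ltr_wpDl.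
have e20 : 0 < e2 by rewrite divr_gt0// mulr_gt0// ltr_wpDl.
have [d1 d10 h1] := M3 _ e10; have [d2 d20 h2] := L3 _ e20.
have [d3 d30 h3] := deriv_contat hX hY Df d10.
have [d4 d40 h4] := L3 1 ltr01.
exists (Num.min d2 (Num.min d3 d4)); first by rewrite !lt_min d20 d30.
move=> y; rewrite !lt_min => /and3P[/h2 k2 /h3/h1 k3 /h4 k4].
set u := f y - f x in k2 k3 k4.
have -> : g (f y) - g (f x) - M (L (y - x)) =
   (g (f y) - g (f x) - M u) + M (u - L (y - x)) by rewrite (M1 u) [RHS]addrA subrK.
apply: le_trans (rnD hZ _ _) _.
have k5 : NY u <= (`|K1| + 1) * NX (y - x).
  have := rnD hY (L (y - x)) (u - L (y - x)); rewrite addrC subrK.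
  have := hK1' (y - x); lra.
have k6 : e1 * NY u <= e / 2 * NX (y - x).
  apply: le_trans (ler_wpM2l (ltW e10) k5) _; rewrite mulrA ler_wpM2r ?(rn_ge0 hX)//.
  rewrite /e1 le_eqVlt; apply/orP; left; apply/eqP; field; lra.
have k7 : NZ (M (u - L (y - x))) <= e / 2 * NX (y - x).
  apply: le_trans (hK2' _) _.
  apply: (@le_trans _ _ ((`|K2| + 1) * (e2 * NX (y - x)))).
    apply: ler_pM; rewrite ?(rn_ge0 hY)//; lra.
  rewrite mulrA ler_wpM2r ?(rn_ge0 hX)//.
  rewrite /e2 le_eqVlt; apply/orP; left; apply/eqP; field; lra.
lra.
Qed.

Section Mul.
Context {X : zmodType} {NX : X -> R}.
Hypothesis hX : real_norm NX.
Local Notation cont := (contat NX (@cmod R)).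
Local Notation deriv := (deriv_at NX (@cmod R)).

Lemma contat_bound (f : X -> C) x : cont f x -> exists2 d, 0 < d &
  forall y, NX (y - x) < d -> cmod (f y) <= cmod (f x) + 1.
Proof.
move=> /(_ 1 ltr01)[d d0 h]; exists d => // y /h k.
have := rn_dist rn_cmod (f y) (f x); lra.
Qed.

Lemma contat_mul (f g : X -> C) x :
  cont f x -> cont g x -> cont (fun y => f y * g y) x.
Proof.
move=> cf cg e e0.
have [d1 d10 h1] := contat_bound cf.
have p1 : 0 < cmod (f x) + 1 by rewrite ltr_wpDl// cmod_ge0.
have p2 : 0 < cmod (g x) + 1 by rewrite ltr_wpDl// cmod_ge0.
have q1 : 0 < e / 2 / (cmod (f x) + 1) by rewrite divr_gt0//; lra.
have q2 : 0 < e / 2 / (cmod (g x) + 1) by rewrite divr_gt0//; lra.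
have [d2 d20 h2] := cf _ q2; have [d3 d30 h3] := cg _ q1.
exists (Num.min d1 (Num.min d2 d3)); first by rewrite !lt_min d10 d20.
move=> y; rewrite !lt_min => /and3P[/h1 k1 /h2 k2 /h3 k3].
have -> : f y * g y - f x * g x = f y * (g y - g x) + (f y - f x) * g x by ring.
apply: le_lt_trans (rnD rn_cmod _ _) _; rewrite !cmodM.
move: k2 k3; rewrite !ltr_pdivlMr// => k2 k3.
have := cmod_ge0 (f y - f x); have := cmod_ge0 (g y - g x).
have := cmod_ge0 (g x); nra.
Qed.

Lemma deriv_mul (f g : X -> C) x L M : deriv f x L -> deriv g x M ->
  deriv (fun y => f y * g y) x (fun u => f x * M u + g x * L u).
Proof.
move=> Df Dg; have [L1 [K1 hK1] L3] := Df; have [M1 [K2 hK2] M3] := Dg.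
split; first by move=> u v; rewrite L1 M1; ring.
  exists (cmod (f x) * K2 + cmod (g x) * K1) => u.
  apply: le_trans (rnD rn_cmod _ _) _; rewrite !cmodM mulrDl -!mulrA.
  by apply: lerD; apply: ler_wpM2l; rewrite ?cmod_ge0.
move=> e e0; have e3 : 0 < e / 3 by lra.
have p1 : 0 < cmod (f x) + 1 by rewrite ltr_wpDl// cmod_ge0.
have p2 : 0 < cmod (g x) + 1 by rewrite ltr_wpDl// cmod_ge0.
have p3 : 0 < `|K2| + 1 by rewrite ltr_wpDl.
have q1 : 0 < e / 3 / (cmod (f x) + 1) by rewrite divr_gt0//; lra.
have q2 : 0 < e / 3 / (cmod (g x) + 1) by rewrite divr_gt0//; lra.
have q3 : 0 < e / 3 / (`|K2| + 1) by rewrite divr_gt0//; lra.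
have [d1 d10 h1] := contat_bound (deriv_contat hX rn_cmod Df).
have [d2 d20 h2] := L3 _ q2; have [d3 d30 h3] := M3 _ q1.
have [d4 d40 h4] := deriv_contat hX rn_cmod Df q3.
exists (Num.min (Num.min d1 d4) (Num.min d2 d3)).
  by rewrite !lt_min d10 d20 d30 d40.
move=> y; rewrite !lt_min => /andP[/andP[/h1 k1 /h4 k4] /andP[/h2 k2 /h3 k3]].
have -> : f y * g y - f x * g x - (f x * M (y - x) + g x * L (y - x)) =
   f y * (g y - g x - M (y - x)) + (f y - f x) * M (y - x)
   + g x * (f y - f x - L (y - x)) by ring.
set w := NX (y - x) in k2 k3 *.
have w0 : 0 <= w by exact: rn_ge0.
apply: le_trans (rnD rn_cmod _ _) _.
apply: le_trans (lerD (rnD rn_cmod _ _) (lexx _)) _; rewrite !cmodM.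
have a1 : cmod (f y) * cmod (g y - g x - M (y - x)) <= e / 3 * w.
  apply: (@le_trans _ _ ((cmod (f x) + 1) * (e / 3 / (cmod (f x) + 1) * w))).
    by apply: ler_pM; rewrite ?cmod_ge0.
  by rewrite !mulrA -(mulrA _ e) [_ * (e / 3)]mulrC mulfK// gt_eqF.
have a2 : cmod (f y - f x) * cmod (M (y - x)) <= e / 3 * w.
  apply: (@le_trans _ _ (e / 3 / (`|K2| + 1) * ((`|K2| + 1) * w))).
    apply: ler_pM; rewrite ?cmod_ge0//; first exact: ltW.
    apply: le_trans (hK2 _) _; rewrite ler_wpM2r//.
    by have := ler_norm K2; lra.
  by rewrite !mulrA divfK// gt_eqF.
have a3 : cmod (g x) * cmod (f y - f x - L (y - x)) <= e / 3 * w.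
  apply: (@le_trans _ _ ((cmod (g x) + 1) * (e / 3 / (cmod (g x) + 1) * w))).
    apply: ler_pM; rewrite ?cmod_ge0//; lra.
  by rewrite !mulrA -(mulrA _ e) [_ * (e / 3)]mulrC mulfK// gt_eqF.
lra.
Qed.

End Mul.

End Differential.

(** * Differentiation and integration in one variable *)

Section RealVariable.
Context {R : realType}.
Local Notation C := R[i].
Local Notation Rabs := (fun x : R => `|x|).

Lemma real_derivP (u : R -> R) (t du : R) :
  is_derive t 1 u du <->
  forall e : R, 0 < e -> exists2 d : R, 0 < d & forall y, `|y - t| < d ->
    `|u y - u t - (y - t) * du| <= e * `|y - t|.
Proof.
split.
  move=> [du1 du2] e e0.
  have cv : h^-1 *: ((u \o shift t) (h *: (1 : R)) - u t) @[h --> 0^'] --> du.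
    by rewrite -du2; exact: du1.
  move/cvgrPdist_le : cv => /(_ e e0)/=.
  rewrite near_withinE /= => /nbhs_ballP[d /= d0 hd].
  exists d => // y yd.
  have [->|yt] := eqVneq y t; first by rewrite !subrr mul0r subrr normr0 mulr0.
  have h0 : y - t != 0 by rewrite subr_eq0.
  have := hd (y - t); rewrite /ball/= sub0r normrN => /(_ yd h0).
  rewrite -[(y - t)%R *: 1]/((y - t) * 1) mulr1 subrK => k.
  have -> : u y - u t - (y - t) * du =
     - ((y - t) * (du - (y - t)^-1 *: (u y - u t))).
    rewrite -[_ *: _]/((y - t)^-1 * (u y - u t)) mulrBr mulrA mulfV//; ring.
  by rewrite normrN normrM mulrC ler_wpM2r.
move=> H.
have cv : h^-1 *: ((u \o shift t) (h *: (1 : R)) - u t) @[h --> 0^'] --> du.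
  apply/cvgrPdist_le => e e0; have [d d0 hd] := H e e0.
  rewrite near_withinE /=; apply/nbhs_ballP; exists d => //= h.
  rewrite /ball/= sub0r normrN => hd1 h0.
  have := hd (h + t); rewrite addrK => /(_ hd1) k.
  rewrite -[h *: 1]/(h * 1) mulr1.
  rewrite -(ler_pM2l (x := `|h|)) ?normr_gt0// [X in _ <= X]mulrC.
  apply: le_trans k; rewrite -normrM mulrBr.
  rewrite -[_ *: _]/(h^-1 * (u (h + t) - u t)) mulrA mulfV// mul1r.
  by rewrite distrC.
by split; [apply/cvg_ex; exists du|apply/cvg_lim].
Qed.

Lemma real_cont (u : R -> R) t :
  contat Rabs Rabs u t <-> {for t, continuous u}.
Proof.
split.
  move=> H; apply/cvgrPdist_lt => e e0; have [d d0 hd] := H e e0.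
  apply/nbhs_ballP; exists d => //= y; rewrite /ball/= => yd.
  by rewrite distrC hd// distrC.
move=> /cvgrPdist_lt H e e0; have /nbhs_ballP[d /= d0 hd] := H e e0.
exists d => // y yd; have := hd y; rewrite /ball/= distrC => /(_ yd).
by rewrite distrC.
Qed.

Definition rderiv (f : R -> C) t (d : C) :=
  deriv_at Rabs (@cmod R) f t (fun s => (s%:C)%C * d).

Definition cderiv (f : C -> C) z (d : C) :=
  deriv_at (@cmod R) (@cmod R) f z (fun h => h * d).

Notation rcont := (contat Rabs (@cmod R)).
Notation ccont := (contat (@cmod R) (@cmod R)).

Lemma rderivP (f : R -> C) t d :
  (forall e : R, 0 < e -> exists2 del : R, 0 < del & forall y, `|y - t| < del ->
    cmod (f y - f t - ((y - t)%:C)%C * d) <= e * `|y - t|) -> rderiv f t d.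
Proof.
move=> H; split=> //; first by move=> u v; rewrite rmorphB mulrBl.
by exists (cmod d) => u; rewrite cmodM cmodR mulrC.
Qed.

Lemma cderivP (f : C -> C) z d :
  (forall e : R, 0 < e -> exists2 del : R, 0 < del & forall y, cmod (y - z) < del ->
    cmod (f y - f z - (y - z) * d) <= e * cmod (y - z)) -> cderiv f z d.
Proof.
move=> H; split=> //; first by move=> u v; rewrite mulrBl.
by exists (cmod d) => u; rewrite cmodM mulrC.
Qed.

Lemma rderiv_cont f t d : rderiv f t d -> rcont f t.
Proof. by move=> h; have := deriv_contat rn_abs rn_cmod h. Qed.

Lemma cderiv_cont f z d : cderiv f z d -> ccont f z.
Proof. by move=> h; have := deriv_contat rn_cmod rn_cmod h. Qed.

Lemma rderiv_add (f g : R -> C) t d d' :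
  rderiv f t d -> rderiv g t d' -> rderiv (fun s => f s + g s) t (d + d').
Proof.
move=> /(deriv_add rn_cmod) /[apply].
by apply: deriv_extL => u; rewrite mulrDr.
Qed.

Lemma rderiv_opp (f : R -> C) t d : rderiv f t d -> rderiv (fun s => - f s) t (- d).
Proof.
by move=> /(deriv_opp rn_cmod); apply: deriv_extL => u; rewrite mulrN.
Qed.

Lemma rderiv_cst (c : C) (t : R) : rderiv (fun=> c) t 0.
Proof.
apply: deriv_extL (deriv_cst rn_abs rn_cmod c t) => u; by rewrite mulr0.
Qed.

Lemma rderiv_mul (f g : R -> C) t d d' : rderiv f t d -> rderiv g t d' ->
  rderiv (fun s => f s * g s) t (d * g t + f t * d').
Proof.
move=> /(deriv_mul rn_abs) /[apply]; apply: deriv_extL => u; ring.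
Qed.

Lemma rderiv_id (t : R) : rderiv (fun s : R => (s%:C)%C) t 1.
Proof.
apply: rderivP => e e0; exists 1 => // y _.
by rewrite -rmorphB mulr1 subrr cmod0 mulr_ge0// ltW.
Qed.

Lemma rderiv_comp (f : C -> C) (g : R -> C) t d d' :
  cderiv f (g t) d -> rderiv g t d' -> rderiv (fun s => f (g s)) t (d * d').
Proof.
move=> h1 h2; apply: deriv_extL (deriv_comp rn_abs rn_cmod rn_cmod h2 h1) => u.
by rewrite -mulrA (mulrC d').
Qed.

Lemma cderiv_add (f g : C -> C) t d d' :
  cderiv f t d -> cderiv g t d' -> cderiv (fun s => f s + g s) t (d + d').
Proof.
move=> /(deriv_add rn_cmod) /[apply].
by apply: deriv_extL => u; rewrite mulrDr.
Qed.

Lemma cderiv_cst (c t : C) : cderiv (fun=> c) t 0.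
Proof.
apply: deriv_extL (deriv_cst rn_cmod rn_cmod c t) => u; by rewrite mulr0.
Qed.

Lemma cderiv_mul (f g : C -> C) t d d' : cderiv f t d -> cderiv g t d' ->
  cderiv (fun s => f s * g s) t (d * g t + f t * d').
Proof.
move=> /(deriv_mul rn_cmod) /[apply]; apply: deriv_extL => u; ring.
Qed.

Lemma cderiv_id (t : C) : cderiv (fun s => s) t 1.
Proof.
apply: cderivP => e e0; exists 1 => // y _.
by rewrite mulr1 subrr cmod0 mulr_ge0 ?cmod_ge0// ltW.
Qed.

Lemma cderiv_comp (f g : C -> C) t d d' :
  cderiv f (g t) d -> cderiv g t d' -> cderiv (fun s => f (g s)) t (d * d').
Proof.
move=> h1 h2; apply: deriv_extL (deriv_comp rn_cmod rn_cmod rn_cmod h2 h1) => u.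
by rewrite -mulrA (mulrC d').
Qed.

Lemma cderiv_ext (f g : C -> C) (z d : C) (r : R) : 0 < r ->
  (forall y, cmod (y - z) < r -> f y = g y) -> cderiv f z d -> cderiv g z d.
Proof. by move=> r0 fg h; have := deriv_ext rn_cmod r0 fg h. Qed.

Lemma cderiv_inv (z : C) : z != 0 -> cderiv (fun w => w^-1) z (- (z ^- 2)).
Proof.
move=> z0; apply: cderivP => e e0.
have cz : 0 < cmod z by rewrite cmod_gt0.
exists (Num.min (cmod z / 2) (e * cmod z ^+ 3 / 2)).
  by rewrite lt_min !divr_gt0// mulr_gt0// exprn_gt0.
move=> y; rewrite lt_min => /andP[y1 y2].
have cy : cmod z / 2 < cmod y.
  have := rn_dist rn_cmod z y; rewrite (rn_distC rn_cmod z y); lra.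
have y0 : y != 0 by rewrite -cmod_gt0; lra.
have -> : y^-1 - z^-1 - (y - z) * - z ^- 2 = (y - z) * ((y - z) * (y^-1 * z ^- 2)).
  by field; rewrite y0 z0.
rewrite cmodM [X in _ <= X]mulrC ler_wpM2l ?cmod_ge0// !cmodM !cmodV cmodX.
rewrite mulrA ler_pdivrMr ?exprn_gt0//.
rewrite ler_pdivrMr ?(lt_trans _ cy)//; last by lra.
apply: (le_trans (ltW y2)).
have -> : e * cmod z ^+ 3 / 2 = e * cmod z ^+ 2 * (cmod z / 2) by ring.
move: cy; set p := e * cmod z ^+ 2 => cy.
by rewrite ler_wpM2l ?ltW// mulr_gt0 ?exprn_gt0.
Qed.

Lemma ccont_inv (z : C) : z != 0 -> ccont (fun w => w^-1) z.
Proof. by move=> /cderiv_inv /cderiv_cont. Qed.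

Lemma rderiv_ext (f g : R -> C) (t : R) (d : C) (r : R) : 0 < r ->
  (forall y, `|y - t| < r -> f y = g y) -> rderiv f t d -> rderiv g t d.
Proof. by move=> r0 fg h; have := deriv_ext rn_abs r0 fg h. Qed.

(** The mean value theorem fails for complex values, so it is applied to the real function Re (w
    f(t)). The weight [w] is left to the application: a conjugate for norm estimates, 1 / (2 pi) for
    the sign of a mean. *)
Lemma re_mean_value (f : R -> C) (g : R -> C) (w : C) a b : a <= b ->
  (forall t, a <= t <= b -> rderiv f t (g t)) ->
  exists2 t, a <= t <= b &
    complex.Re (w * (f b - f a)) = complex.Re (w * g t) * (b - a).
Proof.
move=> ab fg; pose u t := complex.Re (w * f t).
have uE x y : u y - u x = complex.Re (w * (f y - f x)).
  by rewrite /u mulrBr raddfB.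
have du t : a <= t <= b -> is_derive t 1 u (complex.Re (w * g t)).
  move=> /fg [_ _ h]; apply/real_derivP => e e0.
  have p : 0 < cmod w + 1 by rewrite ltr_wpDl ?cmod_ge0.
  have q : 0 < e / (cmod w + 1) by rewrite divr_gt0.
  have [d d0 hd] := h _ q; exists d => // y /hd k.
  have -> : u y - u t - (y - t) * complex.Re (w * g t) =
     complex.Re (w * (f y - f t - (((y - t)%:C)%C * g t))).
    rewrite uE (mulrBr w (f y - f t)) (raddfB (@complex.Re R))/=; congr (_ - _).
    have -> : w * (((y - t)%:C)%C * g t) = ((y - t)%:C)%C * (w * g t) by ring.
    by case: (w * g t) => p1 p2 /=; rewrite mul0r subr0.
  apply: le_trans (Re_le_cmod _) _; rewrite cmodM.
  apply: (@le_trans _ _ ((cmod w + 1) * (e / (cmod w + 1) * `|y - t|))).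
    by apply: ler_pM => //; rewrite ?cmod_ge0//; lra.
  by rewrite mulrA [_ * (e / _)]mulrC divfK// gt_eqF.
have [||c cab] := @MVT_segment R u (fun t => complex.Re (w * g t)) a b ab.
- move=> x; rewrite in_itv/= => /andP[h1 h2]; apply: du; by rewrite !ltW.
- apply: derivable_within_continuous => x; rewrite in_itv/= => h.
  by have [] := du x h.
by rewrite uE => E; exists c => //; move: cab; rewrite in_itv.
Qed.

Lemma rcont_comp (g : C -> C) (f : R -> C) t :
  rcont f t -> ccont g (f t) -> rcont (fun t => g (f t)) t.
Proof. exact: contat_comp. Qed.

Lemma mean_value_le (f : R -> C) (g : R -> C) a b K : a <= b ->
  (forall t, a <= t <= b -> rderiv f t (g t)) ->
  (forall t, a <= t <= b -> cmod (g t) <= K) ->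
  cmod (f b - f a) <= K * (b - a).
Proof.
move=> ab fg gK; pose w := ((f b - f a)^*)%C.
have [c cab /esym E] := re_mean_value w ab fg.
have [fab|fab] := eqVneq (f b - f a) 0.
  rewrite fab cmod0 mulr_ge0 ?subr_ge0//.
  by apply: le_trans (gK a _); rewrite ?cmod_ge0// lexx.
have n0 : 0 < cmod (f b - f a) by rewrite cmod_gt0.
have E2 : complex.Re (w * (f b - f a)) = cmod (f b - f a) ^+ 2.
  rewrite /w cmod_sqr; case: (f b - f a) => p q /=; ring.
rewrite -(ler_pM2l n0) -expr2 -E2 -E.
rewrite mulrA ler_wpM2r ?subr_ge0//.
apply: le_trans (ler_norm _) _; apply: le_trans (Re_le_cmod _) _.
by rewrite cmodM /w cmodJ ler_wpM2l ?cmod_ge0// gK.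
Qed.

Lemma rderiv0_eq (f : R -> C) a b :
  (forall t, a <= t <= b \/ b <= t <= a -> rderiv f t 0) -> f a = f b.
Proof.
wlog ab : a b / a <= b => [H|] h.
  have [ab|ba] := leP a b; first exact: H.
  by symmetry; apply: H (ltW ba) _ => t [] k; apply: h; [right|left].
have := @mean_value_le f (fun=> 0) a b 0 ab.
rewrite mul0r => H; have : cmod (f b - f a) <= 0.
  by apply: H => t k; [apply: h; left|rewrite cmod0].
move=> k; apply/esym/eqP; rewrite -subr_eq0 -cmod_eq0.
by rewrite eq_le k cmod_ge0.
Qed.

Lemma real_antiderivative (g : R -> R) (b : R) :
  (forall t, contat Rabs Rabs g t) ->
  exists G : R -> R, forall t : R, - b < t < b -> is_derive t 1 G (g t).
Proof.
move=> cg.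
have cg' : continuous g by move=> t; apply/real_cont; exact: cg.
exists (fun x => (\int[lebesgue_measure]_(t in [set` `[- b, x]]) (g t))%R).
move=> t /andP[t1 t2].
have ig : lebesgue_measure.-integrable [set` `[- b, b]] (EFin \o g).
  apply: continuous_compact_integrable; first exact: segment_compact.
  exact: continuous_subspaceT.
have [h1 h2] := continuous_FTC1_closed t2 ig t1 (cg' t).
by split; [exact: h1|rewrite -derive1E; exact: h2].
Qed.

Lemma antiderivative (g : R -> C) : (forall t, rcont g t) ->
  exists G : R -> C, forall t, rderiv G t (g t).
Proof.
move=> cg.
have H (b : R) : exists G : R -> C, forall t : R, - b < t < b -> rderiv G t (g t).
  have [|G1 h1] := @real_antiderivative (fun t => complex.Re (g t)) b.
    move=> t e e0; have [d d0 h] := cg t e e0; exists d => // y /h.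
    by apply: le_lt_trans; rewrite -raddfB Re_le_cmod.
  have [|G2 h2] := @real_antiderivative (fun t => complex.Im (g t)) b.
    move=> t e e0; have [d d0 h] := cg t e e0; exists d => // y /h.
    by apply: le_lt_trans; rewrite -raddfB Im_le_cmod.
  exists (fun t => Complex (G1 t) (G2 t)) => t tb.
  apply: rderivP => e e0; have e2 : 0 < e / 2 by lra.
  have [d1 d10 k1] := (real_derivP _ _ _).1 (h1 t tb) _ e2.
  have [d2 d20 k2] := (real_derivP _ _ _).1 (h2 t tb) _ e2.
  exists (Num.min d1 d2); first by rewrite lt_min d10.
  move=> y; rewrite lt_min => /andP[/k1 l1 /k2 l2].
  apply: le_trans (cmod_le_ReIm _) _.
  move: l1 l2; case: (g t) => p q /= l1 l2.
  rewrite !mul0r subr0 addr0; lra.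
have [G hG] := choice H.
(* Primitives on the intervals []-b, b[], normalised to vanish at 0, agree on overlaps, so the
   interval may grow with the point. *)
pose F x := G (`|x| + 1) x - G (`|x| + 1) 0.
have FE (b x : R) : `|x| < b -> F x = G b x - G b 0.
  move=> xb; have E : G (`|x| + 1) x - G b x = G (`|x| + 1) 0 - G b 0.
    apply: (@rderiv0_eq (fun s => G (`|x| + 1) s - G b s)) => t xt.
    have tx : `|t| <= `|x|.
      have l1 := ler_norm x; have l2 := ler_norm (- x); rewrite normrN in l2.
      by rewrite ler_norml; case: xt => /andP[x1 x2]; apply/andP; split; lra.
    rewrite -(subrr (g t)); apply: rderiv_add.
      by apply: hG; rewrite -ltr_norml; lra.
    by apply: rderiv_opp; apply: hG; rewrite -ltr_norml; lra.
  rewrite /F -[G _ x](subrK (G b x)) E; ring.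
exists F => t.
apply: (@rderiv_ext (fun x => G (`|t| + 2) x + - G (`|t| + 2) 0) _ _ _ 1 ltr01).
  move=> y yt; rewrite (FE (`|t| + 2))//.
  by have := rn_dist rn_abs y t; lra.
rewrite -[g t]addr0; apply: rderiv_add; last exact: rderiv_cst.
apply: hG; rewrite -ltr_norml; lra.
Qed.

(** The integral is the increment of one primitive chosen from [g] alone. Reversing or splitting the
    interval of integration is therefore an algebraic identity, which [ring] settles in the lemmas
    on rectangles. *)
Definition cint (g : R -> C) a b : C :=
  let G := xget (fun=> 0) [set G : R -> C | forall t, rderiv G t (g t)] in
  G b - G a.

Lemma cintE (g G : R -> C) a b :
  (forall t, rderiv G t (g t)) -> cint g a b = G b - G a.
Proof.
move=> hG; rewrite /cint.
have /(xgetI (fun=> 0)) /= hF : [set G : R -> C | forall t, rderiv G t (g t)] G by [].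
set F := xget _ _ in hF *.
have E : F b - G b = F a - G a.
  apply: (@rderiv0_eq (fun s => F s - G s)) => t _.
  by rewrite -(subrr (g t)); apply: rderiv_add => //; exact: rderiv_opp.
rewrite -[F b](subrK (G b)) E; ring.
Qed.

Section Cint.
Variables (f g : R -> C).
Hypotheses (cf : forall t, rcont f t) (cg : forall t, rcont g t).

Lemma cint_add a b : cint (fun t => f t + g t) a b = cint f a b + cint g a b.
Proof.
have [F hF] := antiderivative cf; have [G hG] := antiderivative cg.
rewrite (cintE _ _ hF) (cintE _ _ hG) (@cintE _ (fun t => F t + G t)).
  by ring.
by move=> t; exact: rderiv_add.
Qed.

Lemma cint_scale c a b : cint (fun t => c * f t) a b = c * cint f a b.
Proof.
have [F hF] := antiderivative cf.
rewrite (cintE _ _ hF) (@cintE _ (fun t => c * F t)); first by ring.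
move=> t; have := rderiv_mul (rderiv_cst c t) (hF t).
by rewrite mul0r add0r.
Qed.

Lemma cint_le a b K : a <= b -> (forall t, a <= t <= b -> cmod (f t) <= K) ->
  cmod (cint f a b) <= K * (b - a).
Proof.
move=> ab h; have [F hF] := antiderivative cf.
by rewrite (cintE _ _ hF); apply: (@mean_value_le F f).
Qed.

End Cint.

End RealVariable.

Notation rcont := (contat (fun x => `|x|) (@cmod _)).
Notation ccont := (contat (@cmod _) (@cmod _)).

(** * Goursat's theorem and primitives on discs *)

Section Goursat.
Context {R : realType}.
Local Notation C := R[i].

Lemma pow_small (q M e : R) : 0 <= q -> q < 1 -> 0 < e -> exists k, M * q ^+ k < e.
Proof.
move=> q0 q1 e0.
have /cvgrPdist_lt : (GRing.exp q : R^nat) @ \oo --> 0.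
  by apply: cvg_expr; rewrite ger0_norm.
have p : 0 < `|M| + 1 by rewrite ltr_wpDl.
move=> /(_ (e / (`|M| + 1))) []; first by rewrite divr_gt0.
move=> k _ /(_ k (leqnn k)) /=; rewrite sub0r normrN ger0_norm ?exprn_ge0//.
rewrite ltr_pdivlMr// => h; exists k.
apply: le_lt_trans h; rewrite mulrC ler_wpM2l ?exprn_ge0//.
by have := ler_norm M; lra.
Qed.

Lemma cint_approx (f : R -> C) a b c (K : R) : (forall t, rcont f t) ->
  (forall t, Num.min a b <= t <= Num.max a b -> cmod (f t - c) <= K) ->
  cmod (cint f a b - ((b - a)%:C)%C * c) <= K * `|b - a|.
Proof.
move=> cf; wlog ab : a b / a <= b => [H|] h.
  have [/H|/ltW ba] := leP a b; first exact.
  rewrite distrC -(rnN rn_cmod).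
  have -> : - (cint f a b - ((b - a)%:C)%C * c) = cint f b a - ((a - b)%:C)%C * c.
    by rewrite /cint !rmorphB /=; ring.
  by apply: H => // t; rewrite minC maxC; exact: h.
rewrite (min_idPl ab) (max_idPr ab) in h.
have [F hF] := antiderivative cf; rewrite (cintE _ _ hF).
rewrite ger0_norm ?subr_ge0//.
have := @mean_value_le R (fun t => F t + - ((t%:C)%C * c)) (fun t => f t - c) a b K ab.
have -> : F b + - (b%:C%C * c) - (F a + - (a%:C%C * c)) =
   F b - F a - (b - a)%:C%C * c by rewrite rmorphB /=; ring.
apply=> // t tab; apply: rderiv_add => //; apply: rderiv_opp.
by have := rderiv_mul (rderiv_id t) (rderiv_cst c t); rewrite mul1r mulr0 addr0.
Qed.

Lemma cint_le_abs (f : R -> C) a b (K : R) : (forall t, rcont f t) ->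
  (forall t, Num.min a b <= t <= Num.max a b -> cmod (f t) <= K) ->
  cmod (cint f a b) <= K * `|b - a|.
Proof.
move=> cf h; have := @cint_approx f a b 0 K cf; rewrite mulr0 subr0; apply=> t /h.
by rewrite subr0.
Qed.

Section Rectangle.
Variable phi : C -> C.
Hypothesis cphi : forall z, ccont phi z.

Definition hint x1 x2 y : C := cint (fun t => phi (Complex t y)) x1 x2.
Definition vint x y1 y2 : C := cint (fun t => phi (Complex x t)) y1 y2.
(** The integral of phi(z) dz along the boundary of a rectangle, counterclockwise if [x1 <= x2] and
    [y1 <= y2]; exchanging one pair of endpoints changes the sign. *)
Definition rectint x1 x2 y1 y2 : C :=
  hint x1 x2 y1 + 'i%C * vint x2 y1 y2 - hint x1 x2 y2 - 'i%C * vint x1 y1 y2.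

Lemma hcont y t : rcont (fun t => phi (Complex t y)) t.
Proof.
apply: contat_comp (cphi _) => e e0; exists e => // s.
by rewrite -[Complex s y - _]/(Complex (s - t) (y - y)) subrr -cmodR.
Qed.

Lemma vcont x t : rcont (fun t => phi (Complex x t)) t.
Proof.
apply: contat_comp (cphi _) => e e0; exists e => // s.
rewrite -[Complex x s - _]/(Complex (x - x) (s - t)) subrr.
by rewrite cmodE expr0n add0r sqrtr_sqr.
Qed.

Lemma rectint_split x1 x x2 y1 y y2 : rectint x1 x2 y1 y2 =
  rectint x1 x y1 y + rectint x x2 y1 y + rectint x1 x y y2 + rectint x x2 y y2.
Proof. by rewrite /rectint /hint /vint /cint; ring. Qed.

Lemma rectint_le x1 x2 y1 y2 (K : R) :
  (forall x y, Num.min x1 x2 <= x <= Num.max x1 x2 ->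
     Num.min y1 y2 <= y <= Num.max y1 y2 -> cmod (phi (Complex x y)) <= K) ->
  cmod (rectint x1 x2 y1 y2) <= 2 * K * (`|x2 - x1| + `|y2 - y1|).
Proof.
move=> h.
have hh y : Num.min y1 y2 <= y <= Num.max y1 y2 ->
    cmod (hint x1 x2 y) <= K * `|x2 - x1|.
  by move=> hy; apply: cint_le_abs => [t|t tx]; [exact: hcont|exact: h].
have hv x : Num.min x1 x2 <= x <= Num.max x1 x2 ->
    cmod (vint x y1 y2) <= K * `|y2 - y1|.
  by move=> hy; apply: cint_le_abs => [t|t tx]; [exact: vcont|exact: h].
have mM (a b : R) : (Num.min a b <= a <= Num.max a b) /\ (Num.min a b <= b <= Num.max a b).
  by rewrite !ge_min !le_max !lexx !orbT.
have := hh y1 (mM _ _).1; have := hh y2 (mM _ _).2.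
have := hv x1 (mM _ _).1; have := hv x2 (mM _ _).2.
rewrite /rectint; set A := hint _ _ y1; set B := vint x2 _ _.
set D := hint _ _ _; set E := vint _ _ _ => l1 l2 l3 l4.
have := rnD rn_cmod (A + 'i%C * B - D) (- ('i%C * E)).
have := rnD rn_cmod (A + 'i%C * B) (- D).
have := rnD rn_cmod A ('i%C * B).
rewrite !(rnN rn_cmod) !cmodM !cmodi !mul1r; lra.
Qed.

End Rectangle.

Lemma rectint_affine (a b : C) x1 x2 y1 y2 :
  rectint (fun z => a + b * z) x1 x2 y1 y2 = 0.
Proof.
have ii : 'i%C * 'i%C = -1 :> C by rewrite -expr2 sqr_i.
have E (x y : R) : Complex x y = (x%:C)%C + 'i%C * (y%:C)%C by rewrite [LHS]complexE.
have dsq t : rderiv (fun t : R => (t%:C)%C * (t%:C)%C / 2) t (t%:C)%C.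
  have := rderiv_mul (rderiv_mul (rderiv_id t) (rderiv_id t)) (rderiv_cst 2^-1 t).
  suff -> : (1 * (t%:C)%C + (t%:C)%C * 1) * 2^-1 + (t%:C)%C * (t%:C)%C * 0 = (t%:C)%C by [].
  by rewrite mulr0 addr0; field.
have dh y t : rderiv (fun t : R => (a + b * ('i%C * (y%:C)%C)) * (t%:C)%C +
    b * ((t%:C)%C * (t%:C)%C / 2)) t (a + b * Complex t y).
  have := rderiv_add (rderiv_mul (rderiv_cst (a + b * ('i%C * (y%:C)%C)) t) (rderiv_id t))
    (rderiv_mul (rderiv_cst b t) (dsq t)).
  by congr rderiv; rewrite (E t y); ring.
have dv x t : rderiv (fun t : R => (a + b * (x%:C)%C) * (t%:C)%C +
    b * 'i%C * ((t%:C)%C * (t%:C)%C / 2)) t (a + b * Complex x t).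
  have := rderiv_add (rderiv_mul (rderiv_cst (a + b * (x%:C)%C) t) (rderiv_id t))
    (rderiv_mul (rderiv_cst (b * 'i%C) t) (dsq t)).
  by congr rderiv; rewrite (E x t); ring.
rewrite /rectint /hint /vint !(cintE _ _ (dh _)) !(cintE _ _ (dv _)).
transitivity (('i%C * 'i%C + 1) * b * ((y2%:C)%C ^+ 2 - (y1%:C)%C ^+ 2) / 2 * 0); last by rewrite mulr0.
ring: ii.
Qed.

End Goursat.

Section Primitive.
Context {R : realType}.
Local Notation C := R[i].

Section Continuous.
Variable phi : C -> C.
Hypothesis cphi : forall z, ccont phi z.

(** Used with the first order Taylor polynomial of [phi] at the limit point of the bisection, so
    that only the remainder is integrated. *)
Lemma rectint_sub_affine (a b : C) x1 x2 y1 y2 : rectint phi x1 x2 y1 y2 =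
  rectint (fun z => phi z + - (a + b * z)) x1 x2 y1 y2.
Proof.
have ca z : ccont (fun z => - (a + b * z)) z.
  apply: (contat_opp rn_cmod); apply: cderiv_cont.
  exact: cderiv_add (cderiv_cst _ _) (cderiv_mul (cderiv_cst _ _) (cderiv_id _)).
have oppE z : - (a + b * z) = - a + (- b) * z by ring.
have hE y : hint (fun z => phi z + - (a + b * z)) x1 x2 y =
    hint phi x1 x2 y + hint (fun z => - (a + b * z)) x1 x2 y.
  by apply: cint_add => t; [exact: hcont|exact: (hcont ca)].
have vE x : vint (fun z => phi z + - (a + b * z)) x y1 y2 =
    vint phi x y1 y2 + vint (fun z => - (a + b * z)) x y1 y2.
  by apply: cint_add => t; [exact: vcont|exact: (vcont ca)].
have := rectint_affine (- a) (- b) x1 x2 y1 y2.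
rewrite -(funext oppE) /rectint !hE !vE => A0.
apply/esym/eqP; rewrite -subr_eq0; apply/eqP; rewrite -[RHS]A0; ring.
Qed.

Lemma goursat_quarter x1 w y1 h : exists p : R * R,
  [/\ p.1 = x1 \/ p.1 = x1 + w / 2, p.2 = y1 \/ p.2 = y1 + h / 2 &
   cmod (rectint phi x1 (x1 + w) y1 (y1 + h)) <=
   4 * cmod (rectint phi p.1 (p.1 + w / 2) p.2 (p.2 + h / 2))].
Proof.
apply: contrapT => H.
pose q x y := cmod (rectint phi x (x + w / 2) y (y + h / 2)).
pose T := cmod (rectint phi x1 (x1 + w) y1 (y1 + h)).
have K (x y : R) : x = x1 \/ x = x1 + w / 2 -> y = y1 \/ y = y1 + h / 2 ->
    4 * q x y < T.
  move=> hx hy; rewrite ltNge; apply/negP => k; apply: H.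
  by exists (x, y); split.
have k1 := K x1 y1 (or_introl erefl) (or_introl erefl).
have k2 := K _ y1 (or_intror erefl) (or_introl erefl).
have k3 := K x1 _ (or_introl erefl) (or_intror erefl).
have k4 := K _ _ (or_intror erefl) (or_intror erefl).
move: k1 k2 k3 k4; rewrite /q -!(addrA x1) -!(addrA y1) -!splitr.
have := rectint_split phi x1 (x1 + w / 2) (x1 + w) y1 (y1 + h / 2) (y1 + h).
rewrite /T => ->.
set A := rectint _ _ _ _ _; set B := rectint _ _ _ _ _.
set D := rectint _ _ _ _ _; set E := rectint _ _ _ _ _ => l1 l2 l3 l4.
have := rnD rn_cmod (A + B + D) E; have := rnD rn_cmod (A + B) D.
have := rnD rn_cmod A B; lra.
Qed.

Lemma goursat x1 x2 y1 y2 : x1 <= x2 -> y1 <= y2 ->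
  (forall x y, x1 <= x <= x2 -> y1 <= y <= y2 ->
     exists d, cderiv phi (Complex x y) d) ->
  rectint phi x1 x2 y1 y2 = 0.
Proof.
move=> x12 y12 dphi; apply/eqP; rewrite -cmod_eq0; apply/negP => /negP T0.
pose w := x2 - x1; pose h := y2 - y1.
have w0 : 0 <= w by rewrite subr_ge0.
have h0 : 0 <= h by rewrite subr_ge0.
pose q k : R := 2^-1 ^+ k.
have q0 k : 0 <= q k by rewrite exprn_ge0// invr_ge0.
have qS k : q k.+1 = q k / 2 by rewrite /q exprS mulrC.
have /choice[F hF] : forall kp : nat * (R * R), exists p : R * R,
    [/\ p.1 = kp.2.1 \/ p.1 = kp.2.1 + w * q kp.1 / 2,
        p.2 = kp.2.2 \/ p.2 = kp.2.2 + h * q kp.1 / 2 &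
    cmod (rectint phi kp.2.1 (kp.2.1 + w * q kp.1) kp.2.2 (kp.2.2 + h * q kp.1)) <=
    4 * cmod (rectint phi p.1 (p.1 + w * q kp.1 / 2) p.2 (p.2 + h * q kp.1 / 2))].
  by move=> [k [x y]] /=; exact: goursat_quarter.
(* [s k] is the lower left corner of the k-th rectangle, whose sides are [w * q k] and [h * q k]
   with q(k) = 2^-k. *)
pose s := fix s k : R * R := if k is k'.+1 then F (k', s k') else (x1, y1).
pose T k := cmod (rectint phi (s k).1 ((s k).1 + w * q k) (s k).2 ((s k).2 + h * q k)).
have TS k : T k <= 4 * T k.+1.
  have [_ _] := hF (k, s k); rewrite /T qS !mulrA.
  by apply.
have sS1 k : (s k).1 <= (s k.+1).1 /\ (s k.+1).1 + w * q k.+1 <= (s k).1 + w * q k.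
  have [+ _ _] := hF (k, s k); rewrite [F (k, s k)]/(s k.+1) qS /=.
  have wq := mulr_ge0 w0 (q0 k); case=> ->; lra.
have sS2 k : (s k).2 <= (s k.+1).2 /\ (s k.+1).2 + h * q k.+1 <= (s k).2 + h * q k.
  have [_ + _] := hF (k, s k); rewrite [F (k, s k)]/(s k.+1) qS /=.
  have hq := mulr_ge0 h0 (q0 k); case=> ->; lra.
have mono k j : (s k).1 <= (s (k + j)%N).1 /\
    (s (k + j)%N).1 + w * q (k + j)%N <= (s k).1 + w * q k.
  elim: j => [|j [i1 i2]]; first by rewrite addn0.
  rewrite addnS; have [] := sS1 (k + j)%N; lra.
have mono2 k j : (s k).2 <= (s (k + j)%N).2 /\
    (s (k + j)%N).2 + h * q (k + j)%N <= (s k).2 + h * q k.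
  elim: j => [|j [i1 i2]]; first by rewrite addn0.
  rewrite addnS; have [] := sS2 (k + j)%N; lra.
have cross1 k j : (s j).1 <= (s k).1 + w * q k.
  have [kj|/ltnW jk] := leqP k j.
    rewrite -(subnKC kj); have [_] := mono k (j - k)%N.
    have := mulr_ge0 w0 (q0 (k + (j - k))%N); lra.
  have [] := mono j (k - j)%N; rewrite (subnKC jk).
  have := mulr_ge0 w0 (q0 k); lra.
have cross2 k j : (s j).2 <= (s k).2 + h * q k.
  have [kj|/ltnW jk] := leqP k j.
    rewrite -(subnKC kj); have [_] := mono2 k (j - k)%N.
    have := mulr_ge0 h0 (q0 (k + (j - k))%N); lra.
  have [] := mono2 j (k - j)%N; rewrite (subnKC jk).
  have := mulr_ge0 h0 (q0 k); lra.
(* The nested rectangles share the point whose coordinates are the suprema of those of the lower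
   left corners. *)
pose X := sup [set (s k).1 | k in setT]; pose Y := sup [set (s k).2 | k in setT].
have X1 k : (s k).1 <= X <= (s k).1 + w * q k.
  apply/andP; split.
    apply: ub_le_sup; last by exists k.
    by exists ((s 0%N).1 + w * q 0%N) => _ [j _ <-]; exact: cross1.
  apply: ge_sup; first by exists (s 0%N).1, 0%N.
  by move=> _ [j _ <-]; exact: cross1.
have Y1 k : (s k).2 <= Y <= (s k).2 + h * q k.
  apply/andP; split.
    apply: ub_le_sup; last by exists k.
    by exists ((s 0%N).2 + h * q 0%N) => _ [j _ <-]; exact: cross2.
  apply: ge_sup; first by exists (s 0%N).2, 0%N.
  by move=> _ [j _ <-]; exact: cross2.
have [d [_ _ hd]] : exists d, cderiv phi (Complex X Y) d.
  have := X1 0%N; have := Y1 0%N; rewrite /= /q expr0 !mulr1 /w /h.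
  by rewrite !(addrC _ (_ - _)) !subrK => ? ?; exact: dphi.
have T00 : T 0%N = cmod (rectint phi x1 x2 y1 y2).
  by rewrite /T /= /q expr0 !mulr1 /w /h ![_ + (_ - _)]addrC !subrK.
have Tk k : T 0%N <= 4 ^+ k * T k.
  elim: k => [|k IH]; first by rewrite expr0 mul1r.
  by apply: le_trans IH _; rewrite exprSr -mulrA ler_wpM2l// exprn_ge0.
have T0p : 0 < T 0%N by rewrite T00 lt0r cmod_ge0 andbT.
have M0 : 0 <= (w + h) ^+ 2 by exact: sqr_ge0.
(* The estimate below gives [T 0 <= 2 * e * (w + h) ^+ 2]; the added 1 makes the right-hand side
   smaller than [T 0], also for a degenerate rectangle. *)
pose e := T 0%N / (2 * ((w + h) ^+ 2 + 1)).
have e0 : 0 < e by rewrite divr_gt0// mulr_gt0// ltr_wpDl.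
have [del del0 hdel] := hd e e0.
have [||k hk] := @pow_small R 2^-1 (w + h) del _ _ del0; [lra|lra|].
rewrite -/(q k) in hk.
have small x y : (s k).1 <= x <= (s k).1 + w * q k ->
   (s k).2 <= y <= (s k).2 + h * q k ->
   cmod (phi (Complex x y) + - (phi (Complex X Y) - Complex X Y * d + d * Complex x y))
     <= e * ((w + h) * q k).
  move=> hx hy.
  have lt1 : cmod (Complex x y - Complex X Y) <= (w + h) * q k.
    apply: le_trans (cmod_le_ReIm _) _ => /=.
    have := X1 k; have := Y1 k; move: hx hy.
    move=> /andP[? ?] /andP[? ?] /andP[? ?] /andP[? ?]; rewrite mulrDl.
    by apply: lerD; rewrite ler_norml; apply/andP; split; lra.
  have := hdel (Complex x y) (le_lt_trans lt1 hk).
  have -> : phi (Complex x y) + - (phi (Complex X Y) - Complex X Y * d + d * Complex x y) =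
   phi (Complex x y) - phi (Complex X Y) - (Complex x y - Complex X Y) * d by ring.
  by move/le_trans; apply; rewrite ler_wpM2l// ltW.
have : T k <= 2 * (e * ((w + h) * q k)) * (w * q k + h * q k).
  rewrite /T (rectint_sub_affine (phi (Complex X Y) - Complex X Y * d) d).
  have wq0 := mulr_ge0 w0 (q0 k); have hq0 := mulr_ge0 h0 (q0 k).
  have := @rectint_le R (fun z => phi z + - (phi (Complex X Y) - Complex X Y * d + d * z))
    _ (s k).1 ((s k).1 + w * q k) (s k).2 ((s k).2 + h * q k) (e * ((w + h) * q k)).
  rewrite ![_ + _ - _]addrAC !subrr !add0r !ger0_norm//; apply.
    move=> z; apply: (contat_add rn_cmod) => //.
    apply: (contat_opp rn_cmod); apply: cderiv_cont.
    exact: cderiv_add (cderiv_cst _ _) (cderiv_mul (cderiv_cst _ _) (cderiv_id _)).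
  by rewrite !(min_idPl _) ?(max_idPr _) ?lerDl.
rewrite -mulrDl => Tle.
have : T 0%N <= 2 * e * (w + h) ^+ 2.
  apply: le_trans (Tk k) _; apply: le_trans (ler_wpM2l _ Tle) _.
    by rewrite exprn_ge0.
  (* The perimeter and the size of the remainder contribute one factor 2^-k each, which absorbs the
     factor 4^k of the bisection. *)
  have -> : 4 ^+ k * (2 * (e * ((w + h) * q k)) * ((w + h) * q k)) =
     2 * e * (w + h) ^+ 2 * (4 * (2^-1 * 2^-1)) ^+ k by rewrite /q !exprMn; ring.
  by have -> : 4 * (2^-1 * 2^-1) = 1 :> R by [field]; rewrite expr1n mulr1.
apply/negP; rewrite -ltNge.
have -> : 2 * e * (w + h) ^+ 2 = T 0%N * ((w + h) ^+ 2 / ((w + h) ^+ 2 + 1)).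
  by rewrite /e; field; rewrite gt_eqF// ltr_wpDl.
by rewrite gtr_pMr// ltr_pdivrMr ?ltr_wpDl// mul1r ltrDl.
Qed.

Lemma goursat_signed x1 x2 y1 y2 :
  (forall x y, Num.min x1 x2 <= x <= Num.max x1 x2 ->
     Num.min y1 y2 <= y <= Num.max y1 y2 -> exists d, cderiv phi (Complex x y) d) ->
  rectint phi x1 x2 y1 y2 = 0.
Proof.
have sw1 a b c e : rectint phi a b c e = - rectint phi b a c e.
  by rewrite /rectint /hint /vint /cint; ring.
have sw2 a b c e : rectint phi a b c e = - rectint phi a b e c.
  by rewrite /rectint /hint /vint /cint; ring.
wlog x12 : x1 x2 / x1 <= x2 => [H h|].
  have [/H|/ltW x21] := leP x1 x2; first exact.
  by rewrite sw1 H ?oppr0// => x y; rewrite (minC x2) (maxC x2); exact: h.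
wlog y12 : y1 y2 / y1 <= y2 => [H h|].
  have [/H|/ltW y21] := leP y1 y2; first exact.
  by rewrite sw2 H ?oppr0// => x y hx; rewrite (minC y2) (maxC y2); exact: h.
rewrite !(min_idPl _)// !(max_idPr _)//; exact: goursat.
Qed.

End Continuous.

End Primitive.

(** * Primitives in the presence of one exceptional point *)

Section DiscPrimitive.
Context {R : realType}.
Local Notation C := R[i].

Lemma minmax_dist (a b t : R) :
  Num.min a b <= t <= Num.max a b -> `|t - a| <= `|b - a|.
Proof.
rewrite ge_min le_max => /andP[k1 k2].
have n1 := ler_norm (b - a); have n2 := ler_norm (- (b - a)).
rewrite normrN in n2; have n3 : 0 <= `|b - a| by [].
rewrite ler_norml; apply/andP; split.
  by case/orP: k1 => k1; lra.
by case/orP: k2 => k2; lra.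
Qed.

Section Square.
Variables (phi : C -> C) (s u v : R).
Hypothesis cphi : forall z, ccont phi z.
Hypotheses (us : `|u| < s) (vs : `|v| < s).
Hypothesis dphi : forall x y, `|x| < s -> `|y| < s -> Complex x y != Complex u v ->
  exists d, cderiv phi (Complex x y) d.

(* A single exceptional point is harmless: it may be taken to be a corner of the
   rectangle, and then a vanishingly small square at that corner is cut off. *)
Lemma rectint_corner x y : `|x| < s -> `|y| < s -> rectint phi u x v y = 0.
Proof.
move=> xs ys.
have [->|xu] := eqVneq x u; first by rewrite /rectint /hint /vint /cint; ring.
have [->|yv] := eqVneq y v; first by rewrite /rectint /hint /vint /cint; ring.
pose x' e := u + e * (x - u); pose y' e := v + e * (y - v).
have E e : 0 < e -> e < 1 -> rectint phi u x v y = rectint phi u (x' e) v (y' e).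
  move=> e0 e1; rewrite (rectint_split _ _ (x' e) _ _ (y' e)).
  have btw a b t : `|a| < s -> `|b| < s -> Num.min a (a + e * (b - a)) <= t <= Num.max a (a + e * (b - a))
      -> `|t| < s.
    rewrite !ltr_norml => /andP[a1 a2] /andP[b1 b2] /andP[].
    rewrite ge_min le_max => h1 h2; apply/andP; split.
      by case/orP: h1 => h1; nra.
    by case/orP: h2 => h2; nra.
  have btw2 a b t : a != b -> `|a| < s -> `|b| < s ->
      Num.min (a + e * (b - a)) b <= t <= Num.max (a + e * (b - a)) b
      -> `|t| < s /\ t != a.
    rewrite neq_lt !ltr_norml => ab /andP[a1 a2] /andP[b1 b2] /andP[].
    rewrite ge_min le_max neq_lt => h1 h2; split.
      apply/andP; split; first by case/orP: h1 => h1; nra.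
      by case/orP: h2 => h2; nra.
    apply/orP; case/orP: ab => ab; [right|left].
      by case/orP: h1 => h1; nra.
    by case/orP: h2 => h2; nra.
  rewrite eq_sym in xu; rewrite eq_sym in yv.
  have neq1 a b c d : a != c -> Complex a b != Complex c d :> C.
    by move=> ac; apply: contra ac => /eqP[->].
  have neq2 a b c d : b != d -> Complex a b != Complex c d :> C.
    by move=> ac; apply: contra ac => /eqP[_ ->].
  rewrite (@goursat_signed R phi cphi (x' e) (x) (v) (y' e))//; last first.
    move=> p q /(btw2 _ _ _ xu us xs)[p1 p2] /(btw _ _ _ vs ys) p3.
    by apply: dphi => //; exact: neq1.
  rewrite (@goursat_signed R phi cphi (u) (x' e) (y' e) (y))//; last first.
    move=> p q /(btw _ _ _ us xs) p3 /(btw2 _ _ _ yv vs ys)[p1 p2].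
    by apply: dphi => //; exact: neq2.
  rewrite (@goursat_signed R phi cphi (x' e) (x) (y' e) (y))//; last first.
    move=> p q /(btw2 _ _ _ xu us xs)[p1 p2] /(btw2 _ _ _ yv vs ys)[p3 p4].
    by apply: dphi => //; exact: neq1.
  by rewrite !addr0.
apply/eqP; rewrite -cmod_eq0; apply/negP => /negP T0.
have Tp : 0 < cmod (rectint phi u x v y) by rewrite lt0r T0 cmod_ge0.
set T := cmod _ in Tp.
pose M := `|x - u| + `|y - v| + 1.
have Mp : 0 < M by rewrite ltr_wpDl// addr_ge0.
have [d d0 hd] := contat_bound (cphi (Complex u v)).
pose K := cmod (phi (Complex u v)) + 1.
have K0 : 0 < K by rewrite ltr_wpDl ?cmod_ge0.
(* The three bounds keep the small rectangle inside the large one, keep it in the neighbourhood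
   where [phi] is bounded by [K], and make its boundary integral at most [T / 2]. *)
pose e := Num.min (1 / 2) (Num.min (d / (2 * M)) (T / (4 * K * M))).
have e0 : 0 < e by rewrite !lt_min !divr_gt0// ?mulr_gt0.
have e1 : e < 1 by rewrite /e gt_min; apply/orP; left; lra.
have e2 : e * M <= d / 2.
  apply: (@le_trans _ _ (d / (2 * M) * M)).
    by rewrite ler_wpM2r ?(ltW Mp)// !ge_min lexx !orbT.
  by rewrite le_eqVlt; apply/orP; left; apply/eqP; field; rewrite gt_eqF.
have e3 : e * M * K <= T / 4.
  apply: (@le_trans _ _ (T / (4 * K * M) * M * K)).
    by rewrite !ler_wpM2r ?(ltW Mp) ?(ltW K0)// !ge_min lexx !orbT.
  by rewrite le_eqVlt; apply/orP; left; apply/eqP; field; rewrite !gt_eqF.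
have : T <= 2 * K * (`|x' e - u| + `|y' e - v|).
  rewrite /T (E e)//; apply: rectint_le => // p q hp hq.
  apply: hd; apply: le_lt_trans (cmod_le_ReIm _) _ => /=.
  have := minmax_dist hp; have := minmax_dist hq.
  rewrite ![_ + _ - _]addrAC !subrr !add0r !normrM (gtr0_norm e0); move: e2; rewrite /M; nra.
rewrite /x' /y' ![_ + _ - _]addrAC !subrr !add0r !normrM gtr0_norm// -mulrDr.
have : e * (`|x - u| + `|y - v|) <= e * M by rewrite ler_wpM2l ?(ltW e0)// lerDl.
nra.
Qed.

Lemma square_primitive : exists Phi : C -> C, forall x y, `|x| < s -> `|y| < s ->
  cderiv Phi (Complex x y) (phi (Complex x y)).
Proof.
(* The path starts at the exceptional point, runs along y = v and then vertically. Both rectangles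
   that compare two such paths have the exceptional point as a corner, so [rectint_corner] applies
   to them. *)
exists (fun z => hint phi u (complex.Re z) v + 'i%C * vint phi (complex.Re z) v (complex.Im z)).
move=> x y xs ys; apply: cderivP => e e0 /=.
have e4 : 0 < e / 4 by lra.
have [d1 d10 h1] := cphi (Complex x y) e4.
pose d := Num.min d1 (Num.min (s - `|x|) (s - `|y|)).
have d0 : 0 < d by rewrite !lt_min d10 !subr_gt0 xs.
exists (d / 2); first by rewrite divr_gt0.
move=> [x' y']; pose z := Complex (x' - x) (y' - y).
have -> : Complex x' y' - Complex x y = z by [].
move=> /= hd.
have hx : `|x' - x| <= cmod z := Re_le_cmod z.
have hy : `|y' - y| <= cmod z := Im_le_cmod z.
have dd : d <= d1 /\ d <= s - `|x| /\ d <= s - `|y|.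
  by rewrite !ge_min !lexx !orbT.
have x's : `|x'| < s by have := rn_dist rn_abs x' x; lra.
have y's : `|y'| < s by have := rn_dist rn_abs y' y; lra.
have T1 := rectint_corner xs ys; have T2 := rectint_corner x's ys.
have -> : hint phi u x' v + 'i%C * vint phi x' v y' -
   (hint phi u x v + 'i%C * vint phi x v y) - z * phi (Complex x y) =
   rectint phi u x' v y - rectint phi u x v y +
   ((hint phi x x' y - ((x' - x)%:C)%C * phi (Complex x y)) +
   'i%C * (vint phi x' y y' - ((y' - y)%:C)%C * phi (Complex x y))).
  have -> : z = ((x' - x)%:C)%C + 'i%C * ((y' - y)%:C)%C by rewrite [LHS]complexE.
  by rewrite /rectint /hint /vint /cint; ring.
rewrite T1 T2 subrr add0r.
have near (p q : R) : Num.min x x' <= p <= Num.max x x' ->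
    Num.min y y' <= q <= Num.max y y' ->
    cmod (phi (Complex p q) - phi (Complex x y)) <= e / 4.
  move=> hp hq; apply/ltW/h1.
  rewrite -[Complex p q - _]/(Complex (p - x) (q - y)).
  apply: le_lt_trans (cmod_le_ReIm _) _ => /=.
  have := minmax_dist hp; have := minmax_dist hq; lra.
have mM (a b : R) : (Num.min a b <= a <= Num.max a b) /\ (Num.min a b <= b <= Num.max a b).
  by rewrite !ge_min !le_max !lexx !orbT.
apply: le_trans (rnD rn_cmod _ _) _; rewrite cmodM cmodi mul1r.
have l1 : cmod (hint phi x x' y - ((x' - x)%:C)%C * phi (Complex x y)) <= e / 4 * `|x' - x|.
  apply: cint_approx => [t|t ht]; first exact: hcont.
  by apply: near => //; exact: (mM y y').1.
have l2 : cmod (vint phi x' y y' - ((y' - y)%:C)%C * phi (Complex x y)) <= e / 4 * `|y' - y|.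
  apply: cint_approx => [t|t ht]; first exact: vcont.
  by apply: near => //; exact: (mM x x').2.
have := ler_wpM2l (ltW e4) hx; have := ler_wpM2l (ltW e4) hy.
have := mulr_ge0 (ltW e0) (cmod_ge0 z); lra.
Qed.

End Square.

(** The retraction of the line onto [[-s, s]]. Applied to both coordinates it extends a function
    that is continuous near a square to one continuous on the whole plane, as the lemmas on
    rectangles require. *)
Definition clamp (s x : R) := Num.max (- s) (Num.min s x).

Lemma clamp_le s x : 0 <= s -> `|clamp s x| <= s.
Proof.
move=> s0; rewrite ler_norml /clamp le_max lexx/= ge_max ge_min lexx andbT.
by lra.
Qed.

Lemma clamp_id s x : `|x| < s -> clamp s x = x.
Proof.
by move=> /ltr_normlP[a b]; rewrite /clamp (min_idPr _) ?(max_idPr _)//; lra.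
Qed.

Lemma clamp_lip s x y : 0 <= s -> `|clamp s x - clamp s y| <= `|x - y|.
Proof.
move=> s0.
have n1 := ler_norm (x - y); have n2 := ler_norm (- (x - y)); rewrite normrN in n2.
have n0 : 0 <= `|x - y| by [].
have cE t : [\/ t <= - s /\ clamp s t = - s, (- s <= t /\ t <= s) /\ clamp s t = t |
    s <= t /\ clamp s t = s].
  rewrite /clamp; have [h|h] := leP s t.
    by apply: Or33; split=> //; rewrite (max_idPr _)//; lra.
  have [h'|h'] := leP (- s) t; last by apply: Or31; split=> //; exact: ltW.
  by apply: Or32; split=> //; split=> //; exact: ltW.
rewrite ler_norml; apply/andP.
by case: (cE x) => -[hx ->]; case: (cE y) => -[hy ->]; split; lra.
Qed.

Lemma disc_primitive (phi : C -> C) (c w : C) (r : R) : cmod (w - c) < r / 2 ->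
  (forall z, cmod (z - c) < r -> ccont phi z) ->
  (forall z, cmod (z - c) < r -> z != w -> exists d, cderiv phi z d) ->
  exists Phi : C -> C, forall z, cmod (z - c) < r / 2 -> cderiv Phi z (phi z).
Proof.
(* The square of half side 2r/3 contains the disc of radius r/2, and its corners, at distance (2
   sqrt 2 / 3) r, lie in the disc of radius r. *)
move=> wr cphi dphi; pose s := 2 * r / 3.
have r0 : 0 < r by have := cmod_ge0 (w - c); lra.
have s0 : 0 < s by rewrite /s; lra.
pose k z := Complex (clamp s (complex.Re z)) (clamp s (complex.Im z)).
have kr z : cmod (k z) < r.
  have h1 := clamp_le (complex.Re z) (ltW s0); have h2 := clamp_le (complex.Im z) (ltW s0).
  rewrite -(ltr_pXn2r (n := 2)) ?nnegrE ?cmod_ge0 ?(ltW r0)// cmod_sqr /=.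
  have k1 : clamp s (complex.Re z) ^+ 2 <= s ^+ 2.
    by rewrite -real_normK ?num_real// ler_pXn2r// ?nnegrE// ltW.
  have k2 : clamp s (complex.Im z) ^+ 2 <= s ^+ 2.
    by rewrite -real_normK ?num_real// ler_pXn2r// ?nnegrE// ltW.
  by move: k1 k2; rewrite /s; nra.
pose psi z := phi (c + k z).
have cpsi z : ccont psi z.
  apply: contat_comp; last by apply: cphi; rewrite addrC addKr.
  move=> e e0; exists (e / 2); first by rewrite divr_gt0.
  move=> y hy; rewrite opprD addrACA subrr add0r.
  apply: le_lt_trans (cmod_le_ReIm _) _ => /=.
  have := clamp_lip (complex.Re y) (complex.Re z) (ltW s0).
  have := clamp_lip (complex.Im y) (complex.Im z) (ltW s0).
  have := Re_le_cmod (y - z); have := Im_le_cmod (y - z); rewrite !raddfB/=; lra.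
have inr z : cmod z < r / 2 -> `|complex.Re z| < s /\ `|complex.Im z| < s.
  by have := Re_le_cmod z; have := Im_le_cmod z; rewrite /s; split; lra.
have near z : `|complex.Re z| < s -> `|complex.Im z| < s ->
    exists2 e : R, 0 < e & forall y, cmod (y - z) < e -> phi (c + y) = psi y.
  move=> h1 h2; exists (Num.min (s - `|complex.Re z|) (s - `|complex.Im z|)).
    by rewrite lt_min !subr_gt0 h1.
  move=> y; rewrite lt_min => /andP[y1 y2]; rewrite /psi /k !clamp_id.
  - by case: (y).
  - have := Im_le_cmod (y - z); rewrite raddfB/=.
    have := rn_dist rn_abs (complex.Im y) (complex.Im z); lra.
  - have := Re_le_cmod (y - z); rewrite raddfB/=.
    have := rn_dist rn_abs (complex.Re y) (complex.Re z); lra.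
have [w1 w2] := inr _ wr.
have dpsi x y : `|x| < s -> `|y| < s ->
    Complex x y != Complex (complex.Re (w - c)) (complex.Im (w - c)) ->
    exists d, cderiv psi (Complex x y) d.
  move=> xs ys neq.
  have [e e0 he] := near (Complex x y) xs ys.
  have hr : cmod (Complex x y) < r.
    by have := kr (Complex x y); rewrite /k /= !clamp_id.
  have [||d hd] := dphi (c + Complex x y); first by rewrite addrC addKr.
    apply: contra neq => /eqP <-.
    by rewrite addrC addKr.
  exists d; apply: cderiv_ext e0 he _.
  have := @cderiv_comp R phi (fun y => c + y) (Complex x y) _ _ hd (cderiv_add (cderiv_cst c _) (cderiv_id _)).
  by rewrite add0r mulr1.
have [Phi hPhi] := square_primitive cpsi w1 w2 dpsi.
exists (fun z => Phi (z - c)) => z hz; have [z1 z2] := inr _ hz.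
have [e e0 he] := near _ z1 z2.
have := hPhi _ _ z1 z2.
have -> : Complex (complex.Re (z - c)) (complex.Im (z - c)) = z - c by case: (z - c).
rewrite -he ?subrr ?cmod0// (addrC c) subrK => h.
have := @cderiv_comp R Phi (fun y => y + - c) z _ _ h (cderiv_add (cderiv_id z) (cderiv_cst (- c) z)).
by rewrite addr0 mulr1.
Qed.

End DiscPrimitive.

(** * The Cauchy formula on circles *)

Section CauchyFormula.
Context {R : realType}.
Local Notation C := R[i].

Lemma cderiv_unique (f : C -> C) z d d' : cderiv f z d -> cderiv f z d' -> d = d'.
Proof.
move=> [_ _ h1] [_ _ h2]; apply/eqP; rewrite -subr_eq0 -cmod_eq0.
apply/negP => /negP n0; have np : 0 < cmod (d - d') by rewrite lt0r n0 cmod_ge0.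
have e0 : 0 < cmod (d - d') / 3 by rewrite divr_gt0.
have [d1 d10 k1] := h1 _ e0; have [d2 d20 k2] := h2 _ e0.
pose t := Num.min d1 d2 / 2.
have m0 : 0 < Num.min d1 d2 by rewrite lt_min d10.
have t0 : 0 < t by rewrite divr_gt0.
have [t1 t2] : t < d1 /\ t < d2.
  have : Num.min d1 d2 <= d1 /\ Num.min d1 d2 <= d2 by rewrite !ge_min !lexx orbT.
  by move: m0; rewrite /t; lra.
have ct : cmod (z + (t%:C)%C - z) = t.
  by rewrite addrC addKr cmodR gtr0_norm.
have := k1 (z + (t%:C)%C); have := k2 (z + (t%:C)%C); rewrite ct => /(_ t2) l2 /(_ t1) l1.
have := rn_dist3 rn_cmod ((z + (t%:C)%C - z) * d') (f (z + (t%:C)%C) - f z) ((z + (t%:C)%C - z) * d).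
rewrite -mulrBr cmodM ct (rn_distC rn_cmod d') (rn_distC rn_cmod (_ * d')).
move: l1 l2 np; set A := cmod _; set B := cmod _; set D := cmod _; nra.
Qed.

Definition cis (t : R) : C := Complex (cos t) (sin t).

Lemma cmod_cis t : cmod (cis t) = 1.
Proof. by rewrite cmodE cos2Dsin2 sqrtr1. Qed.

Lemma cis0 : cis 0 = 1. Proof. by rewrite /cis cos0 sin0. Qed.

Lemma cis2pi : cis (2 * pi) = 1.
Proof. by rewrite /cis mulr_natl cos2pi sin2pi. Qed.

Lemma rderiv_cis t : rderiv cis t ('i%C * cis t).
Proof.
apply: rderivP => e e0; have e2 : 0 < e / 2 by lra.
have [d1 d10 h1] := (real_derivP _ _ _).1 (is_derive_cos t) _ e2.
have [d2 d20 h2] := (real_derivP _ _ _).1 (is_derive_sin t) _ e2.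
exists (Num.min d1 d2); first by rewrite lt_min d10.
move=> y; rewrite lt_min => /andP[/h1 k1 /h2 k2].
apply: le_trans (cmod_le_ReIm _) _ => /=.
have -> : cos y - cos t - ((y - t) * (0 * cos t - 1 * sin t) - 0 * (0 * sin t + 1 * cos t))
   = cos y - cos t - (y - t) * - sin t by ring.
have -> : sin y - sin t - ((y - t) * (0 * sin t + 1 * cos t) + 0 * (0 * cos t - 1 * sin t))
   = sin y - sin t - (y - t) * cos t by ring.
lra.
Qed.

Definition cmean (g : R -> C) : C := cint g 0 (2 * pi) / ((2 * pi)%:C)%C.

Lemma twopi_gt0 : 0 < 2 * pi :> R.
Proof. by rewrite mulr_gt0// pi_gt0. Qed.

Lemma twopiC_neq0 : ((2 * pi)%:C)%C != 0 :> C.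
Proof. by rewrite -cmod_gt0 cmodR normr_gt0 gt_eqF// twopi_gt0. Qed.

Section Cmean.
Variables (f g : R -> C).
Hypotheses (cf : forall t, rcont f t) (cg : forall t, rcont g t).

Lemma cmean_add : cmean (fun t => f t + g t) = cmean f + cmean g.
Proof. by rewrite /cmean cint_add// mulrDl. Qed.

Lemma cmean_scale c : cmean (fun t => c * f t) = c * cmean f.
Proof. by rewrite /cmean cint_scale// mulrA. Qed.

Lemma cmean_le K : (forall t, cmod (f t) <= K) -> cmod (cmean f) <= K.
Proof.
move=> h; rewrite /cmean cmodM cmodV cmodR gtr0_norm ?twopi_gt0//.
rewrite ler_pdivrMr ?twopi_gt0// -[X in _ <= _ * X]subr0.
by apply: cint_le => //; exact/ltW/twopi_gt0.
Qed.

Lemma cmean_Re_le0 : (forall t, complex.Re (f t) <= 0) -> complex.Re (cmean f) <= 0.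
Proof.
move=> h; have [F hF] := antiderivative cf.
rewrite /cmean (cintE _ _ hF) mulrC.
have [c _ ->] := @re_mean_value R F f (((2 * pi)%:C)%C^-1) 0 (2 * pi) (ltW twopi_gt0) (fun t _ => hF t).
rewrite pmulr_lle0 ?subr0 ?twopi_gt0//.
have -> : ((2 * pi)%:C)%C^-1 = (((2 * pi)^-1)%:C)%C :> C by rewrite fmorphV.
have := h c; case: (f c) => p q /= p0; rewrite mul0r subr0.
by rewrite pmulr_rle0// invr_gt0 twopi_gt0.
Qed.

End Cmean.

Lemma cmean_cst c : cmean (fun=> c) = c.
Proof.
rewrite /cmean (@cintE _ _ (fun t => (t%:C)%C * c)).
  by rewrite mul0r subr0 mulrC mulKf// twopiC_neq0.
by move=> t; have := rderiv_mul (rderiv_id t) (rderiv_cst c t); rewrite mul1r mulr0 addr0.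
Qed.

Lemma cmean_periodic (g G : R -> C) :
  (forall t, rderiv G t (g t)) -> G 0 = G (2 * pi) -> cmean g = 0.
Proof. by move=> h E; rewrite /cmean (cintE _ _ h) E subrr mul0r. Qed.

Definition circ (rho t : R) : C := (rho%:C)%C * cis t.

Section Circle.
Variables (rho : R).
Hypothesis rho0 : 0 < rho.
Local Notation z := (circ rho).

Lemma cmod_circle t : cmod (z t) = rho.
Proof. by rewrite /circ cmodM cmod_cis mulr1 cmodR gtr0_norm. Qed.

Lemma rderiv_circle t : rderiv z t ('i%C * z t).
Proof.
have := rderiv_mul (rderiv_cst (rho%:C)%C t) (rderiv_cis t).
by congr rderiv; rewrite /z; ring.
Qed.

Lemma rcont_circle t : rcont z t.
Proof. exact: rderiv_cont (rderiv_circle t). Qed.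

Lemma circle_neq (m : C) t : cmod m < rho -> z t - m != 0.
Proof.
by move=> h; rewrite subr_eq0; apply: contraTneq h => <-; rewrite cmod_circle ltxx.
Qed.

Lemma rcont_kernel (m : C) t : cmod m < rho -> rcont (fun t => (z t - m)^-1) t.
Proof.
move=> h; apply: (contat_comp (g := fun w : C => w^-1)).
  by apply: (contat_add rn_cmod); [exact: rcont_circle|exact: contat_cst rn_cmod _ _].
by apply: ccont_inv; exact: circle_neq.
Qed.

Lemma cmod_kernel_le (m : C) t K : cmod m <= K -> K < rho ->
  cmod ((z t - m)^-1) <= (rho - K)^-1.
Proof.
move=> h1 h2; have h3 := le_lt_trans h1 h2.
rewrite cmodV lef_pV2 ?posrE ?subr_gt0//; last by rewrite cmod_gt0 circle_neq.
have := rn_dist rn_cmod (z t) m; rewrite cmod_circle; lra.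
Qed.

(** Cauchy's formula for the constant 1, by deformation of [m] to 0 through s m. The derivative in s
    is the mean of m z / (z - s m)^2, which is 0 because z / (z - s m)^2 is the derivative of i / (z
    - s m) along the circle. Differentiation under the integral is replaced by the quadratic bound
    [lip], which forces the derivative 0. *)
Lemma cmean_kernel (m : C) : cmod m < rho -> cmean (fun t => z t * (z t - m)^-1) = 1.
Proof.
move=> mr; pose k (s : R) := cmean (fun t => z t * (z t - (s%:C)%C * m)^-1).
have sm s : `|s| <= 1 -> cmod ((s%:C)%C * m) <= cmod m.
  by move=> s1; rewrite cmodM cmodR ler_piMl ?cmod_ge0.
have sm' s : `|s| <= 1 -> cmod ((s%:C)%C * m) < rho.
  by move=> /sm h; exact: le_lt_trans h mr.
have ck s t : `|s| <= 1 -> rcont (fun t => z t * (z t - (s%:C)%C * m)^-1) t.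
  move=> s01; apply: (contat_mul); first exact: rcont_circle.
  exact: rcont_kernel (sm' _ s01).
have zero s : `|s| <= 1 -> cmean (fun t => z t * (z t - (s%:C)%C * m)^-1 ^+ 2) = 0.
  move=> s01; apply: (@cmean_periodic _ (fun t => 'i%C * (z t - (s%:C)%C * m)^-1)).
    move=> t; have n0 := circle_neq t (sm' _ s01).
    have d1 : rderiv (fun t => z t - (s%:C)%C * m) t ('i%C * z t).
      by have := rderiv_add (rderiv_circle t) (rderiv_opp (rderiv_cst ((s%:C)%C * m) t)); rewrite oppr0 addr0.
    have := rderiv_mul (rderiv_cst 'i%C t) (rderiv_comp (cderiv_inv n0) d1).
    have ii : 'i%C * 'i%C = -1 :> C by rewrite -expr2 sqr_i.
    congr rderiv; rewrite exprVn.
    transitivity (- ('i%C * 'i%C) * (z t / (z t - (s%:C)%C * m) ^+ 2)); first by ring.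
    by rewrite ii; ring.
  by rewrite /circ cis0 cis2pi.
pose K := (rho - cmod m)^-1.
have K0 : 0 < K by rewrite invr_gt0 subr_gt0.
have lip s s' : `|s| <= 1 -> `|s'| <= 1 ->
    cmod (k s' - k s) <= (rho * cmod m ^+ 2 * K ^+ 3) * `|s' - s| ^+ 2.
  move=> s01 s'01.
  pose A t := z t * (z t - (s%:C)%C * m)^-1 ^+ 2.
  pose B t := (((s' - s)%:C)%C * m) ^+ 2 * (A t * (z t - (s'%:C)%C * m)^-1).
  have cA t : rcont A t.
    apply: contat_mul (rcont_circle t) _; rewrite /A.
    by apply: contat_mul; exact: rcont_kernel (sm' _ s01).
  have cB t : rcont B t.
    apply: contat_mul; first exact: contat_cst rn_cmod _ _.
    by apply: contat_mul => //; exact: rcont_kernel (sm' _ s'01).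
  have cc c (f : R -> C) : (forall t, rcont f t) -> forall t, rcont (fun t => c * f t) t.
    by move=> cf t; apply: contat_mul => //; exact: contat_cst rn_cmod _ _.
  have E : (fun t => z t * (z t - (s'%:C)%C * m)^-1) =
      fun t => z t * (z t - (s%:C)%C * m)^-1 + (((s' - s)%:C)%C * m * A t + B t).
    apply/funext => t; rewrite /B /A rmorphB /=.
    have n1 := circle_neq t (sm' _ s01); have n2 := circle_neq t (sm' _ s'01).
    by field; rewrite n1 n2.
  rewrite /k E cmean_add; last 2 first.
  - by move=> t; exact: ck.
  - by move=> t; apply: (contat_add rn_cmod); [exact: cc|].
  rewrite cmean_add//; last exact: cc.
  rewrite cmean_scale// zero// mulr0 add0r addrC addKr; apply: cmean_le => // t.
  have h1 := cmod_kernel_le t (sm _ s01) mr; have h2 := cmod_kernel_le t (sm _ s'01) mr.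
  have -> : cmod (B t) = `|s' - s| ^+ 2 * cmod m ^+ 2 * (rho *
    (cmod ((z t - (s%:C)%C * m)^-1) ^+ 2 * cmod ((z t - (s'%:C)%C * m)^-1))).
    by rewrite /B /A !(cmodM, cmodX) !cmodR cmod_cis (gtr0_norm rho0); ring.
  have h3 : cmod ((z t - (s%:C)%C * m)^-1) ^+ 2 * cmod ((z t - (s'%:C)%C * m)^-1) <= K ^+ 3.
    rewrite [K ^+ 3]exprSr; apply: ler_pM; rewrite ?exprn_ge0 ?cmod_ge0//.
    by rewrite lerXn2r ?nnegrE ?cmod_ge0 ?(ltW K0).
  have -> : rho * cmod m ^+ 2 * K ^+ 3 * `|s' - s| ^+ 2 =
    `|s' - s| ^+ 2 * cmod m ^+ 2 * (rho * K ^+ 3) by ring.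
  apply: ler_wpM2l; first by rewrite mulr_ge0 ?exprn_ge0 ?cmod_ge0.
  by apply: ler_wpM2l => //; exact: ltW.
have cl (s : R) : `|clamp 1 s| <= 1 by apply: clamp_le; lra.
(* The bounds hold for |s| <= 1 only; composing with [clamp 1] gives a function on the whole
   line. *)
have D0 (s : R) : rderiv (fun s => k (clamp 1 s)) s 0.
  apply: rderivP => e e0; pose L := rho * cmod m ^+ 2 * K ^+ 3.
  have L0 : 0 <= L by rewrite !mulr_ge0 ?exprn_ge0 ?cmod_ge0 ?(ltW K0) ?(ltW rho0).
  have p : 0 < L + 1 by lra.
  exists (e / (L + 1)); first by rewrite divr_gt0.
  move=> y; rewrite ltr_pdivlMr// => h; rewrite mulr0 subr0.

  apply: le_trans (lip _ _ (cl s) (cl y)) _; rewrite -/L.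
  have := clamp_lip y s ler01; set u := `|clamp _ _ - _| => us.
  have u0 : 0 <= u by exact: normr_ge0.
  apply: (@le_trans _ _ (L * `|y - s| ^+ 2)).
    by apply: ler_wpM2l => //; apply: lerXn2r => //; rewrite nnegrE.
  by rewrite expr2 mulrA ler_wpM2r//; have : 0 <= `|y - s| by []; lra.
have := @rderiv0_eq R (fun s => k (clamp 1 s)) 0 1 (fun t _ => D0 t).
have c1 : clamp 1 1 = 1 :> R by rewrite /clamp minxx (max_idPr _)//; lra.
rewrite clamp_id ?normr0// c1 /k mul1r => <-.
rewrite -[RHS](cmean_cst 1); congr cmean; apply/funext => t.
by rewrite mul0r subr0 mulfV// -[z t]subr0 circle_neq// cmod0.
Qed.

End Circle.
End CauchyFormula.

(** * Cauchy's formula and estimates on a disc *)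

Section CauchyEstimates.
Context {R : realType}.
Local Notation C := R[i].

Section Disc.
Variables (phi : C -> C) (c : C) (r rho : R).
Hypotheses (rho0 : 0 < rho) (rhor : rho < r / 2).
Hypothesis dphi : forall z, cmod (z - c) < r -> exists d, cderiv phi z d.

Lemma circle_in t : cmod (c + circ rho t - c) < r / 2.
Proof. by rewrite addrC addKr cmod_circle. Qed.

Let r0 : 0 < r. Proof. have h1 := rho0; have h2 := rhor. by lra. Qed.
Let r2 : r / 2 < r. Proof. have h := r0; lra. Qed.

Lemma circle_in_disc t : cmod (c + circ rho t - c) < r.
Proof. exact: lt_trans (circle_in t) r2. Qed.

Lemma rcont_phi_circle t : rcont (fun t => phi (c + circ rho t)) t.
Proof.
have [d hd] := dphi (circle_in_disc t).
apply: (@rcont_comp _ phi (fun t => c + circ rho t)); last exact: cderiv_cont hd.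
by apply: (contat_add rn_cmod (contat_cst rn_cmod _ _)); exact: rcont_circle.
Qed.

(** The difference quotient [q] at [c + m], with the derivative as its value there, is continuous,
    and differentiable elsewhere. So it has a primitive on the disc of radius r/2, which contains
    the circle, and the mean of [q] against z is 0. The subtracted constant [phi (c + m)] is
    restored by [cmean_kernel]. *)
Lemma cauchy_formula m : cmod m < rho ->
  phi (c + m) = cmean (fun t => phi (c + circ rho t) * (circ rho t * (circ rho t - m)^-1)).
Proof.
move=> mr; have h1 := rho0; have h2 := rhor; have h3 := r0.
have [|d hd] := dphi (z := c + m); first by rewrite addrC addKr; lra.
pose q z := if z == c + m then d else (phi z - phi (c + m)) * (z - (c + m))^-1.
have dq z : cmod (z - c) < r -> z != c + m -> exists d, cderiv q z d.
  move=> zr zm; have [d1 hd1] := dphi zr.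
  have zm0 : z + - (c + m) != 0 by rewrite subr_eq0.
  have := cderiv_mul (cderiv_add hd1 (cderiv_cst (- phi (c + m)) z))
    (@cderiv_comp _ _ (fun z => z + - (c + m)) z _ _ (cderiv_inv zm0)
       (cderiv_add (cderiv_id z) (cderiv_cst (- (c + m)) z))).
  set D := (X in cderiv _ _ X); move=> h; exists D.
  apply: (cderiv_ext (r := cmod (z - (c + m))) _ _ h).
    by rewrite cmod_gt0.
  move=> y yz; rewrite /q; case: eqVneq => // ym; exfalso.
  by move: yz; rewrite ym (rn_distC rn_cmod) ltxx.
have cq z : cmod (z - c) < r -> ccont q z.
  move=> zr; have [->|/(dq z zr)[d1]] := eqVneq z (c + m); last exact: cderiv_cont.
  case: hd => _ _ hd e e0; have e2 : 0 < e / 2 by lra.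
  have [del del0 h] := hd _ e2; exists del => // y hy.
  rewrite /q eqxx; case: eqVneq => [_|ym]; first by rewrite subrr cmod0.
  have n0 : y - (c + m) != 0 by rewrite subr_eq0.
  have -> : (phi y - phi (c + m)) / (y - (c + m)) - d =
      (phi y - phi (c + m) - (y - (c + m)) * d) * (y - (c + m))^-1 by field.
  rewrite cmodM cmodV ltr_pdivrMr ?cmod_gt0//.
  by apply: le_lt_trans (h y hy) _; rewrite ltr_pM2r ?cmod_gt0//; lra.
have mc : cmod (c + m - c) < r / 2 by rewrite addrC addKr; lra.
have [Psi hPsi] := disc_primitive mc cq dq.
have M0 : cmean (fun t => q (c + circ rho t) * circ rho t) = 0.
  apply: (@cmean_periodic R _ (fun t => (- 'i%C) * Psi (c + circ rho t))).
    move=> t.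
    have dc : rderiv (fun t => c + circ rho t) t ('i%C * circ rho t).
      by have := rderiv_add (rderiv_cst c t) (rderiv_circle rho t); rewrite add0r.
    have := rderiv_mul (rderiv_cst (- 'i%C) t) (rderiv_comp (hPsi _ (circle_in t)) dc).
    have ii : 'i%C * 'i%C = -1 :> C by rewrite -expr2 sqr_i.
    congr rderiv; set X := q _; set Y := circ _ _.
    transitivity (- ('i%C * 'i%C) * (X * Y)); first by ring.
    by rewrite ii; ring.
  by rewrite /circ cis0 cis2pi.
have K1 := cmean_kernel rho0 mr.
have cK t : rcont (fun t => circ rho t * (circ rho t - m)^-1) t.
  by apply: contat_mul; [exact: rcont_circle|exact: rcont_kernel].
have cqz t : rcont (fun t => q (c + circ rho t) * circ rho t) t.
  apply: contat_mul; last exact: rcont_circle.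
  apply: (@rcont_comp _ q (fun t => c + circ rho t)); last by apply: cq; exact: circle_in_disc.
  by apply: (contat_add rn_cmod (contat_cst rn_cmod _ _)); exact: rcont_circle.
rewrite -[LHS]mulr1 -K1 -cmean_scale// -[LHS]add0r -M0 -cmean_add//; last first.
  by move=> t; apply: contat_mul => //; exact: contat_cst rn_cmod _ _.
congr cmean; apply/funext => t.
have n0 := circle_neq rho0 t mr.
rewrite /q ifN; last by rewrite (inj_eq (addrI c)) -subr_eq0.
have -> : c + circ rho t - (c + m) = circ rho t - m by ring.
by field.
Qed.

Lemma mean_value_circle : phi c = cmean (fun t => phi (c + circ rho t)).
Proof.
have := cauchy_formula (m := 0); rewrite cmod0 addr0 => -> //.
congr cmean; apply/funext => t; rewrite subr0 mulfV ?mulr1//.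
by rewrite -cmod_gt0 cmod_circle.
Qed.

Variable B : R.
Hypothesis phiB : forall z, cmod (z - c) < r -> cmod (phi z) <= B.

Lemma phi_circle_le t : cmod (phi (c + circ rho t)) <= B.
Proof. by apply: phiB; exact: circle_in_disc. Qed.

Lemma circ_neq0 t : circ rho t != 0.
Proof. by rewrite -cmod_gt0 cmod_circle. Qed.

Lemma rcont_circ_inv t : rcont (fun t => (circ rho t)^-1) t.
Proof.
apply: (@rcont_comp _ (fun w : C => w^-1) (circ rho)); first exact: rcont_circle.
by apply: ccont_inv; exact: circ_neq0.
Qed.

Lemma kernel_half h t : cmod h <= rho / 2 -> cmod ((circ rho t - h)^-1) <= 2 / rho.
Proof.
move=> hr; have h1 := rho0; have lt : rho / 2 < rho by lra.
apply: le_trans (cmod_kernel_le rho0 t hr lt) _.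
by rewrite le_eqVlt; apply/orP; left; apply/eqP; field; rewrite gt_eqF// /=; lra.
Qed.

Lemma cauchy_lip h : cmod h <= rho / 2 ->
  cmod (phi (c + h) - phi c) <= 2 * B / rho * cmod h.
Proof.
move=> hr; have h1 := rho0; have hr' : cmod h < rho by lra.
have cphi := rcont_phi_circle.
have E : (fun t => phi (c + circ rho t) * (circ rho t * (circ rho t - h)^-1)) =
   fun t => phi (c + circ rho t) + h * (phi (c + circ rho t) * (circ rho t - h)^-1).
  apply/funext => t; have n0 := circle_neq rho0 t hr'; field; exact: n0.
have cX t : rcont (fun t => phi (c + circ rho t) * (circ rho t - h)^-1) t.
  by apply: contat_mul => //; exact: rcont_kernel.
rewrite (cauchy_formula hr') E cmean_add//; last first.
  by move=> t; apply: contat_mul => //; exact: contat_cst rn_cmod _ _.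
rewrite cmean_scale// mean_value_circle addrC addKr cmodM mulrC.
apply: ler_wpM2r; first exact: cmod_ge0.
apply: cmean_le => // t; rewrite cmodM.
apply: (@le_trans _ _ (B * (2 / rho))); last by rewrite mulrA (mulrC B).
by apply: ler_pM; rewrite ?cmod_ge0// ?phi_circle_le// kernel_half.
Qed.

Definition cauchy_deriv := cmean (fun t => phi (c + circ rho t) * (circ rho t)^-1).

(** Expand z / (z - h) = 1 + h / z + h^2 / (z (z - h)) in Cauchy's formula, where |z - h| >= rho /
    2. [cauchy_lip] uses the same expansion one order lower. *)
Lemma cauchy_taylor_mean h : cmod h <= rho / 2 ->
  cmod (phi (c + h) - phi c - h * cauchy_deriv) <= 2 * B / rho ^+ 2 * cmod h ^+ 2.
Proof.
move=> hr; have h1 := rho0; have hr' : cmod h < rho by lra.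
have cphi := rcont_phi_circle.
have E : (fun t => phi (c + circ rho t) * (circ rho t * (circ rho t - h)^-1)) =
   fun t => phi (c + circ rho t) + (h * (phi (c + circ rho t) * (circ rho t)^-1) +
    h ^+ 2 * (phi (c + circ rho t) * ((circ rho t)^-1 * (circ rho t - h)^-1))).
  apply/funext => t; have n0 := circle_neq rho0 t hr'; have n1 := circ_neq0 t.
  by field; rewrite n0 n1.
have cX t : rcont (fun t => phi (c + circ rho t) * (circ rho t)^-1) t.
  by apply: contat_mul => //; exact: rcont_circ_inv.
have cY t : rcont (fun t => phi (c + circ rho t) * ((circ rho t)^-1 * (circ rho t - h)^-1)) t.
  apply: contat_mul => //; apply: contat_mul; first exact: rcont_circ_inv.
  exact: rcont_kernel.
have cs (k : C) (f : R -> C) : (forall t, rcont f t) -> forall t, rcont (fun t => k * f t) t.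
  by move=> cf t; apply: contat_mul => //; exact: contat_cst rn_cmod _ _.
rewrite (cauchy_formula hr') E cmean_add//; last first.
  by move=> t; apply: (contat_add rn_cmod); exact: cs.
rewrite (cmean_add (cs _ _ cX) (cs _ _ cY)) !cmean_scale// mean_value_circle /cauchy_deriv.
set S := cmean (fun t => _ * (_ * _)); rewrite addrAC.
rewrite [X in cmod X](_ : _ = h ^+ 2 * S); last by ring.
rewrite cmodM cmodX mulrC.
apply: ler_wpM2r; first by rewrite exprn_ge0 ?cmod_ge0.
apply: cmean_le => // t; rewrite !cmodM.
apply: (@le_trans _ _ (B * (rho^-1 * (2 / rho)))); last first.
  by rewrite le_eqVlt; apply/orP; left; apply/eqP; field; rewrite gt_eqF.
apply: ler_pM; rewrite ?cmod_ge0 ?mulr_ge0 ?cmod_ge0// ?phi_circle_le//.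
apply: ler_pM; rewrite ?cmod_ge0//; last exact: kernel_half.
by rewrite cmodV cmod_circle.
Qed.

Lemma cderiv_cauchy : cderiv phi c cauchy_deriv.
Proof.
apply: cderivP => e e0; have r1 := rho0.
have B0 : 0 <= B by apply: le_trans (cmod_ge0 _) (phi_circle_le 0).
pose K := 2 * B / rho ^+ 2.
have K0 : 0 <= K by rewrite divr_ge0 ?mulr_ge0 ?exprn_ge0// ltW.
have p : 0 < K + 1 by lra.
exists (Num.min (rho / 2) (e / (K + 1))); first by rewrite lt_min !divr_gt0.
move=> y; rewrite lt_min => /andP[h1]; rewrite ltr_pdivlMr// => h2.
have := cauchy_taylor_mean (ltW h1).
have -> : c + (y - c) = y by ring.
move/le_trans; apply; rewrite -/K expr2 mulrA ler_wpM2r ?cmod_ge0//.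
have := cmod_ge0 (y - c); lra.
Qed.

Lemma cauchy_taylor d h : cderiv phi c d -> cmod h <= rho / 2 ->
  cmod (phi (c + h) - phi c - h * d) <= 2 * B / rho ^+ 2 * cmod h ^+ 2.
Proof. by move=> /(cderiv_unique cderiv_cauchy) <-; exact: cauchy_taylor_mean. Qed.

End Disc.

End CauchyEstimates.

(** * Euclidean geometry and compactness *)

Section Hermitian.
Context {R : realType} {n : nat}.
Local Notation C := R[i].
Local Notation V := 'rV[C]_n.

Lemma sum_cauchy_schwarz (I : finType) (a b : I -> R) :
  (\sum_i a i * b i) ^+ 2 <= (\sum_i a i ^+ 2) * (\sum_i b i ^+ 2).
Proof.
set S := \sum_i _; set A := \sum_i _; set B := \sum_i _.
have B0 : 0 <= B by apply: sumr_ge0 => i _; exact: sqr_ge0.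
have [B_eq0|B_neq0] := eqVneq B 0.
  have b0 i : b i = 0.
    apply/eqP; rewrite -sqrf_eq0; apply/eqP.
    exact: (psumr_eq0P (fun i _ => sqr_ge0 (b i)) B_eq0).
  by rewrite B_eq0 mulr0 /S big1 ?expr0n// => i _; rewrite b0 mulr0.
have : 0 <= \sum_i (B * a i - S * b i) ^+ 2.
  by apply: sumr_ge0 => i _; exact: sqr_ge0.
have -> : \sum_i (B * a i - S * b i) ^+ 2 = B * (A * B - S ^+ 2).
  transitivity (\sum_i (B ^+ 2 * a i ^+ 2 + (- (2 * B * S)) * (a i * b i) + S ^+ 2 * b i ^+ 2)).
    by apply: eq_bigr => i _; ring.
  by rewrite !big_split/= -!mulr_sumr -/A -/B -/S; ring.
by rewrite pmulr_rge0 ?subr_ge0// lt0r B_neq0.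
Qed.

Definition hdot (z w : V) : C := \sum_j z ord0 j * (w ord0 j)^*%C.

Lemma hdotDl (x y w : V) : hdot (x + y) w = hdot x w + hdot y w.
Proof. by rewrite /hdot -big_split/=; apply: eq_bigr => j _; rewrite mxE mulrDl. Qed.

Lemma hdotZl a (x w : V) : hdot (a *: x) w = a * hdot x w.
Proof. by rewrite /hdot mulr_sumr; apply: eq_bigr => j _; rewrite mxE mulrA. Qed.

Lemma hdotNl (x w : V) : hdot (- x) w = - hdot x w.
Proof. by rewrite -scaleN1r hdotZl mulN1r. Qed.

Lemma hdotC (z w : V) : hdot w z = (hdot z w)^*%C.
Proof.
rewrite /hdot rmorph_sum/=; apply: eq_bigr => j _.
by rewrite rmorphM/= conjcK mulrC.
Qed.

Lemma enorm_ge0 (z : V) : 0 <= enorm z.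
Proof. exact: sqrtr_ge0. Qed.

Lemma enorm_sqr (z : V) : enorm z ^+ 2 = \sum_j cmod (z ord0 j) ^+ 2.
Proof. by rewrite sqr_sqrtr// sumr_ge0// => j _; exact: sqr_ge0. Qed.

Lemma hdotzz (z : V) : hdot z z = ((enorm z ^+ 2)%:C)%C.
Proof.
rewrite enorm_sqr rmorph_sum; apply: eq_bigr => j _; rewrite cmod_sqr.
by case: (z ord0 j) => a b; apply/eqP; rewrite eq_complex/=; apply/andP; split;
  apply/eqP; ring.
Qed.

Lemma cmod_sum (I : finType) (f : I -> C) : cmod (\sum_i f i) <= \sum_i cmod (f i).
Proof.
elim/big_ind2 : _ => [|x y z t h1 h2|//]; first by rewrite cmod0.
by apply: le_trans (rnD rn_cmod _ _) _; exact: lerD.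
Qed.

Lemma hdot_le (z w : V) : cmod (hdot z w) <= enorm z * enorm w.
Proof.
apply: le_trans (cmod_sum _) _.
rewrite -(ler_pXn2r (n := 2)) ?nnegrE ?mulr_ge0 ?enorm_ge0//; last first.
  by apply: sumr_ge0 => j _; exact: cmod_ge0.
rewrite exprMn !enorm_sqr; under eq_bigr do rewrite cmodM cmodJ.
exact: sum_cauchy_schwarz.
Qed.

Lemma enormZ a (z : V) : enorm (a *: z) = cmod a * enorm z.
Proof.
apply/eqP; rewrite -(eqrXn2 (n := 2))// ?enorm_ge0 ?mulr_ge0 ?enorm_ge0 ?cmod_ge0//.
rewrite exprMn !enorm_sqr mulr_sumr; apply/eqP; apply: eq_bigr => j _.
by rewrite mxE cmodM exprMn.
Qed.

Lemma enormD_sqr (x y : V) :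
  enorm (x + y) ^+ 2 = enorm x ^+ 2 + 2 * complex.Re (hdot x y) + enorm y ^+ 2.
Proof.
rewrite !enorm_sqr /hdot raddf_sum/= mulr_sumr -!big_split/=.
apply: eq_bigr => j _; rewrite mxE !cmod_sqr.
by case: (x ord0 j) (y ord0 j) => a b [c d] /=; ring.
Qed.

Lemma rn_enorm : real_norm (@enorm R n).
Proof.
split.
- by rewrite -(scale0r (0 : V)) enormZ cmod0 mul0r.
- by move=> x; rewrite -scaleN1r enormZ (rnN rn_cmod) cmod1 mul1r.
- move=> x y; rewrite -(ler_pXn2r (n := 2)) ?nnegrE ?addr_ge0 ?enorm_ge0//.
  rewrite enormD_sqr; have := hdot_le x y; have := Re_le_cmod (hdot x y).
  have := ler_norm (complex.Re (hdot x y)); nra.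
Qed.

Lemma cmod_coord (z : V) j : cmod (z ord0 j) <= enorm z.
Proof.
rewrite -(ler_pXn2r (n := 2)) ?nnegrE ?enorm_ge0 ?cmod_ge0// enorm_sqr.
by rewrite (bigD1 j)//= lerDl sumr_ge0// => i _; exact: sqr_ge0.
Qed.

Lemma enorm_le_sum (z : V) : enorm z <= \sum_j cmod (z ord0 j).
Proof.
have -> : z = \sum_j z ord0 j *: delta_mx ord0 j by exact: row_sum_delta.
have d1 j : enorm (delta_mx ord0 j : V) = 1.
  apply/eqP; rewrite -(eqrXn2 (n := 2))// ?enorm_ge0// expr1n enorm_sqr.
  rewrite (bigD1 j)//= big1 ?mxE ?eqxx ?cmod1 ?expr1n ?addr0// => i ij.
  by rewrite mxE (negPf ij) andbF cmod0 expr0n.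
have H (I : finType) (f : I -> V) : enorm (\sum_i f i) <= \sum_i enorm (f i).
  elim/big_ind2 : _ => [|x y u t h1 h2|//]; first by rewrite (rn0 rn_enorm).
  by apply: le_trans (rnD rn_enorm _ _) _; exact: lerD.
apply: le_trans (H _ _) _; apply: ler_sum => j _; rewrite enormZ d1 mulr1.
by rewrite -row_sum_delta.
Qed.

Lemma enorm_eq0 (z : V) : (enorm z == 0) = (z == 0).
Proof.
apply/eqP/eqP => [h|->]; last exact: rn0 rn_enorm.
apply/rowP => j; rewrite mxE; apply/eqP; rewrite -cmod_eq0 eq_le cmod_ge0.
by rewrite -h cmod_coord.
Qed.

Lemma enorm_gt0 (z : V) : (0 < enorm z) = (z != 0).
Proof. by rewrite lt0r enorm_ge0 enorm_eq0 andbT. Qed.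

End Hermitian.

Section Compactness.
Context {R : realType}.
Local Notation C := R[i].

(** A cluster point stands for the limit of a subsequence, so that no subsequence is extracted. *)
Definition seqcompact (X : zmodType) (N : X -> R) (S : set X) :=
  forall u : nat -> X, (forall k, S (u k)) -> exists2 z, S z &
    forall (e : R) m, 0 < e -> exists2 k, (m <= k)%N & N (u k - z) < e.

Lemma bolzano_weierstrass n (u : nat -> 'rV[C]_n) M : (forall k, enorm (u k) <= M) ->
  exists z, forall (e : R) m, 0 < e -> exists2 k, (m <= k)%N & enorm (u k - z) < e.
Proof.
move=> uM.
pose v k : 'rV[R]_(n + n) := row_mx (\row_j complex.Re (u k ord0 j)) (\row_j complex.Im (u k ord0 j)).
have vK k : [set w : 'rV[R]_(n + n) | forall i, `[- M, M]%classic (w ord0 i)] (v k).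
  move=> i /=; rewrite in_itv/= -ler_norml /v mxE; case: splitP => j _; rewrite mxE.
    by apply: le_trans (Re_le_cmod _) _; apply: le_trans (cmod_coord _ _) _.
  by apply: le_trans (Im_le_cmod _) _; apply: le_trans (cmod_coord _ _) _.
have cK := @rV_compact R (n + n) (fun=> `[- M, M]%classic) (fun=> @segment_compact R (- M) M).
have [|p [_ hp]] := cK (v @ \oo) _.
  by exists 0%N => // k _; exact: vK.
exists (\row_j Complex (p ord0 (lshift n j)) (p ord0 (rshift n j))) => e m e0.
pose d := e / (2 * n%:R + 1).
have n0 : 0 <= n%:R :> R by [].
have d0 : 0 < d by rewrite divr_gt0//; lra.
have [_ [[k mk <-] hk]] := hp [set v k | k in [set k | (m <= k)%N]] (ball p d)
   (ex_intro2 _ _ m I (fun k mk => ex_intro2 _ _ k mk erefl)) (nbhsx_ballx p d d0).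
exists k => //; apply: le_lt_trans (enorm_le_sum _) _.
have : forall j, cmod ((u k - \row_j Complex (p ord0 (lshift n j)) (p ord0 (rshift n j))) ord0 j) <= 2 * d.
  move=> j; rewrite !mxE; apply: le_trans (cmod_le_ReIm _) _; rewrite !raddfB/=.
  have [_ hk'] := hk; have := hk' ord0 (lshift n j); have := hk' ord0 (rshift n j).
  by rewrite /ball/= /v row_mxEl row_mxEr !mxE ![`|p _ _ - _|]distrC; lra.
move=> h; apply: (@le_lt_trans _ _ (\sum_(j < n) 2 * d)); first exact: ler_sum.
rewrite sumr_const card_ord -(mulr_natr (2 * d)).
have -> : 2 * d * n%:R = 2 * n%:R * e / (2 * n%:R + 1) by rewrite /d; ring.
by rewrite ltr_pdivrMr; nra.
Qed.

Section Sub.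
Context {X : zmodType} {N : X -> R}.
Hypothesis hN : real_norm N.

Lemma seqcompact_sub (S P : set X) : seqcompact N S -> P `<=` S ->
  (forall z, ~ P z -> exists2 d : R, 0 < d & forall y, N (y - z) < d -> ~ P y) ->
  seqcompact N P.
Proof.
move=> cS PS clP u uP; have [z _ hz] := cS u (fun k => PS _ (uP k)).
exists z => //; apply: contrapT => /clP[d d0 hd].
by have [k _ /hd] := hz d 0%N d0; apply; exact: uP.
Qed.

Lemma seqcompact_min (S : set X) (f : X -> R) : seqcompact N S -> S !=set0 ->
  (forall z, S z -> contat N (fun x : R => `|x|) f z) ->
  exists2 z, S z & forall y, S y -> f z <= f y.
Proof.
move=> cS [x0 Sx0] cf.
have H : has_lbound [set f z | z in S].
  apply: contrapT => H.
  have /choice[u hu] : forall k : nat, exists y, S y /\ f y < - k%:R.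
    move=> k; apply: contrapT => h; apply: H; exists (- k%:R) => _ [y Sy <-].
    by rewrite leNgt; apply/negP => l; apply: h; exists y.
  have [z Sz hz] := cS u (fun k => (hu k).1).
  have [d d0 hd] := cf z Sz 1 ltr01.
  have [k mk /hd] := hz d (Num.bound (`|f z| + 1)) d0.
  have := archi_boundP (addr_ge0 (normr_ge0 (f z)) ler01).
  have : (Num.bound (`|f z| + 1))%:R <= k%:R :> R by rewrite ler_nat.
  have := (hu k).2; have := ler_norm (f z); have := ler_norm (- f z); rewrite normrN.
  have := ler_norm (- (f (u k) - f z)); rewrite normrN; lra.
pose m := inf [set f z | z in S].
have hm y : S y -> m <= f y by move=> Sy; apply: ge_inf => //; exists y.
have /choice[u hu] : forall k : nat, exists y, S y /\ f y < m + k.+1%:R^-1.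
  move=> k; apply: contrapT => h.
  suff : m + k.+1%:R^-1 <= m by rewrite gerDl leNgt invr_gt0 ltr0Sn.
  apply: lb_le_inf; first by exists (f x0), x0.
  move=> _ [y Sy <-]; rewrite leNgt; apply/negP => l; apply: h; by exists y.
have [z Sz hz] := cS u (fun k => (hu k).1).
exists z => // y /hm; apply: le_trans; apply/ler_addgt0Pr => e e0.
have e2 : 0 < e / 2 by lra.
have [d d0 hd] := cf z Sz _ e2.
have [k mk /hd] := hz d (Num.bound (e / 2)^-1) d0.
have i0 : 0 <= (e / 2)^-1 by rewrite invr_ge0 ltW.
have := archi_boundP i0.
have : (Num.bound (e / 2)^-1)%:R <= k%:R :> R by rewrite ler_nat.
move=> l1 l2.
have l3 : k.+1%:R^-1 < e / 2.
  by rewrite -[e / 2]invrK ltf_pV2 ?posrE ?invr_gt0// -natr1; lra.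
have := (hu k).2; have := ler_norm (- (f (u k) - f z)); rewrite normrN.
move: l3; set q : R := k.+1%:R^-1; clearbody q m => l3 l4 l5 l6.
clear -l3 l4 l5 l6; lra.
Qed.

Lemma seqcompact_max (S : set X) (f : X -> R) : seqcompact N S -> S !=set0 ->
  (forall z, S z -> contat N (fun x : R => `|x|) f z) ->
  exists2 z, S z & forall y, S y -> f y <= f z.
Proof.
move=> cS S0 cf; have [|z Sz hz] := @seqcompact_min S (fun z => - f z) cS S0.
  by move=> z /cf; exact: (contat_opp rn_abs).
by exists z => // y /hz; rewrite lerN2.
Qed.

Lemma contat_norm (X' : zmodType) (N' : X' -> R) (f : X -> X') x : real_norm N' ->
  contat N N' f x -> contat N (fun x : R => `|x|) (fun y => N' (f y)) x.
Proof.
move=> hN' cf e e0; have [d d0 h] := cf e e0; exists d => // y /h.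
exact: le_lt_trans (rn_dist_abs hN' _ _).
Qed.

End Sub.

Lemma seqcompact_eball n (c : 'rV[C]_n) r : seqcompact (@enorm R n) [set z | enorm (z - c) <= r].
Proof.
move=> u hu; have [k|z hz] := @bolzano_weierstrass n u (enorm c + r).
  have := rn_dist rn_enorm (u k) c; have := hu k => /=; lra.
exists z => //=; apply/ler_addgt0Pr => e e0; have [k _ hk] := hz e 0%N e0.
have := rn_dist3 rn_enorm z (u k) c; rewrite (rn_distC rn_enorm z (u k)).
have := hu k => /=; lra.
Qed.

Lemma seqcompact_disc (c : C) r : seqcompact (@cmod R) [set z | cmod (z - c) <= r].
Proof.
move=> u hu.
have E (x : C) : enorm (const_mx x : 'rV[C]_1) = cmod x.
  apply/eqP; rewrite -(eqrXn2 (n := 2))// ?enorm_ge0 ?cmod_ge0//.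
  by rewrite enorm_sqr big_ord1 mxE.
have [|z hz hz'] := @seqcompact_eball 1 (const_mx c) r (fun k => const_mx (u k)).
  move=> k /=; have := hu k; rewrite /= -E.
  by congr (enorm _ <= _); apply/rowP => j; rewrite !mxE.
have zE : z = const_mx (z ord0 ord0) by apply/rowP => j; rewrite mxE ord1.
have E2 (x y : C) : enorm (const_mx x - const_mx y : 'rV[C]_1) = cmod (x - y).
  by rewrite -E; congr enorm; apply/rowP => j; rewrite !mxE.
exists (z ord0 ord0); first by move: hz; rewrite /= {1}zE E2.
by move=> e m /(hz' e m)[k mk]; rewrite {1}zE E2 => ?; exists k.
Qed.

End Compactness.

(** * The maximum and identity principles *)

Section MaximumPrinciple.
Context {R : realType}.
Local Notation C := R[i].

Lemma cmean_circ rho : cmean (circ rho) = 0 :> C.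
Proof.
apply: (@cmean_periodic R _ (fun t => (- 'i%C) * circ rho t)).
  move=> t; have := rderiv_mul (rderiv_cst (- 'i%C) t) (rderiv_circle rho t).
  have ii : 'i%C * 'i%C = -1 :> C by rewrite -expr2 sqr_i.
  congr rderiv; transitivity (- ('i%C * 'i%C) * circ rho t); first by ring.
  by rewrite ii; ring.
by rewrite /circ cis0 cis2pi.
Qed.

(* Differentiability may fail where [phi] vanishes: such points are not maxima
   of the modulus.  At an interior maximum of |phi|^2 + eta |z|^2 the mean value
   property gives a contradiction. *)
Lemma max_principle (phi : C -> C) (c : C) (rho B : R) : 0 < rho ->
  (forall z, cmod (z - c) <= rho -> ccont phi z) ->
  (forall z, cmod (z - c) < rho -> phi z != 0 -> exists d, cderiv phi z d) ->
  (forall z, cmod (z - c) = rho -> cmod (phi z) <= B) ->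
  forall z, cmod (z - c) <= rho -> cmod (phi z) <= B.
Proof.
move=> rho0 cphi dphi phiB z0 z0r; rewrite leNgt; apply/negP => Bz0.
have B0 : 0 <= B.
  apply: le_trans (cmod_ge0 (phi (c + (rho%:C)%C))) (phiB _ _).
  by rewrite addrC addKr cmodR gtr0_norm.
have gap : 0 < cmod (phi z0) ^+ 2 - B ^+ 2.
  by rewrite subr_gt0 ltr_pXn2r// nnegrE ?cmod_ge0.
(* With this choice [eta * rho ^+ 2] is half the gap, so [u] stays below |phi(z0)|^2 on the boundary
   circle and at the zeros of [phi]; its maximum is at neither. *)
pose eta := (cmod (phi z0) ^+ 2 - B ^+ 2) / (2 * rho ^+ 2).
have eta0 : 0 < eta by rewrite divr_gt0// mulr_gt0// exprn_gt0.
have etar : eta * rho ^+ 2 = (cmod (phi z0) ^+ 2 - B ^+ 2) / 2.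
  by rewrite /eta; field; rewrite gt_eqF.
pose u (z : C) : R := cmod (phi z) ^+ 2 + eta * cmod (z - c) ^+ 2.
have cu z : cmod (z - c) <= rho -> contat (@cmod R) (fun x : R => `|x|) u z.
  move=> zr.
  have : ccont (fun z => phi z * (phi z)^*%C + (eta%:C)%C * ((z - c) * (z - c)^*%C)) z.
    have cJ (f : C -> C) : ccont f z -> ccont (fun z => (f z)^*%C) z.
      move=> cf e e0; have [d d0 h] := cf e e0; exists d => // y /h.
      by rewrite -rmorphB cmodJ.
    have cz : ccont (fun z => z - c) z.
      exact: cderiv_cont (cderiv_add (cderiv_id z) (cderiv_cst (- c) z)).
    apply: (contat_add rn_cmod); first by apply: contat_mul; [exact: cphi|apply/cJ/cphi].
    apply: contat_mul; first exact: contat_cst rn_cmod _ _.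
    by apply: contat_mul => //; exact: cJ.
  move=> h e e0; have [d d0 hd] := h e e0; exists d => // y /hd.
  apply: le_lt_trans; rewrite -cmodR.
  have E (x : C) : ((cmod x ^+ 2)%:C)%C = x * x^*%C.
    rewrite cmod_sqr; case: x => a b; apply/eqP; rewrite eq_complex/=; apply/andP.
    by split; apply/eqP; ring.
  have uE y' : ((u y')%:C)%C = phi y' * (phi y')^*%C + (eta%:C)%C * ((y' - c) * (y' - c)^*%C).
    by rewrite -!E -rmorphM -rmorphD.
  by rewrite rmorphB /= !uE.
have [|z1 z1r z1max] := seqcompact_max (@seqcompact_disc R c rho) _ cu.
  by exists c => /=; rewrite subrr cmod0 ltW.
have u1 : cmod (phi z0) ^+ 2 <= u z1.
  by apply: le_trans (z1max _ z0r); rewrite /u lerDl mulr_ge0 ?(ltW eta0) ?exprn_ge0 ?cmod_ge0.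
have z1r2 : cmod (z1 - c) ^+ 2 <= rho ^+ 2 by rewrite lerXn2r ?nnegrE ?cmod_ge0 ?(ltW rho0).
have z1lt : cmod (z1 - c) < rho.
  rewrite lt_neqAle z1r andbT; apply/negP => /eqP E.
  have : cmod (phi z1) ^+ 2 <= B ^+ 2 by rewrite lerXn2r ?nnegrE ?cmod_ge0// phiB.
  by move: u1; rewrite /u E; lra.
have phi1 : phi z1 != 0.
  apply/eqP => E; move: u1; rewrite /u E cmod0 expr0n add0r.
  have := ler_wpM2l (ltW eta0) z1r2; have := sqr_ge0 B; lra.
have p1 : 0 < cmod (phi z1) by rewrite cmod_gt0.
have [d1 d10 h1] := cphi _ z1r _ p1.
pose r := Num.min d1 (rho - cmod (z1 - c)).
have r0 : 0 < r by rewrite lt_min d10 subr_gt0.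
have rz z : cmod (z - z1) < r -> cmod (z - c) < rho /\ phi z != 0.
  rewrite lt_min => /andP[/h1 k1 k2]; split.
    have := rn_dist3 rn_cmod z z1 c; lra.
  apply: contraTneq k1 => ->; by rewrite sub0r (rnN rn_cmod) ltxx.
have dphi1 z : cmod (z - z1) < r -> exists d, cderiv phi z d.
  by move=> /rz[? ?]; exact: dphi.
pose s := r / 3.
have [s0 sr] : 0 < s /\ s < r / 2 by rewrite /s; lra.
pose w := (phi z1)^*%C; pose v := (z1 - c)^*%C.
(* By |b|^2 >= |a|^2 + 2 Re (conj(a) (b - a)), [Re G] is at most half of u(z1 + zeta) - u(z1), hence
   at most 0. In the mean everything cancels except [eta * s ^+ 2 / 2 > 0]. *)
pose G t := (w * phi (z1 + circ s t) + (eta%:C)%C * v * circ s t) +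
   (- (w * phi z1) + ((eta * s ^+ 2 / 2)%:C)%C).
have c1 (t : R) : rcont (fun t => w * phi (z1 + circ s t)) t.
  by apply: contat_mul; [exact: contat_cst rn_cmod _ _|exact: rcont_phi_circle s0 sr dphi1 t].
have c2 (t : R) : rcont (fun t => (eta%:C)%C * v * circ s t) t.
  by apply: contat_mul; [exact: contat_cst rn_cmod _ _|exact: rcont_circle].
have c12 (t : R) : rcont (fun t => w * phi (z1 + circ s t) + (eta%:C)%C * v * circ s t) t.
  by apply: (contat_add rn_cmod); [exact: c1|exact: c2].
have c3 (t : R) : rcont (fun=> - (w * phi z1) + ((eta * s ^+ 2 / 2)%:C)%C) t.
  exact: contat_cst rn_cmod _ _.
have : complex.Re (cmean G) <= 0.
  apply: cmean_Re_le0 => t; first by apply: (contat_add rn_cmod); [exact: c12|exact: c3].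
  have : u (z1 + circ s t) <= u z1.
    apply: z1max; apply/ltW; apply: (rz _ _).1.
    by rewrite addrC addKr cmod_circle//; lra.
  have -> : z1 = c + (z1 - c) by ring.
  rewrite /G /u /w /v (_ : c + (z1 - c) + circ s t - c = (z1 - c) + circ s t); last by ring.
  have := cmod_circle s0 t; rewrite (_ : c + (z1 - c) = z1); last by ring.
  move=> /(congr1 (fun x => eta * x ^+ 2)); rewrite !cmod_sqr.
  case: (phi (z1 + circ s t)) => b1 b2.
  case: (phi z1) (circ s t) (z1 - c) => a1 a2 [x1 x2] [y1 y2] /=.
  have := sqr_ge0 (a1 - b1); have := sqr_ge0 (a2 - b2). clear; lra.
have m1 : cmean (fun t => w * phi (z1 + circ s t)) = w * phi z1.
  rewrite (mean_value_circle s0 sr dphi1) (@cmean_scale R (fun t => phi (z1 + circ s t)))//.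
  by move=> t; exact: rcont_phi_circle s0 sr dphi1 t.
have m2 : cmean (fun t => (eta%:C)%C * v * circ s t) = 0.
  rewrite (@cmean_scale R (circ s)) ?cmean_circ ?mulr0// => t; exact: rcont_circle.
rewrite /G (cmean_add c12 c3) (cmean_add c1 c2) m1 m2 cmean_cst addr0 addrA subrr add0r /=.
by apply/negP; rewrite -ltNge divr_gt0// mulr_gt0// exprn_gt0.
Qed.

(** As [phi] vanishes near c, phi / (z - c)^N satisfies the hypotheses of the maximum principle for
    every N. This gives |phi(z)| <= B (|z - c| / rho)^N, and N tends to infinity. *)
Lemma disc_identity (phi : C -> C) (c : C) (r r0 : R) : 0 < r0 ->
  (forall z, cmod (z - c) < r -> ccont phi z) ->
  (forall z, cmod (z - c) < r -> phi z != 0 -> exists d, cderiv phi z d) ->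
  (forall z, cmod (z - c) < r0 -> phi z = 0) ->
  forall z, cmod (z - c) < r -> phi z = 0.
Proof.
move=> r00 cphi dphi phi0 z zr.
pose rho := (cmod (z - c) + r) / 2.
have [rho1 rho2] : cmod (z - c) < rho /\ rho < r by rewrite /rho; lra.
have rho0 : 0 < rho by have := cmod_ge0 (z - c); lra.
have [||zm _ hB] := @seqcompact_max R _ _ _ (fun z => cmod (phi z)) (@seqcompact_disc R c rho).
- by exists c => /=; rewrite subrr cmod0 ltW.
- move=> y /= yr; apply: contat_norm rn_cmod _; apply: cphi; exact: le_lt_trans yr rho2.
set B := cmod (phi zm) in hB.
have key N : cmod (phi z) <= B * (cmod (z - c) / rho) ^+ N.
  pose psi y := phi y * (y - c)^-1 ^+ N.
  have psi0 y : cmod (y - c) < r0 -> psi y = 0 by move=> h; rewrite /psi phi0// mul0r.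
  have dk y : y != c -> exists d, cderiv (fun y => (y - c)^-1 ^+ N) y d.
    move=> yc; have yc0 : y + - c != 0 by rewrite subr_eq0.
    have [d hd] : exists d, cderiv (fun y => (y - c)^-1) y d.
      eexists; exact: (@cderiv_comp R _ (fun y => y + - c) y _ _ (cderiv_inv yc0)
         (cderiv_add (cderiv_id y) (cderiv_cst (- c) y))).
    elim: N {psi psi0} => [|N [dN hN]].
      exists 0; apply: cderiv_ext (ltr01 : 0 < 1 :> R) _ (cderiv_cst 1 y) => x _.
      by rewrite expr0.
    eexists; apply: cderiv_ext (ltr01 : 0 < 1 :> R) _ (cderiv_mul hd hN) => x _.
    by rewrite exprS.
  have psiB : forall y, cmod (y - c) <= rho -> cmod (psi y) <= B * rho^-1 ^+ N.
    apply: max_principle => //.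
    - move=> y yr; have [->|yc] := eqVneq y c.
        apply: (contat_ext rn_cmod r00 _ (contat_cst rn_cmod (0 : C) c)) => x /psi0 ->//.
      have [d hd] := dk y yc; apply: contat_mul; last exact: cderiv_cont hd.
      by apply: cphi; lra.
    - move=> y yr; have [->|yc] := eqVneq y c; first by rewrite psi0 ?subrr ?cmod0// eqxx.
      rewrite /psi mulf_eq0 negb_or => /andP[py _].
      have [d hd] := dk y yc; have [|d' hd'] := dphi y _ py; first by lra.
      by eexists; exact: cderiv_mul hd' hd.
    - move=> y yr; rewrite /psi cmodM cmodX cmodV yr.
      by apply: ler_wpM2r; [rewrite exprn_ge0// invr_ge0 ltW|apply: hB => /=; rewrite yr].
  have [->|zc] := eqVneq z c.
    by rewrite phi0 ?subrr ?cmod0// mulr_ge0 ?exprn_ge0 ?mul0r// cmod_ge0.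
  have := psiB z (ltW rho1); rewrite /psi cmodM cmodX cmodV.
  have zp : 0 < cmod (z - c) by rewrite cmod_gt0 subr_eq0.
  rewrite -(ler_pM2r (exprn_gt0 N zp)) -mulrA -exprMn mulVf ?gt_eqF// expr1n mulr1.
  by rewrite -mulrA -exprMn [rho^-1 * _]mulrC.
apply/eqP; rewrite -cmod_eq0 eq_le cmod_ge0 andbT; apply/ler_addgt0Pr => e e0.
have q0 : 0 <= cmod (z - c) / rho by rewrite divr_ge0 ?cmod_ge0// ltW.
have q1 : cmod (z - c) / rho < 1 by rewrite ltr_pdivrMr// mul1r.
have [k hk] := pow_small B q0 q1 e0.
by rewrite add0r; apply: le_trans (key k) (ltW hk).
Qed.

End MaximumPrinciple.

(** * Holomorphic functions of several variables *)

Section SeveralVariables.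
Context {R : realType} {n : nat}.
Local Notation C := R[i].
Local Notation V := 'rV[C]_n.

Definition hderiv (f : V -> C) z (d : 'cV[C]_n) :=
  deriv_at (@enorm R n) (@cmod R) f z (fun h => (h *m d) ord0 ord0).

Definition hol f z := exists d, hderiv f z d.

Lemma mul_col_le (h : V) (d : 'cV[C]_n) K : (forall j, cmod (d j ord0) <= K) ->
  cmod ((h *m d) ord0 ord0) <= n%:R * K * enorm h.
Proof.
move=> dK; rewrite mxE; apply: le_trans (cmod_sum _) _.
apply: (@le_trans _ _ (\sum_(j < n) enorm h * K)).
  apply: ler_sum => j _; rewrite cmodM.
  by apply: ler_pM; rewrite ?cmod_ge0// cmod_coord.
by rewrite sumr_const card_ord -(mulr_natl (enorm h * K) n) [enorm h * K]mulrC mulrA.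
Qed.

Lemma mul_col_sub (u v : V) (d : 'cV[C]_n) :
  ((u - v) *m d) ord0 ord0 = (u *m d) ord0 ord0 - (v *m d) ord0 ord0.
Proof. by rewrite mulmxBl !mxE. Qed.

Lemma hderivP (f : V -> C) z d :
  (forall e : R, 0 < e -> exists2 del : R, 0 < del & forall y, enorm (y - z) < del ->
    cmod (f y - f z - ((y - z) *m d) ord0 ord0) <= e * enorm (y - z)) -> hderiv f z d.
Proof.
move=> H; split=> //; first by move=> u v; exact: mul_col_sub.
exists (n%:R * \sum_j cmod (d j ord0)) => u; apply: mul_col_le => j.
by rewrite (bigD1 j)//= lerDl sumr_ge0// => i _; exact: cmod_ge0.
Qed.

Lemma hol_cont f z : hol f z -> contat (@enorm R n) (@cmod R) f z.
Proof. by move=> [d hd]; have := deriv_contat rn_enorm rn_cmod hd. Qed.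

Lemma hol_ext (f g : V -> C) z (r : R) : 0 < r ->
  (forall y, enorm (y - z) < r -> f y = g y) -> hol f z -> hol g z.
Proof. by move=> r0 fg [d hd]; exists d; have := deriv_ext rn_enorm r0 fg hd. Qed.

Lemma hol_cst c z : hol (fun=> c) z.
Proof.
exists 0; apply: deriv_extL (deriv_cst rn_enorm rn_cmod c z) => u.
by rewrite mulmx0 mxE.
Qed.

Lemma hol_add f g z : hol f z -> hol g z -> hol (fun y => f y + g y) z.
Proof.
move=> [d hd] [d' hd']; exists (d + d').
by apply: deriv_extL (deriv_add rn_cmod hd hd') => u; rewrite mulmxDr [RHS]mxE.
Qed.

Lemma hol_opp f z : hol f z -> hol (fun y => - f y) z.
Proof.
move=> [d hd]; exists (- d).
by apply: deriv_extL (deriv_opp rn_cmod hd) => u; rewrite mulmxN [RHS]mxE.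
Qed.

Lemma hol_mul f g z : hol f z -> hol g z -> hol (fun y => f y * g y) z.
Proof.
move=> [d hd] [d' hd']; exists (f z *: d' + g z *: d).
apply: deriv_extL (deriv_mul rn_enorm hd hd') => u.
by rewrite mulmxDr -!scalemxAr !mxE.
Qed.

Lemma hol_sum (I : Type) (s : seq I) (f : I -> V -> C) z : (forall i, hol (f i) z) ->
  hol (fun y => \sum_(i <- s) f i y) z.
Proof.
move=> h; elim: s => [|i s IH].
  by apply: hol_ext ltr01 _ (hol_cst 0 z) => y _; rewrite big_nil.
by apply: hol_ext ltr01 _ (hol_add (h i) IH) => y _; rewrite big_cons.
Qed.

Lemma hol_prod (I : Type) (s : seq I) (f : I -> V -> C) z : (forall i, hol (f i) z) ->
  hol (fun y => \prod_(i <- s) f i y) z.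
Proof.
move=> h; elim: s => [|i s IH].
  by apply: hol_ext ltr01 _ (hol_cst 1 z) => y _; rewrite big_nil.
by apply: hol_ext ltr01 _ (hol_mul (h i) IH) => y _; rewrite big_cons.
Qed.

Lemma hderiv_line (f : V -> C) (p v : V) (l : C) d : hderiv f (p + l *: v) d ->
  cderiv (fun l => f (p + l *: v)) l ((v *m d) ord0 ord0).
Proof.
move=> hd.
have dl : deriv_at (@cmod R) (@enorm R n) (fun l => p + l *: v) l (fun k => k *: v).
  split; first by move=> a b; rewrite scalerBl.
    by exists (enorm v) => a; rewrite enormZ mulrC.
  move=> e e0; exists 1 => // y _; rewrite opprD addrACA subrr add0r -scalerBl subrr.
  by rewrite (rn0 rn_enorm) mulr_ge0 ?cmod_ge0// ltW.
have := deriv_comp rn_cmod rn_enorm rn_cmod dl hd.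
by apply: deriv_extL => k; rewrite -scalemxAl mxE.
Qed.

Lemma hol_line (f : V -> C) (p v : V) (l : C) : hol f (p + l *: v) ->
  exists d, cderiv (fun l => f (p + l *: v)) l d.
Proof. by move=> [d /hderiv_line]; eexists; eassumption. Qed.

Definition hol_ball (f : V -> C) p r B :=
  forall y, enorm (y - p) < r -> hol f y /\ cmod (f y) <= B.

Lemma hol_ball_sub f p q r s B :
  hol_ball f p r B -> enorm (q - p) + s <= r -> hol_ball f q s B.
Proof.
move=> h le y yq; apply: h; have := rn_dist3 rn_enorm y q p; lra.
Qed.

Lemma hol_ball_exists (f : V -> C) p r : 0 < r ->
  (forall y, enorm (y - p) < r -> hol f y) ->
  exists2 s : R, 0 < s & s <= r /\ hol_ball f p s (cmod (f p) + 1).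
Proof.
move=> r0 h; have hp : hol f p by apply: h; rewrite subrr (rn0 rn_enorm).
have [d d0 hd] := contat_bound (hol_cont hp).
exists (Num.min d r); first by rewrite lt_min d0.
split; first by rewrite ge_min lexx orbT.
by move=> y; rewrite lt_min => /andP[/hd ? /h ?].
Qed.

Section Estimates.
Variables (f : V -> C) (p : V) (r B : R).
Hypotheses (r0 : 0 < r) (fB : hol_ball f p r B).

Lemma hol_ball_ge0 : 0 <= B.
Proof.
by apply: le_trans (cmod_ge0 (f p)) (fB _).2; rewrite subrr (rn0 rn_enorm).
Qed.

Lemma line_disc (h : V) : h != 0 -> forall l : C, cmod (l - 0) < r / enorm h ->
  enorm (p + l *: h - p) < r.
Proof.
move=> h0 l; rewrite subr0 ltr_pdivlMr ?enorm_gt0//.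
by rewrite addrC addKr enormZ.
Qed.

Lemma hol_lip h : enorm h <= r / 6 -> cmod (f (p + h) - f p) <= 6 * B / r * enorm h.
Proof.
move=> hr; have [->|h0] := eqVneq h 0.
  by rewrite addr0 subrr cmod0 (rn0 rn_enorm) mulr0.
have hp : 0 < enorm h by rewrite enorm_gt0.
have rr := r0.
(* In the parameter of the complex line through [h] the slice is a disc of radius [r / enorm h]. A
   third of it is below the half that Cauchy's estimates allow, and [enorm h <= r / 6] makes the
   step 1 at most [rho / 2]. *)
pose rho := r / 3 / enorm h.
have rho0 : 0 < rho by rewrite !divr_gt0.
have rhor : rho < r / enorm h / 2.
  by rewrite /rho mulrAC ltr_pM2l ?divr_gt0// ltf_pV2 ?posrE//; lra.
have := @cauchy_lip R (fun l => f (p + l *: h)) 0 (r / enorm h) rho rho0 rhor _ B _ 1.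
rewrite add0r scale1r scale0r addr0 cmod1 mulr1 => H.
have -> : 6 * B / r * enorm h = 2 * B / rho.
  by rewrite /rho; field; rewrite !gt_eqF.
apply: H.
- by move=> l /(line_disc h0) /fB[/hol_line].
- by move=> l /(line_disc h0) /fB[].
- rewrite /rho ler_pdivlMr// ler_pdivlMr//; lra.
Qed.

Lemma hol_taylor d h : hderiv f p d -> enorm h <= r / 6 ->
  cmod (f (p + h) - f p - (h *m d) ord0 ord0) <= 18 * B / r ^+ 2 * enorm h ^+ 2.
Proof.
move=> hd hr; have [->|h0] := eqVneq h 0.
  by rewrite addr0 subrr mul0mx mxE subrr cmod0 (rn0 rn_enorm) expr0n mulr0.
have hp : 0 < enorm h by rewrite enorm_gt0.
have rr := r0.
pose rho := r / 3 / enorm h.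
have rho0 : 0 < rho by rewrite !divr_gt0.
have rhor : rho < r / enorm h / 2.
  by rewrite /rho mulrAC ltr_pM2l ?divr_gt0// ltf_pV2 ?posrE//; lra.
have := @cauchy_taylor R (fun l => f (p + l *: h)) 0 (r / enorm h) rho rho0 rhor _ B _ ((h *m d) ord0 ord0) 1.
rewrite add0r scale1r scale0r addr0 cmod1 mul1r expr1n mulr1 => H.
have -> : 18 * B / r ^+ 2 * enorm h ^+ 2 = 2 * B / rho ^+ 2.
  by rewrite /rho; field; rewrite !gt_eqF.
apply: H.
- by move=> l /(line_disc h0) /fB[/hol_line].
- by move=> l /(line_disc h0) /fB[].
- by apply: hderiv_line; rewrite scale0r addr0.
- rewrite /rho ler_pdivlMr// ler_pdivlMr//; lra.
Qed.

End Estimates.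

Lemma enorm_delta (j : 'I_n) : enorm (delta_mx ord0 j : V) = 1.
Proof.
apply/eqP; rewrite -(eqrXn2 (n := 2))// ?enorm_ge0// expr1n enorm_sqr.
rewrite (bigD1 j)//= big1 ?mxE ?eqxx ?cmod1 ?expr1n ?addr0// => i ij.
by rewrite mxE (negPf ij) andbF cmod0 expr0n.
Qed.

Lemma delta_mul_col (j : 'I_n) (d : 'cV[C]_n) :
  ((delta_mx ord0 j : V) *m d) ord0 ord0 = d j ord0.
Proof. by rewrite -rowE mxE. Qed.

(** Both partial derivatives are compared with difference quotients of the same step s in direction
    j. Taylor's remainder costs a multiple of s, and the two quotients differ by a multiple of |q -
    p| / s; so s is fixed first and |q - p| is taken small afterwards. *)
Lemma partial_cont (f : V -> C) p r B d : 0 < r -> hol_ball f p r B -> hderiv f p d ->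
  forall e : R, 0 < e -> exists2 del : R, 0 < del &
    forall q d', enorm (q - p) < del -> hderiv f q d' ->
    forall j, cmod (d' j ord0 - d j ord0) < e.
Proof.
move=> r0 fB hd e e0; have B0 := hol_ball_ge0 r0 fB.
pose K := 72 * B / r ^+ 2; pose L := 12 * B / r.
have K0 : 0 <= K by rewrite divr_ge0 ?exprn_ge0 ?mulr_ge0// ltW.
have L0 : 0 <= L by rewrite divr_ge0 ?mulr_ge0// ltW.
pose s := Num.min (r / 12) (e / (4 * (K + 1))).
have K1 : 0 < 4 * (K + 1) by lra.
have s0 : 0 < s by rewrite lt_min !divr_gt0.
have sr : s <= r / 12 by rewrite ge_min lexx.
have sK : s * K < e / 4.
  apply: (@le_lt_trans _ _ (e / (4 * (K + 1)) * K)).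
    by rewrite ler_wpM2r// ge_min lexx orbT.
  by rewrite mulrAC ltr_pdivrMr//; nra.
have L1 : 0 < 4 * (L + 1) by lra.
exists (Num.min (r / 12) (s * e / (4 * (L + 1)))).
  by rewrite lt_min !divr_gt0// mulr_gt0.
move=> q d'; rewrite lt_min => /andP[q1 q2] hd' j.
pose h : V := (s%:C)%C *: delta_mx ord0 j.
have hs : enorm h = s by rewrite enormZ enorm_delta mulr1 cmodR gtr0_norm.
have hE (a : 'cV[C]_n) : (h *m a) ord0 ord0 = (s%:C)%C * a j ord0.
  by rewrite -scalemxAl mxE delta_mul_col.
have r2 : 0 < r / 2 by lra.
have fq : hol_ball f q (r / 2) B by apply: hol_ball_sub fB _; lra.
have fp : hol_ball f p (r / 2) B by apply: hol_ball_sub fB _; rewrite subrr (rn0 rn_enorm); lra.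
have fph : hol_ball f (p + h) (r / 2) B.
  by apply: hol_ball_sub fB _; rewrite [p + h]addrC addrK hs; lra.
have hr : enorm h <= r / 2 / 6 by rewrite hs; lra.
have qr : enorm (q - p) <= r / 2 / 6 by lra.
have t1 := hol_taylor r2 fq hd' hr; have t2 := hol_taylor r2 fp hd hr.
have l1 := hol_lip r2 fp qr; have l2 := hol_lip r2 fph qr.
rewrite hs hE in t1; rewrite hs hE in t2.
have cE : 18 * B / (r / 2) ^+ 2 = K by rewrite /K; field; rewrite gt_eqF.
have cE2 : 6 * B / (r / 2) = L by rewrite /L; field; rewrite gt_eqF.
rewrite cE in t1 t2; rewrite cE2 in l1 l2.
have q3 : L * enorm (q - p) <= s * e / 4.
  apply: (@le_trans _ _ (L * (s * e / (4 * (L + 1))))); first by rewrite ler_wpM2l// ltW.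
  rewrite mulrA ler_pdivrMr//; have := mulr_gt0 s0 e0; nra.
have E : (s%:C)%C * (d' j ord0 - d j ord0) =
   - (f (q + h) - f q - (s%:C)%C * d' j ord0) + (f (p + h) - f p - (s%:C)%C * d j ord0)
   + ((f (p + h + (q - p)) - f (p + h)) + - (f (p + (q - p)) - f p)).
  have -> : p + h + (q - p) = q + h by rewrite addrAC addrCA subrr addr0.
  have -> : p + (q - p) = q by rewrite addrCA subrr addr0.
  by ring.
have : s * cmod (d' j ord0 - d j ord0) <= 2 * (K * s ^+ 2) + 2 * (L * enorm (q - p)).
  rewrite -[X in X * _ <= _](gtr0_norm s0) -cmodR -cmodM E.
  apply: le_trans (rnD rn_cmod _ _) _; apply: lerD.
    apply: le_trans (rnD rn_cmod _ _) _; rewrite (rnN rn_cmod); lra.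
  by apply: le_trans (rnD rn_cmod _ _) _; rewrite (rnN rn_cmod); lra.
rewrite -(ltr_pM2l s0); nra.
Qed.

End SeveralVariables.

(** * Differentiation of means, Jacobian matrices and the inverse function theorem *)

Section Jacobian.
Context {R : realType} {n : nat}.
Local Notation C := R[i].
Local Notation V := 'rV[C]_n.
Local Notation vcont := (contat (@enorm R n) (@cmod R)).

Lemma cmean_sum (I : Type) (s : seq I) (g : I -> R -> C) :
  (forall i t, rcont (g i) t) ->
  cmean (fun t => \sum_(i <- s) g i t) = \sum_(i <- s) cmean (g i).
Proof.
move=> cg; elim: s => [|i s IH].
  rewrite big_nil -[RHS](cmean_cst (0 : C)); congr cmean; apply/funext => t.
  by rewrite big_nil.
rewrite big_cons -IH -cmean_add//; last first.
  elim: s {IH} => [|k s IH] t.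
    apply: (contat_ext rn_abs ltr01 _ (contat_cst rn_cmod (0 : C) t)) => y _.
    by rewrite big_nil.
  apply: (contat_ext rn_abs ltr01 _ (contat_add rn_cmod (cg k t) (IH t))) => y _.
  by rewrite big_cons.
by congr cmean; apply/funext => t; rewrite big_cons.
Qed.

(** The derivative is the weighted mean of the derivatives of [f] along the curve: Taylor's
    remainder is bounded uniformly in t because [r] and [B] do not depend on t. *)
Lemma mean_hol (f : V -> C) (gam : R -> V) (w : R -> C) z (r B W : R) : 0 < r ->
  (forall t, contat (fun x : R => `|x|) (@enorm R n) gam t) ->
  (forall t, rcont w t) -> (forall t, cmod (w t) <= W) ->
  (forall t, hol_ball f (z + gam t) r B) ->
  hol (fun y => cmean (fun t => w t * f (y + gam t))) z.
Proof.
move=> r0 cgam cw wW fB.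
have /choice[D hD] : forall t, exists d, hderiv f (z + gam t) d.
  by move=> t; have [] := fB t (z + gam t); rewrite ?subrr ?(rn0 rn_enorm).
have cf y t : enorm (y - z) < r -> rcont (fun t => w t * f (y + gam t)) t.
  move=> yr; apply: contat_mul (cw t) _.
  apply: (@contat_comp _ _ _ _ _ (@enorm R n) _ (fun t => y + gam t) f).
    by apply: (contat_add rn_enorm) => //; exact: contat_cst rn_enorm _ _.
  apply: hol_cont; apply: (fB t _ _).1.
  by rewrite opprD addrACA subrr addr0.
have cD j t : rcont (fun t => w t * D t j ord0) t.
  apply: contat_mul (cw t) _ => e e0.
  have [d d0 h] := partial_cont r0 (fB t) (hD t) e0.
  have [d' d'0 h'] := cgam t d d0; exists d' => // y /h' yd.
  by apply: h (hD y) j; rewrite opprD addrACA subrr add0r.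
pose Db : 'cV[C]_n := \col_j cmean (fun t => w t * D t j ord0).
have W0 : 0 <= W by apply: le_trans (cmod_ge0 (w 0)) (wW 0).
have B0 := hol_ball_ge0 r0 (fB 0).
pose K := W * (18 * B / r ^+ 2).
have K0 : 0 <= K by rewrite mulr_ge0// divr_ge0 ?exprn_ge0 ?mulr_ge0// ltW.
exists Db; apply: hderivP => e e0.
have K1 : 0 < K + 1 by lra.
exists (Num.min (r / 6) (e / (K + 1))); first by rewrite lt_min !divr_gt0.
move=> y; rewrite lt_min => /andP[yr]; rewrite ltr_pdivlMr// => yK.
have yr' : enorm (y - z) < r by lra.
have zr : enorm (z - z) < r by rewrite subrr (rn0 rn_enorm).
pose g j t := (- (y - z) ord0 j) * (w t * D t j ord0).
have cg j t : rcont (g j) t by apply: contat_mul (contat_cst rn_cmod _ _) (cD _ _).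
have -> : cmean (fun t => w t * f (y + gam t)) - cmean (fun t => w t * f (z + gam t)) -
    ((y - z) *m Db) ord0 ord0 =
  cmean (fun t => (w t * f (y + gam t) + (- 1) * (w t * f (z + gam t))) + \sum_j g j t).
  rewrite cmean_add ?cmean_add ?cmean_scale ?cmean_sum//.
  - rewrite mulN1r; congr (_ + _); rewrite mxE -sumrN; apply: eq_bigr => j _.
    by rewrite /g cmean_scale// [Db j _]mxE mulNr.
  - by move=> t; exact: cf.
  - by move=> t; exact: cf.
  - by move=> t; apply: contat_mul (contat_cst rn_cmod _ _) (cf _ _ zr).
  - by move=> t; apply: (contat_add rn_cmod) (cf _ _ yr') (contat_mul (contat_cst rn_cmod _ _) (cf _ _ zr)).
  - elim: (index_enum _) => [|k s IH] t.
      apply: (contat_ext rn_abs ltr01 _ (contat_cst rn_cmod (0 : C) t)) => u _.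
      by rewrite big_nil.
    apply: (contat_ext rn_abs ltr01 _ (contat_add rn_cmod (cg k t) (IH t))) => u _.
    by rewrite big_cons.
apply: (@le_trans _ _ (K * enorm (y - z) ^+ 2)); last first.
  rewrite expr2 mulrA ler_wpM2r ?enorm_ge0//.
  have := enorm_ge0 (y - z); lra.
have yr6 : enorm (y - z) <= r / 6 by exact: ltW.
apply: cmean_le => [t|t].
  apply: (contat_add rn_cmod).
    exact: (contat_add rn_cmod) (cf _ _ yr') (contat_mul (contat_cst rn_cmod _ _) (cf _ _ zr)).
  elim: (index_enum _) => [|k s IH].
    apply: (contat_ext rn_abs ltr01 _ (contat_cst rn_cmod (0 : C) t)) => u _.
    by rewrite big_nil.
  apply: (contat_ext rn_abs ltr01 _ (contat_add rn_cmod (cg k t) IH)) => u _.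
  by rewrite big_cons.
have -> : w t * f (y + gam t) + -1 * (w t * f (z + gam t)) + \sum_j g j t =
  w t * (f (z + gam t + (y - z)) - f (z + gam t) - ((y - z) *m D t) ord0 ord0).
  have -> : z + gam t + (y - z) = y + gam t by rewrite addrAC addrCA subrr addr0.
  have -> : \sum_j g j t = - (w t * ((y - z) *m D t) ord0 ord0).
    by rewrite mxE mulr_sumr -sumrN; apply: eq_bigr => j _; rewrite /g; ring.
  ring.
rewrite cmodM /K -(mulrA W); apply: ler_pM; rewrite ?cmod_ge0 ?wW//.
have := hol_taylor r0 (fB t) (hD t) yr6. by [].
Qed.

Definition grad (f : V -> C) y : 'cV[C]_n := xget 0 [set d | @hderiv R n f y d].

Lemma gradP (f : V -> C) y : hol f y -> hderiv f y (grad f y).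
Proof. by move=> [d hd]; have := xgetI 0 hd. Qed.

(** Cauchy's formula writes the partial derivative at every y near z as a weighted mean of [f] over
    one fixed circle translated to y, and [mean_hol] differentiates such means. *)
Lemma grad_hol (f : V -> C) z (r B : R) j : 0 < r -> hol_ball f z r B ->
  hol (fun y => grad f y j ord0) z.
Proof.
move=> r0 fB; pose rho := r / 8.
have rho0 : 0 < rho by rewrite /rho; lra.
pose gam t : V := circ rho t *: delta_mx ord0 j.
have gamn t : enorm (gam t) = rho by rewrite enormZ enorm_delta mulr1 cmod_circle.
have r4 : 0 < r / 4 by lra.
apply: (@hol_ext R n (fun y => cmean (fun t => (circ rho t)^-1 * f (y + gam t))) _ z _ r4).
  move=> y yr.
  have fy : hol_ball f y (r / 2) B by apply: hol_ball_sub fB _; lra.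
  have dd l : cmod (l - 0) < r / 2 -> enorm (y + l *: (delta_mx ord0 j : V) - y) < r / 2.
    by rewrite subr0 [y + _]addrC addrK enormZ enorm_delta mulr1.
  have rr : rho < r / 2 / 2 by rewrite /rho; lra.
  have h1 : forall l, cmod (l - 0) < r / 2 -> exists d, cderiv (fun l => f (y + l *: delta_mx ord0 j)) l d.
    by move=> l /dd /fy[/hol_line].
  have h2 : forall l, cmod (l - 0) < r / 2 -> cmod (f (y + l *: delta_mx ord0 j)) <= B.
    by move=> l /dd /fy[].
  have := @cderiv_cauchy R (fun l => f (y + l *: delta_mx ord0 j)) 0 (r / 2) rho rho0 rr h1 B h2.
  have h3 : cderiv (fun l => f (y + l *: delta_mx ord0 j)) 0 (grad f y j ord0).
    rewrite -delta_mul_col; apply: hderiv_line; rewrite scale0r addr0; apply: gradP.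
    by apply: (fy _ _).1; rewrite subrr (rn0 rn_enorm); lra.
  move=> /(cderiv_unique h3) ->; rewrite /cauchy_deriv; congr cmean; apply/funext => t.
  by rewrite add0r mulrC.
have r2 : 0 < r / 2 by lra.
apply: (@mean_hol _ _ _ _ (r / 2) B rho^-1 r2).
- move=> t e e0; have [d d0 h] := rcont_circle rho t e0; exists d => // y /h.
  by rewrite -scalerBl enormZ enorm_delta mulr1.
- by move=> t; exact: rcont_circ_inv rho0 t.
- by move=> t; rewrite cmodV cmod_circle.
- by move=> t; apply: hol_ball_sub fB _; rewrite [z + _]addrC addrK gamn /rho; lra.
Qed.

Definition vhol (f : V -> V) z := forall i, hol (fun y => f y ord0 i) z.

(** Vectors are rows and matrices act on the right, so this is the transpose of the usual Jacobian
    matrix. *)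
Definition jac (f : V -> V) z : 'M[C]_n :=
  \matrix_(j, i) grad (fun y => f y ord0 i) z j ord0.

Lemma mul_jac f z (h : V) i :
  (h *m jac f z) ord0 i = (h *m grad (fun y => f y ord0 i) z) ord0 ord0.
Proof. by rewrite !mxE; apply: eq_bigr => j _; rewrite mxE. Qed.

Lemma det_jac_hol (f : V -> V) z (r : R) : 0 < r -> (forall y, enorm (y - z) < r -> vhol f y) ->
  hol (fun y => \det (jac f y)) z.
Proof.
move=> r0 fh; rewrite /determinant; apply: hol_sum => s.
apply: hol_mul; first exact: hol_cst.
apply: hol_prod => i.
have [|d d0 [_ h]] := @hol_ball_exists R n (fun y => f y ord0 (s i)) z r r0.
  by move=> y /fh.
apply: hol_ext ltr01 _ (grad_hol i d0 h) => y _; by rewrite mxE.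
Qed.

Lemma fin_delta (I : finType) (P : I -> R -> Prop) :
  (forall i d d', d' <= d -> P i d -> P i d') ->
  (forall i, exists2 d : R, 0 < d & P i d) -> exists2 d : R, 0 < d & forall i, P i d.
Proof.
move=> mono H.
have [d d0 hd] : exists2 d : R, 0 < d & forall i, i \in enum I -> P i d.
  elim: (enum I) => [|i s [d d0 hd]]; first by exists 1.
  have [d' d'0 hd'] := H i; exists (Num.min d d'); first by rewrite lt_min d0.
  move=> k; rewrite inE => /orP[/eqP ->|/hd h].
    by apply: mono hd'; rewrite ge_min lexx orbT.
  by apply: mono h; rewrite ge_min lexx.
by exists d => // i; apply: hd; rewrite mem_enum.
Qed.

(** Strict differentiability, on which local injectivity and the constant rank argument rest: expand
    at y, where the remainder is quadratic, then replace the gradient at y by the gradient at z. *)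
Lemma strict_grad (g : V -> C) z (r : R) : 0 < r ->
  (forall y, enorm (y - z) < r -> hol g y) ->
  forall e : R, 0 < e -> exists2 d : R, 0 < d & forall x y,
    enorm (x - z) < d -> enorm (y - z) < d ->
    cmod (g x - g y - ((x - y) *m grad g z) ord0 ord0) <= e * enorm (x - y).
Proof.
move=> r0 hg e e0; have [s s0 [_ gB]] := hol_ball_exists r0 hg.
set B := cmod _ + 1 in gB; have B0 := hol_ball_ge0 s0 gB.
have gz : hol g z by apply: (gB _ _).1; rewrite subrr (rn0 rn_enorm).
have n0 : 0 <= n%:R :> R by [].
have e1 : 0 < e / (2 * (n%:R + 1)) by rewrite divr_gt0//; lra.
have [d1 d10 h1] := partial_cont s0 gB (gradP gz) e1.
pose K := 72 * B / s ^+ 2.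
have K0 : 0 <= K by rewrite divr_ge0 ?exprn_ge0 ?mulr_ge0// ltW.
have K1 : 0 < 4 * (K + 1) by lra.
exists (Num.min d1 (Num.min (s / 24) (e / (4 * (K + 1))))).
  by rewrite !lt_min d10 !divr_gt0.
move=> x y; rewrite !lt_min => /and3P[_ x2 x3] /and3P[y1 y2 y3].
have s2 : 0 < s / 2 by lra.
have gy : hol_ball g y (s / 2) B by apply: hol_ball_sub gB _; lra.
have hy : hol g y by apply: (gB _ _).1; lra.
have xy := rn_dist3 rn_enorm x z y; rewrite (rn_distC rn_enorm z) in xy.
have xy6 : enorm (x - y) <= s / 2 / 6 by lra.
have := hol_taylor s2 gy (gradP hy) xy6.
have -> : y + (x - y) = x by rewrite addrCA subrr addr0.
have -> : 18 * B / (s / 2) ^+ 2 = K by rewrite /K; field; rewrite gt_eqF.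
move=> t1.
have t2 := @mul_col_le R n (x - y) (grad g y - grad g z) (e / (2 * (n%:R + 1))).
have {}t2 : cmod (((x - y) *m (grad g y - grad g z)) ord0 ord0) <= e / 2 * enorm (x - y).
  apply: le_trans (t2 _) _.
    by move=> j; rewrite !mxE; exact: ltW (h1 y (grad g y) y1 (gradP hy) j).
  rewrite ler_wpM2r ?enorm_ge0// mulrA ler_pdivrMr; last by lra.
  by rewrite mulrAC -mulrA; nra.
have -> : g x - g y - ((x - y) *m grad g z) ord0 ord0 =
   (g x - g y - ((x - y) *m grad g y) ord0 ord0) +
   ((x - y) *m (grad g y - grad g z)) ord0 ord0.
  by rewrite mulmxBr [X in _ = _ + X]mxE [X in _ = _ + (_ + X)]mxE addrA subrK.
apply: le_trans (rnD rn_cmod _ _) _.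
have : K * enorm (x - y) ^+ 2 <= e / 2 * enorm (x - y).
  rewrite expr2 mulrA ler_wpM2r ?enorm_ge0//.
  have k1 : enorm (x - y) <= e / (2 * (K + 1)).
    have -> : e / (2 * (K + 1)) = 2 * (e / (4 * (K + 1))) by field; lra.
    lra.
  apply: le_trans (ler_wpM2l K0 k1) _; rewrite mulrA ler_pdivrMr; last by lra.
  nra.
lra.
Qed.

Lemma strict_deriv (f : V -> V) z (r : R) : 0 < r ->
  (forall y, enorm (y - z) < r -> vhol f y) ->
  forall e : R, 0 < e -> exists2 d : R, 0 < d & forall x y,
    enorm (x - z) < d -> enorm (y - z) < d ->
    enorm (f x - f y - (x - y) *m jac f z) <= e * enorm (x - y).
Proof.
move=> r0 hf e e0.
have n0 : 0 <= n%:R :> R by [].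
have e1 : 0 < e / (n%:R + 1) by rewrite divr_gt0//; lra.
pose P (i : 'I_n) (d : R) := forall x y, enorm (x - z) < d -> enorm (y - z) < d ->
    cmod (f x ord0 i - f y ord0 i - ((x - y) *m grad (fun y => f y ord0 i) z) ord0 ord0)
     <= e / (n%:R + 1) * enorm (x - y).
have [||d d0 hd] := @fin_delta 'I_n P.
- move=> i d d' dd h x y xd yd; apply: h; exact: lt_le_trans dd.
- by move=> i; apply: strict_grad r0 _ _ e1 => y /hf.
exists d => // x y xd yd; apply: le_trans (enorm_le_sum _) _.
apply: (@le_trans _ _ (\sum_(j < n) e / (n%:R + 1) * enorm (x - y))).
  apply: ler_sum => i _; have := hd i x y xd yd; apply: le_trans.
  by rewrite -mul_jac !mxE.
rewrite sumr_const card_ord -(mulr_natl (e / (n%:R + 1) * enorm (x - y)) n) mulrA.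
rewrite ler_wpM2r ?enorm_ge0// mulrA ler_pdivrMr; last by lra.
nra.
Qed.

Lemma mulmx_bound (M : 'M[C]_n) : exists2 K : R, 0 < K & forall v : V, enorm (v *m M) <= K * enorm v.
Proof.
pose S := \sum_i \sum_j cmod (M j i).
have S0 : 0 <= S by apply: sumr_ge0 => i _; apply: sumr_ge0 => j _; exact: cmod_ge0.
have n0 : 0 <= n%:R :> R by [].
exists (n%:R * (n%:R * S) + 1) => [|v].
  by rewrite ltr_wpDl// !mulr_ge0.
have H i : cmod ((v *m M) ord0 i) <= n%:R * S * enorm v.
  have -> : (v *m M) ord0 i = (v *m col i M) ord0 ord0 by rewrite !mxE; apply: eq_bigr => j _; rewrite mxE.
  apply: mul_col_le => j; rewrite mxE /S (bigD1 i)//= (bigD1 j)//= -addrA lerDl.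
  by rewrite addr_ge0// sumr_ge0// => *; rewrite ?sumr_ge0// => *; exact: cmod_ge0.
apply: le_trans (enorm_le_sum _) _.
apply: (@le_trans _ _ (\sum_(i < n) n%:R * S * enorm v)); first exact: ler_sum.
rewrite sumr_const card_ord -(mulr_natl (n%:R * S * enorm v) n) !mulrA mulrDl mul1r.
by rewrite lerDl enorm_ge0.
Qed.

Lemma vhol_cont (f : V -> V) z : vhol f z -> contat (@enorm R n) (@enorm R n) f z.
Proof.
move=> hf e e0; have n0 : 0 <= n%:R :> R by [].
have e1 : 0 < e / (n%:R + 1) by rewrite divr_gt0//; lra.
pose P (i : 'I_n) (d : R) := forall y, enorm (y - z) < d ->
  cmod (f y ord0 i - f z ord0 i) < e / (n%:R + 1).
have [||d d0 hd] := @fin_delta 'I_n P.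
- move=> i d d' dd h y yd; apply: h; exact: lt_le_trans dd.
- by move=> i; have [d d0 h] := hol_cont (hf i) e1; exists d.
exists d => // y yd; apply: le_lt_trans (enorm_le_sum _) _.
apply: (@le_lt_trans _ _ (\sum_(i < n) e / (n%:R + 1))).
  by apply: ler_sum => i _; rewrite !mxE; apply/ltW/hd.
rewrite sumr_const card_ord -(mulr_natl (e / (n%:R + 1)) n) mulrCA gtr_pMr//.
by rewrite ltr_pdivrMr; lra.
Qed.

(* The preimage of q minimises |Phi x - q| on a closed ball: at a minimiser with
   Phi x <> q, moving x by a small multiple of q - Phi x decreases this distance. *)
Lemma surj_near (Phi : V -> V) z (d : R) : 0 < d ->
  (forall x y, enorm (x - z) < d -> enorm (y - z) < d ->
     enorm (Phi x - Phi y - (x - y)) <= enorm (x - y) / 2) ->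
  forall q, enorm (q - Phi z) < d / 8 -> exists2 x, enorm (x - z) < d & Phi x = q.
Proof.
move=> d0 hPhi q hq.
have inK y : enorm (y - z) <= d / 2 -> enorm (y - z) < d by lra.
have low x y : enorm (x - z) < d -> enorm (y - z) < d -> enorm (x - y) <= 2 * enorm (Phi x - Phi y).
  move=> xd yd; have := hPhi x y xd yd.
  have := rn_dist rn_enorm (x - y) (Phi x - Phi y); rewrite (rn_distC rn_enorm (x - y)); lra.
have up x y : enorm (x - z) < d -> enorm (y - z) < d -> enorm (Phi x - Phi y) <= 2 * enorm (x - y).
  move=> xd yd; have := hPhi x y xd yd.
  have := rn_dist rn_enorm (Phi x - Phi y) (x - y); have := enorm_ge0 (x - y); lra.
have [||w /= wK wmin] := @seqcompact_min R _ _ _ (fun x => enorm (Phi x - q)) (@seqcompact_eball R n z (d / 2)).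
- by exists z => /=; rewrite subrr (rn0 rn_enorm); lra.
- move=> x /= xK; apply: (contat_norm (f := fun x => Phi x - q) rn_enorm).
  apply: (contat_add rn_enorm); last exact: contat_cst rn_enorm _ _.
  move=> e e0; exists (Num.min (d / 2) (e / 2)); first by rewrite lt_min !divr_gt0.
  move=> y; rewrite lt_min => /andP[y1 y2].
  have yd : enorm (y - z) < d by have := rn_dist3 rn_enorm y x z; lra.
  rewrite -[y]/(id y); have := up _ _ yd (inK _ xK) => /=; lra.
exists w; first exact: inK.
have zd : enorm (z - z) < d by rewrite subrr (rn0 rn_enorm).
(* [low] gives |w - z| <= 2 |Phi w - Phi z| <= 4 |Phi z - q|, which is where the radius d / 8 comes
   from. The minimiser is interior, so it can still be moved. *)
have wz : enorm (w - z) < d / 2.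
  have l1 := low _ _ (inK _ wK) zd.
  have l2 : enorm (Phi w - q) <= enorm (Phi z - q).
    by apply: wmin; rewrite subrr (rn0 rn_enorm); lra.
  have := rn_dist3 rn_enorm (Phi w) q (Phi z).
  rewrite (rn_distC rn_enorm (Phi z)) in l2; lra.
apply/eqP; rewrite -subr_eq0 -enorm_eq0; apply/negP => /negP v0.
pose v := q - Phi w.
have vE : enorm v = enorm (Phi w - q) by rewrite (rn_distC rn_enorm).
have vp : 0 < enorm v by rewrite vE lt0r v0 enorm_ge0.
pose t := Num.min 1 ((d / 2 - enorm (w - z)) / enorm v).
have t0 : 0 < t by rewrite lt_min ltr01 divr_gt0// subr_gt0.
have t1 : t <= 1 by rewrite ge_min lexx.
have tv : t * enorm v <= d / 2 - enorm (w - z).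
  by rewrite -ler_pdivlMr// ge_min lexx orbT.
pose w' := w + (t%:C)%C *: v.
have w'w : w' - w = (t%:C)%C *: v by rewrite /w' addrC addKr.
have nw : enorm (w' - w) = t * enorm v by rewrite w'w enormZ cmodR gtr0_norm.
have w'K : enorm (w' - z) <= d / 2 by have := rn_dist3 rn_enorm w' w z; lra.
have := wmin _ w'K; rewrite -vE.
have := hPhi _ _ (inK _ w'K) (inK _ wK); rewrite nw.
have -> : Phi w' - q = (Phi w' - Phi w - (w' - w)) + ((t - 1)%:C)%C *: v.
  rewrite w'w rmorphB rmorph1 scalerBl scale1r [RHS]addrA subrK /v opprB.
  by rewrite [RHS]addrA subrK.
have := rnD rn_enorm (Phi w' - Phi w - (w' - w)) (((t - 1)%:C)%C *: v).
have -> : enorm (((t - 1)%:C)%C *: v) = (1 - t) * enorm v.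
  by rewrite enormZ cmodR distrC ger0_norm// subr_ge0.
nra.
Qed.

(** Composition with the inverse of the derivative at z turns f into a perturbation of the identity
    with Lipschitz constant 1/2; this gives the lower bound, and [surj_near] gives the preimages in
    every smaller ball. *)
Lemma local_inverse (f : V -> V) z (r : R) : 0 < r ->
  (forall y, enorm (y - z) < r -> vhol f y) -> jac f z \in unitmx ->
  exists2 d : R, 0 < d & exists2 K : R, 0 < K &
    (forall x y, enorm (x - z) < d -> enorm (y - z) < d ->
       enorm (x - y) <= K * enorm (f x - f y)) /\
    forall s : R, 0 < s -> s <= d -> exists2 eta : R, 0 < eta & forall q,
      enorm (q - f z) < eta -> exists2 x, enorm (x - z) < s & f x = q.
Proof.
move=> r0 hf uA; set A := jac f z in uA.
have [K K0 hK] := mulmx_bound (invmx A).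
have [KA KA0 hKA] := mulmx_bound A.
have e0 : 0 < (2 * K)^-1 by rewrite invr_gt0 mulr_gt0.
have [d d0 hd] := strict_deriv r0 hf e0.
pose Phi x := f x *m invmx A.
have half x y : enorm (x - z) < d -> enorm (y - z) < d ->
     enorm (Phi x - Phi y - (x - y)) <= enorm (x - y) / 2.
  move=> xd yd; have -> : Phi x - Phi y - (x - y) = (f x - f y - (x - y) *m A) *m invmx A.
    by rewrite /Phi !mulmxBl !mulmxK.
  apply: le_trans (hK _) _; apply: le_trans (ler_wpM2l (ltW K0) (hd _ _ xd yd)) _.
  by rewrite le_eqVlt; apply/orP; left; apply/eqP; field; rewrite gt_eqF.
exists d => //; exists (2 * K); first by rewrite mulr_gt0.
split.
  move=> x y xd yd; have := half x y xd yd.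
  have := rn_dist rn_enorm (x - y) (Phi x - Phi y); rewrite (rn_distC rn_enorm (x - y)).
  have := hK (f x - f y); rewrite mulmxBl -/(Phi x) -/(Phi y); lra.
move=> s s0 sd; exists (s / (8 * K)); first by rewrite divr_gt0// mulr_gt0.
move=> q; rewrite ltr_pdivlMr ?mulr_gt0// => hq.
have [||x xs hx] := @surj_near Phi z s s0 _ (q *m invmx A).
- by move=> x y xs ys; apply: half; exact: lt_le_trans sd.
- by rewrite -mulmxBl; have := hK (q - f z); lra.
exists x => //; by have := congr1 (mulmx^~ A) hx; rewrite /Phi !mulmxKV.
Qed.

End Jacobian.

(** * Injective holomorphic maps *)

Section InjectiveRank.
Context {R : realType} {n : nat}.
Local Notation C := R[i].
Local Notation V := 'rV[C]_n.

Lemma subr_addACA (Z : zmodType) (a b c d : Z) : (a + b) - (c + d) = (a - c) + (b - d).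
Proof. by rewrite opprD addrACA. Qed.

Lemma subr_cancel (Z : zmodType) (a b c : Z) : (a - c) - (b - c) = a - b.
Proof. by rewrite opprB addrA subrK. Qed.

Lemma add_sub_eq (Z : zmodType) (a b c d : Z) : d = b + a -> (a + c) - d = c - b.
Proof. by move=> ->; rewrite opprD addrACA addrC subrKA. Qed.

Lemma addr_cancel (Z : zmodType) (a b c : Z) : (a + b) + (c - b) = a + c.
Proof. by rewrite addrACA subrr addr0. Qed.

(** Write P for [pid_mx k]. Since P M P = P, the product P M has the rank of M, so its rows span
    those of M. Right multiplication by P is injective on that span, as x P M P = x P, and it sends
    e M to e P = 0. *)
Lemma rank_pid_kill (M : 'M[C]_n) k (e : V) : (k <= n)%N -> (\rank M <= k)%N ->
  M *m (pid_mx k : 'M[C]_n) = pid_mx k -> e *m (pid_mx k : 'M[C]_n) = 0 -> e *m M = 0.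
Proof.
move=> kn rM MP eP; pose P : 'M[C]_n := pid_mx k.
have PP : P *m P = P by rewrite pid_mx_id.
have rP : \rank P = k by rewrite rank_pid_mx.
have sub : (P *m M <= M)%MS by exact: submxMl.
have rPM : (\rank M <= \rank (P *m M))%N.
  have PMP : P *m M *m P = P by rewrite -mulmxA MP PP.
  by apply: leq_trans rM _; rewrite -[X in (X <= _)%N]rP -{1}PMP mxrankM_maxl.
have MPM : (M <= P *m M)%MS by rewrite -(geq_leqif (mxrank_leqif_sup sub)).
have /submxP[x hx] : (e *m M <= P *m M)%MS by apply: submx_trans (submxMl _ _) MPM.
have xP : x *m P = 0.
  have : e *m M *m P = x *m P by rewrite hx -!mulmxA MP PP.
  by rewrite -mulmxA MP eP => <-.
by rewrite hx mulmxA xP mul0mx.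
Qed.

(** [N] is the derivative of the map [Theta] of the next lemma at a point where f has the derivative
    [M], and the claim is that f is stationary along curves on which [Theta] moves in the direction
    [e *m invmx L]. After the change of coordinates by [L], [N] and [U], M becomes [M'] with M' D =
    D and rank at most k, so [rank_pid_kill] applies. *)
Lemma normal_form_kill (M L U : 'M[C]_n) k (e : V) :
  let D : 'M[C]_n := pid_mx k in
  let N := L *m (1%:M - D) *m invmx L + M *m (invmx U *m D *m invmx L) in
  (k <= n)%N -> L \in unitmx -> U \in unitmx -> N \in unitmx -> (\rank M <= k)%N ->
  e *m D = 0 -> e *m invmx L *m invmx N *m M = 0.
Proof.
move=> D N kn uL uU uN rM eD.
have DD : D *m D = D by rewrite pid_mx_id.
pose E := L *m (1%:M - D) *m invmx L; pose B := invmx U *m D *m invmx L.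
have ELD : E *m L *m D = 0.
  by rewrite /E mulmxKV// -mulmxA mulmxBl mul1mx DD subrr mulmx0.
have BLD : B *m L *m D = invmx U *m D by rewrite /B mulmxKV// -mulmxA DD.
have NLD : N *m (L *m D) = M *m (invmx U *m D).
  transitivity (E *m (L *m D) + M *m B *m (L *m D)); first exact: mulmxDl.
  by rewrite mulmxA ELD add0r -(mulmxA M) (mulmxA B L D) BLD.
pose M' := invmx L *m (invmx N *m (M *m invmx U)).
have M'D : M' *m D = D.
  by rewrite /M' -!mulmxA -NLD !mulKmx.
have rM' : (\rank M' <= k)%N.
  apply: leq_trans (mxrankM_maxr _ _) _; apply: leq_trans (mxrankM_maxr _ _) _.
  by apply: leq_trans (mxrankM_maxl _ _) rM.
have := rank_pid_kill kn rM' M'D eD.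
move=> /(congr1 (mulmx^~ U)); rewrite mul0mx => <-.
by rewrite /M' !mulmxA mulmxKV.
Qed.

(* Constant rank theorem at a point p1 of maximal rank k < n: in coordinates where
   the derivative at p1 is [pid_mx k], Theta has derivative the identity, and f is
   constant along the curve Theta (X s) = s e, e the k-th unit vector. *)
Lemma injective_det_jac (f : V -> V) p (r : R) : (0 < n)%N -> 0 < r ->
  (forall y, enorm (y - p) < r -> vhol f y) ->
  (forall x y, enorm (x - p) < r -> enorm (y - p) < r -> f x = f y -> x = y) ->
  exists2 y, enorm (y - p) < r & \det (jac f y) != 0.
Proof.
move=> n0 r0 hf inj; apply: contrapT => Hdet.
have det0 y : enorm (y - p) < r -> \det (jac f y) = 0.
  move=> yr; apply/eqP; apply/negPn/negP => d0; apply: Hdet; by exists y.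
pose P k := `[< exists2 y, enorm (y - p) < r & \rank (jac f y) = k >].
have exP : exists k, P k.
  by exists (\rank (jac f p)); apply/asboolP; exists p => //; rewrite subrr (rn0 rn_enorm).
have ubP k : P k -> (k <= n)%N by move=> /asboolP[y _ <-]; exact: rank_leq_row.
case: (ex_maxnP exP ubP) => k /asboolP[p1 p1r rk] kmax.
have rank_le y : enorm (y - p) < r -> (\rank (jac f y) <= k)%N.
  by move=> yr; apply: kmax; apply/asboolP; exists y.
have kn : (k < n)%N.
  rewrite -rk ltn_neqAle rank_leq_row andbT; apply/negP => full.
  have : jac f p1 \in unitmx by rewrite -row_free_unit.
  by rewrite unitmxE det0// unitr0.
set A := jac f p1 in rk.
pose L := col_ebase A; pose U := row_ebase A; pose D : 'M[C]_n := pid_mx k.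
have uL : L \in unitmx by exact: col_ebase_unit.
have uU : U \in unitmx by exact: row_ebase_unit.
have AE : A = L *m D *m U by rewrite /D -rk mulmx_ebase.
have DD : D *m D = D by rewrite pid_mx_id// ltnW.
pose s0 := r - enorm (p1 - p).
have s00 : 0 < s0 by rewrite subr_gt0.
have in0 y : enorm (y - p1) < s0 -> enorm (y - p) < r.
  by move=> h; have := rn_dist3 rn_enorm y p1 p; rewrite /s0 in h; lra.
pose B := invmx U *m D *m invmx L.
pose E := L *m (1%:M - D) *m invmx L.
have AB : A *m B + E = 1%:M.
  rewrite /B /E AE !mulmxA mulmxK// -[L *m D *m D]mulmxA DD -mulmxDl -mulmxDr.
  by rewrite addrC subrK mulmx1 mulmxV.
(* [Theta] keeps the components of f that are independent at [p1] and fills up with coordinates of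
   x; by [AB] its derivative at [p1] is the identity. *)
pose Theta x : V := (x - p1) *m E + (f x - f p1) *m B.
have [K K0 hK] := mulmx_bound B.
have e0 : 0 < (2 * K)^-1 by rewrite invr_gt0 mulr_gt0.
have hf1 y : enorm (y - p1) < s0 -> vhol f y by move=> /in0; exact: hf.
have [d1 d10 hd1] := strict_deriv s00 hf1 e0.
pose d := Num.min d1 s0.
have d0 : 0 < d by rewrite lt_min d10.
have ThetaB x y : Theta x - Theta y = (x - y) *m E + (f x - f y) *m B.
  have H (M : 'M[C]_n) (a b c : V) : (a - c) *m M - (b - c) *m M = (a - b) *m M.
    by rewrite -mulmxBl subr_cancel.
  by rewrite /Theta -(H E x y p1) -(H B (f x) (f y) (f p1)); exact: subr_addACA.
have half x y : enorm (x - p1) < d -> enorm (y - p1) < d ->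
    enorm (Theta x - Theta y - (x - y)) <= enorm (x - y) / 2.
  rewrite !lt_min => /andP[x1 _] /andP[y1 _].
  have -> : Theta x - Theta y - (x - y) = (f x - f y - (x - y) *m A) *m B.
    rewrite ThetaB (mulmxBl (f x - f y)) -(mulmxA (x - y)); apply: add_sub_eq.
    by rewrite -mulmxDr AB mulmx1.
  apply: le_trans (hK _) _; apply: le_trans (ler_wpM2l (ltW K0) (hd1 _ _ x1 y1)) _.
  by rewrite le_eqVlt; apply/orP; left; apply/eqP; field; rewrite gt_eqF.
have Theta0 : Theta p1 = 0 by rewrite /Theta (subrr p1) (subrr (f p1)) !mul0mx addr0.
pose j := Ordinal kn.
pose e : V := delta_mx ord0 j *m invmx L.
have eD : (delta_mx ord0 j : V) *m D = 0.
  by apply/rowP => i; rewrite -rowE !mxE /= ltnn andbF.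
pose s1 := d / (8 * (enorm e + 1)).
have e1 : 0 < 8 * (enorm e + 1) by have := enorm_ge0 e; lra.
have s10 : 0 < s1 by rewrite divr_gt0.
have /choice[X hX] : forall s : R, exists x, `|s| < s1 ->
    enorm (x - p1) < d /\ Theta x = (s%:C)%C *: e.
  move=> s; have [ss|] := ltP `|s| s1; last by exists p1.
  have [|x xd hx] := surj_near d0 half (q := (s%:C)%C *: e).
    rewrite Theta0 subr0 enormZ cmodR.
    apply: (@le_lt_trans _ _ (`|s| * (enorm e + 1))).
      by rewrite ler_wpM2l// lerDl.
    move: ss; rewrite /s1 !ltr_pdivlMr//; lra.
  by exists x => _.
have hX1 s : `|s| < s1 -> enorm (X s - p1) < d by move=> /hX[].
have hX2 s : `|s| < s1 -> Theta (X s) = (s%:C)%C *: e by move=> /hX[].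
have low x y : enorm (x - p1) < d -> enorm (y - p1) < d -> enorm (x - y) <= 2 * enorm (Theta x - Theta y).
  move=> xd yd; have := half x y xd yd.
  have := rn_dist rn_enorm (x - y) (Theta x - Theta y); rewrite (rn_distC rn_enorm (x - y)); lra.
have Xlip s t : `|s| < s1 -> `|t| < s1 -> enorm (X s - X t) <= 2 * enorm e * `|s - t|.
  move=> hs ht; have := low _ _ (hX1 _ hs) (hX1 _ ht).
  by rewrite !hX2// -scalerBl -rmorphB enormZ cmodR mulrA -mulrA [`|_| * _]mulrC mulrA.
have dzero t i : `|t| < s1 -> rderiv (fun s => f (X s) ord0 i) t 0.
  move=> ht; pose x := X t; have xd : enorm (x - p1) < d by exact: hX1.
  have xs0 : enorm (x - p1) < s0 by apply: lt_le_trans xd _; rewrite ge_min lexx orbT.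
  pose M := jac f x; pose N := E + M *m B.
  pose r1 := s0 - enorm (x - p1).
  have r10 : 0 < r1 by rewrite subr_gt0.
  have hfx y : enorm (y - x) < r1 -> vhol f y.
    move=> h; apply: hf1; have := rn_dist3 rn_enorm y x p1; rewrite /r1 in h; lra.
  (* A vector v with v N = 0 would move x without moving [Theta x] to first order, while [half]
     forces [Theta] to move by at least half the displacement. *)
  have uN : N \in unitmx.
    rewrite -row_free_unit; apply/row_freeP; apply: contrapT => notfree.
    have : kermx N != 0.
      by apply/eqP => /eqP; rewrite kermx_eq0 => /row_freeP.
    move=> /rowV0Pn[v /sub_kermxP vN v0].
    have vp : 0 < enorm v by rewrite enorm_gt0.
    pose ee := (4 * K)^-1.
    have ee0 : 0 < ee by rewrite invr_gt0 mulr_gt0.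
    have [d2 d20 hd2] := strict_deriv r10 hfx ee0.
    pose l := Num.min (d2 / (2 * enorm v)) ((d - enorm (x - p1)) / (2 * enorm v)).
    have l0 : 0 < l by rewrite lt_min !divr_gt0 ?mulr_gt0// subr_gt0.
    pose y := x + (l%:C)%C *: v.
    have yx : y - x = (l%:C)%C *: v by rewrite /y addrC addKr.
    have nyx : enorm (y - x) = l * enorm v by rewrite yx enormZ cmodR gtr0_norm.
    have l1 : enorm (y - x) < d2.
      rewrite nyx; apply: (@le_lt_trans _ _ (d2 / 2)); last by lra.
      have : l <= d2 / (2 * enorm v) by rewrite ge_min lexx.
      by rewrite ler_pdivlMr ?mulr_gt0//; lra.
    have l2 : enorm (y - p1) < d.
      have : l <= (d - enorm (x - p1)) / (2 * enorm v) by rewrite ge_min lexx orbT.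
      rewrite ler_pdivlMr ?mulr_gt0//; have := rn_dist3 rn_enorm y x p1; rewrite nyx; lra.
    have := half _ _ l2 xd; rewrite ThetaB.
    have yxN : (y - x) *m N = 0 by rewrite yx -scalemxAl vN scaler0.
    have -> : (y - x) *m E + (f y - f x) *m B - (y - x) =
        (f y - f x - (y - x) *m M) *m B - (y - x).
      have : (y - x) *m E = - ((y - x) *m M *m B).
        by apply/eqP; rewrite -addr_eq0 -mulmxA -mulmxDr yxN.
      by move=> ->; rewrite [- _ + _]addrC -mulmxBl.
    have h2 : enorm ((f y - f x - (y - x) *m M) *m B) <= enorm (y - x) / 4.
      apply: le_trans (hK _) _; apply: le_trans (ler_wpM2l (ltW K0) (hd2 _ _ l1 _)) _.
        by rewrite subrr (rn0 rn_enorm).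
      by rewrite le_eqVlt /ee; apply/orP; left; apply/eqP; field; rewrite gt_eqF.
    have := rn_dist rn_enorm (y - x) ((f y - f x - (y - x) *m M) *m B).
    rewrite (rn_distC rn_enorm (y - x)).
    have : 0 < enorm (y - x) by rewrite nyx mulr_gt0.
    lra.
  have eNM : e *m invmx N *m M = 0.
    exact: normal_form_kill (ltnW kn) uL uU uN (rank_le _ (in0 _ xs0)) eD.
  have [KN KN0 hKN] := mulmx_bound (invmx N *m M).
  have [KB KB0 hKB] := mulmx_bound (B *m (invmx N *m M)).
  pose c := 2 * enorm e + 1; have c0 : 0 < c by have := enorm_ge0 e; rewrite /c; lra.
  apply: rderivP => ee ee0.
  have KB1 : 0 < c * (KB + 1) by rewrite mulr_gt0//; lra.
  have ee1 : 0 < ee / (c * (KB + 1)) by rewrite divr_gt0.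
  have [d2 d20 hd2] := strict_deriv r10 hfx ee1.
  exists (Num.min (s1 - `|t|) (d2 / c)); first by rewrite lt_min subr_gt0 ht divr_gt0.
  move=> s; rewrite lt_min ltr_pdivlMr// => /andP[st1 st2].
  have hs : `|s| < s1 by have := rn_dist rn_abs s t; lra.
  have Xst : enorm (X s - x) <= c * `|s - t|.
    apply: le_trans (Xlip _ _ hs ht) _; rewrite ler_wpM2r// /c; lra.
  have X2 : enorm (X s - x) < d2 by apply: le_lt_trans Xst _; rewrite mulrC.
  have := hd2 (X s) x X2; rewrite subrr (rn0 rn_enorm) => /(_ d20).
  pose v := X s - x; pose w := f (X s) - f x; rewrite -/v -/w -/M => hw.
  (* The increment of [Theta] along the curve, split into its linear part at x and the remainder of
     f. Multiplication by N^-1 M kills the multiple of e and bounds [v *m M], hence [w], by the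
     remainder, which is o(|s - t|). *)
  have vN : v *m N + (w - v *m M) *m B = ((s - t)%:C)%C *: e.
    rewrite rmorphB scalerBl -(hX2 _ hs) -(hX2 _ ht) ThetaB -/v -/w.
    by rewrite [v *m N]mulmxDr (mulmxBl w) (mulmxA v M B); exact: addr_cancel.
  have vM : v *m M = - (((w - v *m M) *m (B *m (invmx N *m M)))).
    have : (v *m N + (w - v *m M) *m B) *m (invmx N *m M) = 0.
      by rewrite vN -scalemxAl mulmxA eNM scaler0.
    rewrite mulmxDl (mulmxA (v *m N)) (mulmxK uN) -(mulmxA (w - v *m M)).
    by move=> /eqP; rewrite addr_eq0 => /eqP.
  rewrite mulr0 subr0.
  have -> : f (X s) ord0 i - f (X t) ord0 i = w ord0 i by rewrite !mxE.
  apply: le_trans (cmod_coord _ _) _.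
  have h1 : enorm (v *m M) <= KB * enorm (w - v *m M) by rewrite {1}vM (rnN rn_enorm).
  have h2 := rn_dist rn_enorm w (v *m M).
  apply: (@le_trans _ _ ((KB + 1) * enorm (w - v *m M))); first by lra.
  apply: (@le_trans _ _ ((KB + 1) * (ee / (c * (KB + 1)) * (c * `|s - t|)))).
    rewrite ler_wpM2l//; first by lra.
    by apply: le_trans hw _; rewrite ler_wpM2l// ltW.
  rewrite le_eqVlt; apply/orP; left; apply/eqP; field.
  by rewrite !gt_eqF//; lra.
pose s2 := s1 / 2; have [s20 s21] : 0 < s2 /\ s2 < s1 by rewrite /s2; lra.
have fX : f (X 0) = f (X s2).
  apply/rowP => i; apply: (@rderiv0_eq R (fun s => f (X s) ord0 i)) => t ht.
  by apply: dzero; case: ht => /andP[t1 t2]; rewrite ltr_norml; apply/andP; split; lra.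
have h0 : `|0 : R| < s1 by rewrite normr0.
have h2 : `|s2| < s1 by rewrite gtr0_norm.
have inr s : `|s| < s1 -> enorm (X s - p) < r.
  by move=> /hX1 h; apply: in0; apply: lt_le_trans h _; rewrite ge_min lexx orbT.
have XX := inj _ _ (inr _ h0) (inr _ h2) fX.
have := hX2 _ h2; rewrite -XX (hX2 _ h0) => /eqP.
rewrite scale0r eq_sym scaler_eq0 => /orP[/eqP /(congr1 (@cmod R))|/eqP ee0].
  by rewrite cmodR cmod0 => /eqP; rewrite normr_eq0 => /eqP; lra.
have : (delta_mx ord0 j : V) = 0 by rewrite -[LHS](mulmxKV uL) -/e ee0 mul0mx.
move=> /(congr1 (fun v : V => v ord0 j)); rewrite !mxE !eqxx => /eqP.
by rewrite oner_eq0.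
Qed.

End InjectiveRank.

(** * The open mapping theorem for injective holomorphic maps *)

Section OpenMapping.
Context {R : realType} {n : nat}.
Local Notation C := R[i].
Local Notation V := 'rV[C]_n.
Local Notation vcont := (contat (@enorm R n) (@cmod R)).

Lemma ball_tube (c p q y : V) (m d t : R) : enorm (p - c) + d <= m -> enorm (q - c) + d <= m ->
  0 <= t <= 1 -> enorm (y - (p + (t%:C)%C *: (q - p))) < d -> enorm (y - c) < m.
Proof.
move=> pm qm /andP[t0 t1] yd; set x := p + _ in yd.
have xE : x - c = ((1 - t)%:C)%C *: (p - c) + (t%:C)%C *: (q - c).
  apply/rowP => j; rewrite /x !mxE rmorphB rmorph1; ring.
have : enorm (x - c) <= (1 - t) * enorm (p - c) + t * enorm (q - c).
  rewrite xE; apply: le_trans (rnD rn_enorm _ _) _.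
  by rewrite !enormZ !cmodR !ger0_norm// subr_ge0.
have := rn_dist3 rn_enorm y x c; nra.
Qed.

(** On the complex line through p and q, the discs of radius d / |q - p| about the points k / (N +
    1) lie in the tube. The step is shorter than the radius, so [disc_identity] carries the zeros
    from each centre to the next. *)
Lemma tube_identity (f : V -> C) p q (d d0 : R) : 0 < d -> 0 < d0 ->
  (forall t y, 0 <= t <= 1 -> enorm (y - (p + (t%:C)%C *: (q - p))) < d ->
     vcont f y /\ (f y != 0 -> hol f y)) ->
  (forall y, enorm (y - p) < d0 -> f y = 0) -> f q = 0.
Proof.
move=> dp d0p hf fp.
have [->|qp] := eqVneq q p; first by rewrite fp// subrr (rn0 rn_enorm).
pose D := enorm (q - p); have D0 : 0 < D by rewrite enorm_gt0 subr_eq0.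
pose phi (l : C) := f (p + l *: (q - p)).
pose r := d / D; have r0 : 0 < r by rewrite divr_gt0.
have tube (t : R) l : 0 <= t <= 1 -> cmod (l - (t%:C)%C) < r ->
    vcont f (p + l *: (q - p)) /\ (f (p + l *: (q - p)) != 0 -> hol f (p + l *: (q - p))).
  move=> t01 lr; apply: hf t01 _.
  by rewrite opprD addrACA subrr add0r -scalerBl enormZ -ltr_pdivlMr.
have cphi t l : 0 <= t <= 1 -> cmod (l - (t%:C)%C) < r -> ccont phi l.
  move=> t01 lr; have [h _] := tube t l t01 lr.
  apply: (@contat_comp _ _ _ _ _ (@enorm R n) _ (fun l => p + l *: (q - p)) f) => // e e0.
  exists (e / D); first by rewrite divr_gt0.
  by move=> y; rewrite opprD addrACA subrr add0r -scalerBl enormZ -ltr_pdivlMr.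
have dphi t l : 0 <= t <= 1 -> cmod (l - (t%:C)%C) < r -> phi l != 0 -> exists d, cderiv phi l d.
  by move=> t01 lr; have [_ h] := tube t l t01 lr => /h /hol_line.
have [N hN] : exists N : nat, 1 / r < N.+1%:R.
  exists (Num.bound (1 / r)); have h : 0 <= 1 / r by rewrite divr_ge0// ltW.
  by apply: lt_trans (archi_boundP h) _; rewrite ltr_nat.
have N0 : 0 < N.+1%:R :> R by [].
have key k : (k <= N.+1)%N -> exists2 s : R, 0 < s &
    forall l, cmod (l - ((k%:R / N.+1%:R)%:C)%C) < s -> phi l = 0.
  elim: k => [_|k IH kN].
    exists (d0 / D); first by rewrite divr_gt0.
    move=> l; rewrite mul0r subr0 => hl; apply: fp.
    by rewrite addrC addKr enormZ -ltr_pdivlMr.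
  have [s s0 hs] := IH (ltnW kN).
  have k01 : 0 <= (k%:R / N.+1%:R : R) <= 1.
    by rewrite divr_ge0//= ler_pdivrMr// mul1r ler_nat ltnW.
  have z := disc_identity s0 (fun l => cphi _ l k01) (fun l => dphi _ l k01) hs.
  have gap : 0 < r - 1 / N.+1%:R.
    by rewrite subr_gt0 ltr_pdivrMr// mulrC -ltr_pdivrMr.
  exists (r - 1 / N.+1%:R) => // l hl; apply: z.
  have := rn_dist3 rn_cmod l ((k.+1%:R / N.+1%:R)%:C)%C ((k%:R / N.+1%:R)%:C)%C.
  have dk : k.+1%:R / N.+1%:R - k%:R / N.+1%:R = 1 / N.+1%:R :> R.
    by rewrite -mulrBl -[k.+1%:R]natr1 addrAC subrr add0r.
  rewrite -rmorphB cmodR dk ger0_norm ?divr_ge0//.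
  by move=> h2; apply: le_lt_trans h2 _; rewrite -ltrBrDr.
have [s s0 hs] := key N.+1 (leqnn _).
have := hs 1; rewrite divff ?gt_eqF// subrr cmod0 => /(_ s0).
by rewrite /phi scale1r addrC subrK.
Qed.

(** From mere continuity of [G], strict differentiability of f first gives |G y - G q| <= 2 K |y -
    q|; then the linear part of [G] is read off from y - q = f(G y) - f(G q). *)
Lemma comp_inverse_hol (f G : V -> V) (h : V -> C) q (r e1 : R) : 0 < r -> 0 < e1 ->
  (forall y, enorm (y - G q) < r -> vhol f y) ->
  contat (@enorm R n) (@enorm R n) G q ->
  (forall y, enorm (y - q) < e1 -> f (G y) = y) ->
  jac f (G q) \in unitmx -> hol h (G q) -> hol (fun y => h (G y)) q.
Proof.
move=> r0 e10 hf cG fG uJ [Dh [_ _ hDh]].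
set J := jac f (G q) in uJ.
have [K K0 hK] := mulmx_bound (invmx J).
have [K1 K10 hK1] : exists2 K1 : R, 0 < K1 & forall v : V, cmod ((v *m Dh) ord0 ord0) <= K1 * enorm v.
  have n0 : 0 <= n%:R :> R by [].
  have S0 : 0 <= \sum_j cmod (Dh j ord0) by apply: sumr_ge0 => i _; exact: cmod_ge0.
  exists (n%:R * \sum_j cmod (Dh j ord0) + 1) => [|u]; first by rewrite ltr_wpDl// mulr_ge0.
  have := enorm_ge0 u; suff : cmod ((u *m Dh) ord0 ord0) <= n%:R * (\sum_j cmod (Dh j ord0)) * enorm u by lra.
  apply: mul_col_le => j.
  by rewrite (bigD1 j)//= lerDl sumr_ge0// => i _; exact: cmod_ge0.
exists (invmx J *m Dh); apply: hderivP => e e0.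
pose e2 := Num.min (2 * K)^-1 (e / (4 * K ^+ 2 * K1)).
have e20 : 0 < e2.
  rewrite lt_min; apply/andP; split; first by rewrite invr_gt0 mulr_gt0.
  by rewrite divr_gt0// !mulr_gt0// exprn_gt0.
have e30 : 0 < e / (4 * K) by rewrite divr_gt0// mulr_gt0.
have [d2 d20 hd2] := strict_deriv r0 hf e20.
have [d3 d30 hd3] := hDh _ e30.
have d23 : 0 < Num.min d2 d3 by rewrite lt_min d20.
have [d4 d40 hd4] := cG _ d23.
exists (Num.min d4 e1); first by rewrite lt_min d40.
move=> y; rewrite lt_min => /andP[/hd4 y1 /fG fy].
move: y1; rewrite lt_min => /andP[y2 y3].
have fq : f (G q) = q by apply: fG; rewrite subrr (rn0 rn_enorm).
have := hd2 _ (G q) y2; rewrite subrr (rn0 rn_enorm) fy fq => /(_ d20).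
set w := G y - G q in y2 y3 *; rewrite -/J => h1.
have wE : w = (y - q) *m invmx J - (y - q - w *m J) *m invmx J.
  by rewrite -mulmxBl opprB addrC subrK mulmxK.
have h2 : enorm ((y - q - w *m J) *m invmx J) <= K * (e2 * enorm w).
  by apply: le_trans (hK _) _; rewrite ler_wpM2l// ltW.
have w0 := enorm_ge0 w.
have h3 : K * (e2 * enorm w) <= enorm w / 2.
  have -> : enorm w / 2 = K * ((2 * K)^-1 * enorm w) by field; rewrite gt_eqF.
  by rewrite ler_wpM2l ?(ltW K0)// ler_wpM2r// ge_min lexx.
have h4 : enorm w <= 2 * K * enorm (y - q).
  have : enorm w <= enorm ((y - q) *m invmx J) + enorm ((y - q - w *m J) *m invmx J).
    by rewrite {1}wE; apply: le_trans (rnD rn_enorm _ _) _; rewrite (rnN rn_enorm).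
  by have := hK (y - q); lra.
have h5 : cmod (((y - q - w *m J) *m invmx J *m Dh) ord0 ord0) <= e / 2 * enorm (y - q).
  apply: le_trans (hK1 _) _.
  apply: (@le_trans _ _ (K1 * (K * (e2 * (2 * K * enorm (y - q)))))).
    rewrite ler_wpM2l ?(ltW K10)//; apply: le_trans h2 _.
    by rewrite ler_wpM2l ?(ltW K0)// ler_wpM2l// ltW.
  have : e2 <= e / (4 * K ^+ 2 * K1) by rewrite ge_min lexx orbT.
  rewrite ler_pdivlMr ?mulr_gt0 ?exprn_gt0// => h6.
  have -> : K1 * (K * (e2 * (2 * K * enorm (y - q)))) = e2 * (4 * K ^+ 2 * K1) / 2 * enorm (y - q) by field.
  by rewrite ler_wpM2r ?enorm_ge0//; lra.
have h6 := hd3 _ y3; rewrite -/w in h6.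
have -> : h (G y) - h (G q) - ((y - q) *m (invmx J *m Dh)) ord0 ord0 =
   (h (G y) - h (G q) - (w *m Dh) ord0 ord0) -
     ((y - q - w *m J) *m invmx J *m Dh) ord0 ord0.
  have E : (w *m Dh) ord0 ord0 = ((y - q) *m (invmx J *m Dh)) ord0 ord0 -
      ((y - q - w *m J) *m invmx J *m Dh) ord0 ord0.
    by rewrite {1}wE mulmxBl mulmxA [LHS]mxE; congr (_ + _); rewrite mxE.
  by rewrite E; ring.
apply: le_trans (rnD rn_cmod _ _) _; rewrite (rnN rn_cmod).
have : e / (4 * K) * enorm w <= e / 2 * enorm (y - q).
  apply: le_trans (ler_wpM2l (ltW e30) h4) _.
  by rewrite le_eqVlt; apply/orP; left; apply/eqP; field; rewrite gt_eqF.
lra.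
Qed.

(** On the compact set of points of K at distance at least s from w, |f y - f w| has a positive
    minimum by injectivity. *)
Lemma inverse_cont (K : set V) (f : V -> V) w : seqcompact (@enorm R n) K -> K w ->
  (forall y, K y -> contat (@enorm R n) (@enorm R n) f y) ->
  (forall x y, K x -> K y -> f x = f y -> x = y) ->
  forall s : R, 0 < s -> exists2 e : R, 0 < e & forall y, K y -> enorm (f y - f w) < e -> enorm (y - w) < s.
Proof.
move=> cK Kw cf inj s s0; pose K' := [set y | K y /\ s <= enorm (y - w)].
have [K'0|K'0] := pselect (K' !=set0); last first.
  exists 1 => // y Ky _; rewrite ltNge; apply/negP => h; apply: K'0; by exists y.
have cK' : seqcompact (@enorm R n) K'.
  move=> u uK'; have [z Kz hz] := cK u (fun k => (uK' k).1).
  exists z => //; split => //; apply/ler_addgt0Pr => e e0.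
  have [k _ hk] := hz e 0%N e0; have := (uK' k).2.
  have := rn_dist3 rn_enorm (u k) z w; lra.
have [|z [Kz zs] zmin] := @seqcompact_min R _ _ _ (fun y => enorm (f y - f w)) cK' K'0.
  move=> z [Kz _]; apply: (contat_norm (f := fun y => f y - f w) rn_enorm).
  by apply: (contat_add rn_enorm); [exact: cf|exact: contat_cst rn_enorm _ _].
exists (enorm (f z - f w)).
  rewrite enorm_gt0 subr_eq0; apply/negP => /eqP /(inj _ _ Kz Kw) zw.
  by move: zs; rewrite zw subrr (rn0 rn_enorm); lra.
move=> y Ky hy; rewrite ltNge; apply/negP => h.
by have := zmin y (conj Ky h); rewrite leNgt hy.
Qed.

(* With K a closed ball and g the inverse of f on f(K), the function equal to
   det f' o g on f(K) and to 0 elsewhere is continuous near f(w1), holomorphic where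
   it is not 0, and not identically 0; hence it vanishes on no open set. *)
Theorem injective_open (f : V -> V) w1 (r : R) : (0 < n)%N -> 0 < r ->
  (forall y, enorm (y - w1) < r -> vhol f y) ->
  (forall x y, enorm (x - w1) < r -> enorm (y - w1) < r -> f x = f y -> x = y) ->
  forall d : R, 0 < d -> exists2 eta : R, 0 < eta & forall q, enorm (q - f w1) < eta ->
    exists2 w, enorm (w - w1) < d & f w = q.
Proof.
move=> n0 r0 hf inj d d0.
pose s := Num.min d r / 2.
have [s0 sd sr] : [/\ 0 < s, s < d & s < r].
  have m0 : 0 < Num.min d r by rewrite lt_min d0.
  have : Num.min d r <= d /\ Num.min d r <= r by rewrite !ge_min !lexx orbT.
  by rewrite /s; split; lra.
pose K := [set y : V | enorm (y - w1) <= s].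
have cK : seqcompact (@enorm R n) K by exact: seqcompact_eball.
have Kr y : K y -> enorm (y - w1) < r by move=> /= h; exact: le_lt_trans h sr.
have cf y : K y -> contat (@enorm R n) (@enorm R n) f y by move=> /Kr /hf /vhol_cont.
have Kinj x y : K x -> K y -> f x = f y -> x = y by move=> /Kr hx /Kr hy; exact: inj.
have Kw1 : K w1 by rewrite /K /= subrr (rn0 rn_enorm) ltW.
(* Values within m of f(w1) are taken on K only at distance less than s from w1, so never on the
   boundary of K. *)
have [m m0 hm] := inverse_cont cK Kw1 cf Kinj s0.
pose im q := exists2 w, K w & f w = q.
pose g q := xget w1 [set w | K w /\ f w = q].
have gP q : im q -> K (g q) /\ f (g q) = q.
  by move=> [w Kw fw]; have := @xgetI _ w1 [set w | K w /\ f w = q] w (conj Kw fw).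
have gf w : K w -> g (f w) = w.
  by move=> Kw; have [k1 k2] := gP (f w) (ex_intro2 _ _ w Kw erefl); exact: Kinj.
have gin q : im q -> enorm (q - f w1) < m -> enorm (g q - w1) < s.
  by move=> /gP[k1 k2] h; apply: hm => //; rewrite k2.
suff H q : enorm (q - f w1) < m -> im q.
  by exists m => // q /H[w Kw fw]; exists w => //; exact: le_lt_trans sd.
apply: contraPP => nim qm.
pose phi q := if `[< im q >] then \det (jac f (g q)) else 0.
have phif w : K w -> phi (f w) = \det (jac f w).
  move=> Kw; rewrite /phi; case: asboolP => [_|]; first by rewrite gf.
  by case; exists w.
have out q' : ~ im q' -> exists2 e : R, 0 < e & forall y, enorm (y - q') < e -> phi y = 0.
  move=> nq.
  have [|z Kz zmin] := @seqcompact_min R _ _ _ (fun y => enorm (f y - q')) cK (ex_intro _ w1 Kw1).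
    move=> z Kz; apply: (contat_norm (f := fun y => f y - q') rn_enorm).
    by apply: (contat_add rn_enorm); [exact: cf|exact: contat_cst rn_enorm _ _].
  exists (enorm (f z - q')).
    rewrite enorm_gt0 subr_eq0; apply/negP => /eqP fz; apply: nq; by exists z.
  move=> y hy; rewrite /phi; case: asboolP => // -[w Kw fw].
  by have := zmin w Kw; rewrite fw leNgt hy.
have dethol w : K w -> hol (fun y => \det (jac f y)) w.
  move=> /Kr wr; apply: (@det_jac_hol R n f w (r - enorm (w - w1))); first by rewrite subr_gt0.
  move=> y hy; apply: hf; have := rn_dist3 rn_enorm y w w1; lra.
have phihol q' : enorm (q' - f w1) < m -> phi q' != 0 -> hol phi q'.
  move=> q'm; rewrite {1}/phi; case: asboolP => [iq d1|]; last by rewrite eqxx.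
  have [Kw fw] := gP _ iq; have ws := gin _ iq q'm; set w := g q' in Kw fw ws d1.
  pose r1 := s - enorm (w - w1); have r10 : 0 < r1 by rewrite subr_gt0.
  have inK y : enorm (y - w) < r1 -> K y.
    by move=> h; have := rn_dist3 rn_enorm y w w1; rewrite /K /= /r1 in h *; lra.
  have hf1 y : enorm (y - w) < r1 -> vhol f y by move=> /inK /Kr /hf.
  have uJ : jac f w \in unitmx by rewrite unitmxE unitfE.
  have [dl dl0 [_ _ [_ loc]]] := local_inverse r10 hf1 uJ.
  have cont_g (e : R) : 0 < e -> exists2 eta : R, 0 < eta & forall y, enorm (y - q') < eta ->
      im y /\ enorm (g y - w) < e.
    move=> e0; pose e1 := Num.min e (Num.min r1 dl).
    have e10 : 0 < e1 by rewrite !lt_min e0 r10.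
    have e1dl : e1 <= dl by rewrite !ge_min lexx !orbT.
    have [eta eta0 heta] := loc e1 e10 e1dl.
    exists eta => // y hy; have [|x] := heta y; first by rewrite fw.
    rewrite !lt_min => /and3P[x1 /inK x2 _] fx; split; first by exists x.
    by rewrite -fx gf.
  have [eta eta0 heta] := cont_g _ r10.
  apply: (@hol_ext R n (fun y => \det (jac f (g y))) phi q' eta eta0).
    by move=> y /heta[iy _]; rewrite /phi; case: asboolP.
  apply: (@comp_inverse_hol f g (fun y => \det (jac f y)) q' r1 eta r10 eta0) => //.
  - by move=> e e0; have [et et0 het] := cont_g _ e0; exists et => // y /het[].
  - by move=> y /heta[/gP[]].
  - exact: dethol.
(* Continuity at a zero of [phi] has two cases: a value outside the closed set f(K) has a
   neighbourhood of such values; at a critical value the determinant at the preimage is 0, and the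
   preimages of nearby values converge to it by [inverse_cont]. *)
have phicont q' : enorm (q' - f w1) < m -> vcont phi q'.
  move=> q'm; have [p0|p0] := eqVneq (phi q') 0; last by apply: hol_cont; exact: phihol.
  have [iq|niq] := pselect (im q'); last first.
    have [e e0 he] := out _ niq.
    by apply: (contat_ext rn_enorm e0 _ (contat_cst rn_cmod (0 : C) q')) => y /he.
  have [Kw fw] := gP _ iq; move=> e e0.
  have [d1 d10 h1] := hol_cont (dethol _ Kw) e0.
  have [e2 e20 h2] := inverse_cont cK Kw cf Kinj d10.
  exists e2 => // y hy; rewrite p0 subr0 /phi; case: asboolP => [/gP[Ky fy]|]; last by rewrite cmod0.
  have dw : \det (jac f (g q')) = 0 by move: p0; rewrite /phi; case: asboolP.
  by have := h1 (g y); rewrite dw subr0; apply; apply: h2 => //; rewrite fy fw.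
have [d1 d10 hd1] := cf _ Kw1 _ m0.
pose r2 := Num.min d1 s; have r20 : 0 < r2 by rewrite lt_min d10.
have r2r y : enorm (y - w1) < r2 -> K y.
  by rewrite lt_min => /andP[_ /ltW].
have [||w2 w2r det2] := @injective_det_jac R n f w1 r2 n0 r20.
- by move=> y /r2r /Kr /hf.
- by move=> x y /r2r hx /r2r hy; exact: Kinj.
have Kw2 := r2r _ w2r.
have q1m : enorm (f w2 - f w1) < m by apply: hd1; move: w2r; rewrite lt_min => /andP[].
have [e e0 he] := out _ nim.
pose dl := Num.min (m - enorm (q - f w1)) (m - enorm (f w2 - f w1)).
have dl0 : 0 < dl by rewrite lt_min !subr_gt0 qm.
have [dl1 dl2] : dl <= m - enorm (q - f w1) /\ dl <= m - enorm (f w2 - f w1).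
  by rewrite !ge_min !lexx orbT.
(* [phi] vanishes near the omitted value q, so by the identity principle in the ball of radius m it
   vanishes at f(w2), where the Jacobian determinant is not 0. *)
have : phi (f w2) = 0.
  apply: (tube_identity (p := q) dl0 e0 _ he) => t y t01 hy.
  have ym : enorm (y - f w1) < m.
    by apply: ball_tube t01 hy; lra.
  by split; [exact: phicont|exact: phihol].
by move=> p0; move: det2; rewrite -phif// p0 eqxx.
Qed.

End OpenMapping.

(** * The slit ball *)

Section Bridge.
Context {R : realType}.
Local Notation C := R[i].

Lemma normC_cmod (z : C) : `|z| = ((cmod z)%:C)%C.
Proof. by case: z. Qed.

Lemma mxnorm_le_enorm n (x : 'rV[C]_n) : `|x| <= ((enorm x)%:C)%C.
Proof.
have [x0|/mx_norm_neq0[[i j] /= xE]] := eqVneq (mx_norm x) 0.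
  by rewrite /Num.norm /= x0 lecR enorm_ge0.
by rewrite /Num.norm /= xE normC_cmod lecR (ord1 i) cmod_coord.
Qed.

Lemma posC (e : C) : 0 < e -> 0 < complex.Re e /\ e = ((complex.Re e)%:C)%C.
Proof. by case: e => a b; rewrite ltcE /= => /andP[/eqP -> ?]. Qed.

Lemma nbhs_enormP n (z : 'rV[C]_n) (A : set 'rV[C]_n) :
  nbhs z A <-> exists2 e : R, 0 < e & forall y, enorm (y - z) < e -> A y.
Proof.
split.
  move=> /nbhs_ballP[e /= /posC[e0 eE] h]; exists (complex.Re e) => // y hy.
  apply: h; rewrite mx_norm_ball /ball_ /= eE.
  apply: le_lt_trans (mxnorm_le_enorm _) _.
  by rewrite ltcR (rn_distC rn_enorm).
move=> [e e0 h]; apply/nbhs_ballP.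
have n0 : 0 < n%:R + 1 :> R by rewrite ltr_wpDl.
have d0 : 0 < e / (n%:R + 1) by rewrite divr_gt0.
exists (((e / (n%:R + 1))%:C)%C); first by rewrite /= ltcR.
move=> y [_ hy]; apply: h; apply: le_lt_trans (enorm_le_sum _) _.
apply: (@le_lt_trans _ _ (\sum_(j < n) e / (n%:R + 1))).
  apply: ler_sum => j _; rewrite !mxE; have := hy ord0 j.
  by rewrite /ball /= normC_cmod ltcR (rn_distC rn_cmod) => /ltW.
rewrite sumr_const card_ord -(mulr_natl (e / (n%:R + 1)) n) mulrCA gtr_pMr//.
by rewrite ltr_pdivrMr//; lra.
Qed.

Lemma differentiable_hol n (f : 'rV[C]_n -> C) z : differentiable f z -> hol f z.
Proof.
move=> df; pose d : 'cV[C]_n := \col_j 'd f z (delta_mx ord0 j).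
have dE h : 'd f z h = (h *m d) ord0 ord0.
  rewrite {1}[h]row_sum_delta linear_sum mxE; apply: eq_bigr => j _.
  by rewrite linearZ /= mxE.
exists d; apply: hderivP => e e0.
have /eqaddoP /(_ ((e%:C)%C)) := diff_locally df.
rewrite ltcR => /(_ e0) /nbhs_enormP[del del0 hdel].
exists del => // y yz.
have := hdel (y - z); rewrite subr0 => /(_ yz) /=.
have E : (f \o shift z - (cst (f z) + 'd f z)) (y - z) = f y - f z - ((y - z) *m d) ord0 ord0.
  change (f (y - z + z) - (f z + 'd f z (y - z)) = f y - f z - ((y - z) *m d) ord0 ord0).
  by rewrite (@GRing.subrK _ z y) opprD addrA dE.
move=> h; rewrite E normC_cmod in h.
have : ((cmod (f y - f z - ((y - z) *m d) ord0 ord0))%:C)%C <= (((e * enorm (y - z)))%:C)%C.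
  apply: le_trans h _; rewrite rmorphM; apply: ler_wpM2l.
    by rewrite ler0c ltW.
  exact: mxnorm_le_enorm.
by rewrite lecR.
Qed.

Lemma differentiable_vhol n (f : 'rV[C]_n -> 'rV[C]_n) z : differentiable f z -> vhol f z.
Proof.
move=> df i; apply: differentiable_hol.
have h := differentiable_comp df (differentiable_coord (f z) ord0 i).
exact: h.
Qed.

Lemma enorm_ball_frontier n (r : R) (z : 'rV[C]_n) : 0 < r ->
  frontier (eball (0 : 'rV[C]_n) r) z <-> enorm z = r.
Proof.
move=> r0; rewrite /frontier /eball; split.
  move=> [cl ni]; apply/eqP; rewrite eq_le; apply/andP; split.
    apply/ler_addgt0Pr => e e0.
    have [|y [/= yr yz]] := cl [set y | enorm (y - z) < e].
      by apply/nbhs_enormP; exists e.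
    rewrite subr0 in yr; have := rn_dist rn_enorm z y; rewrite (rn_distC rn_enorm z); lra.
  rewrite leNgt; apply/negP => zr; apply: ni; apply/nbhs_enormP.
  exists (r - enorm z); first by rewrite subr_gt0.
  by move=> y /= yz; rewrite subr0; have := rn_dist rn_enorm y z; lra.
move=> zr; split.
  move=> B /nbhs_enormP[e e0 hB].
  pose t := Num.min (1 / 2) (e / (2 * r)).
  have t0 : 0 < t by rewrite lt_min !divr_gt0// mulr_gt0.
  have t1 : t <= 1 / 2 by rewrite ge_min lexx.
  have t2 : t * r <= e / 2.
    apply: (@le_trans _ _ (e / (2 * r) * r)); first by rewrite ler_wpM2r ?(ltW r0)// ge_min lexx orbT.
    by rewrite le_eqVlt; apply/orP; left; apply/eqP; field; rewrite gt_eqF.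
  exists (((1 - t)%:C)%C *: z); split => /=.
    by rewrite subr0 enormZ cmodR zr ger0_norm; nra.
  apply: hB; have -> : ((1 - t)%:C)%C *: z - z = - ((t%:C)%C *: z).
    by rewrite rmorphB rmorph1 scalerBl scale1r addrAC subrr add0r.
  by rewrite (rnN rn_enorm) enormZ cmodR zr gtr0_norm//; lra.
move=> /nbhs_singleton /=; by rewrite subr0 zr ltxx.
Qed.

Lemma hdot_last n (z : 'rV[C]_n.+1) (r : R) :
  hdot z (\row_(j < n.+1) (if j.+1 == n.+1 then Complex r 0 else 0)) = (r%:C)%C * z ord0 ord_max.
Proof.
rewrite /hdot (bigD1 ord_max)//= big1 ?addr0.
  by rewrite mxE eqxx /= [in LHS]mulrC; congr (_ * _); rewrite /= oppr0.
move=> j jn; rewrite mxE ifF ?rmorph0 ?mulr0//.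
by apply: contraNF jn; rewrite eqSS.
Qed.

Lemma Re_mulR (t : R) (z : C) : complex.Re ((t%:C)%C * z) = t * complex.Re z.
Proof. by case: z => a b /=; rewrite mul0r subr0. Qed.

Lemma enormN n (x : 'rV[C]_n) : enorm (- x) = enorm x.
Proof. exact: rnN rn_enorm _. Qed.

Definition slit_ball n (r c : R) : set 'rV[C]_n.+1 :=
  [set z | enorm z < 1 /\ ~ (enorm z = r /\ complex.Re (z ord0 ord_max) <= c)].

(** On the sphere |z| = r one has |z - Q|^2 = 2 r^2 - 2 r Re z_n, so |z - Q| < eps means Re z_n >
    c. *)
Lemma slit_ballE n (r eps : R) : 0 < r -> 0 < eps ->
  let Q : 'rV[C]_n.+1 := \row_(j < n.+1) (if j.+1 == n.+1 then Complex r 0 else 0) in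
  eball 0 1 `\` (frontier (eball 0 r) `\` eball Q eps) = slit_ball r (r - eps ^+ 2 / (2 * r)).
Proof.
move=> r0 eps0 Q; set c := r - _.
have Qr : enorm Q = r.
  apply/eqP; rewrite -(@eqrXn2 _ 2)// ?enorm_ge0 ?(ltW r0)//; apply/eqP.
  have : complex.Re (hdot Q Q) = r ^+ 2.
    by rewrite hdot_last Re_mulR mxE eqxx expr2.
  by rewrite hdotzz.
have cE : 2 * r * c = 2 * r ^+ 2 - eps ^+ 2 by rewrite /c; field; rewrite gt_eqF.
have inQ (z : 'rV[C]_n.+1) : enorm z = r -> eball Q eps z <-> c < complex.Re (z ord0 ord_max).
  move=> zr; have E := enormD_sqr z (- Q).
  have EQ : complex.Re (hdot z (- Q)) = - (r * complex.Re (z ord0 ord_max)).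
    rewrite hdotC hdotNl; have -> : hdot Q z = (hdot z Q)^*%C by rewrite hdotC.
    rewrite hdot_last -Re_mulR; case: (_ * _) => a b /=.
    by [].
  rewrite EQ enormN Qr zr in E; rewrite /eball /=.
  have ge := enorm_ge0 (z - Q).
  split=> h.
    rewrite -(ltr_pM2l (x := 2 * r)) ?mulr_gt0// cE.
    have : enorm (z - Q) ^+ 2 < eps ^+ 2 by rewrite ltr_pXn2r// nnegrE ltW.
    rewrite E; lra.
  rewrite -(@ltr_pXn2r _ 2)// ?nnegrE ?(ltW eps0)// E.
  rewrite -(ltr_pM2l (x := 2 * r)) ?mulr_gt0// cE in h; lra.
apply/seteqP; split => z.
  move=> [z1 h]; split; first by move: z1; rewrite /eball /= subr0.
  move=> [zr zc]; apply: h; split; first exact/enorm_ball_frontier.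
  by move=> /(inQ _ zr); rewrite ltNge zc.
move=> [z1 h]; split; first by rewrite /eball /= subr0.
move=> [/enorm_ball_frontier-/(_ r0) zr nQ]; apply: h; split => //.
by rewrite leNgt; apply/negP => /(inQ _ zr).
Qed.

Lemma Re_sub_le n (y z : 'rV[C]_n.+1) j :
  `|complex.Re (y ord0 j) - complex.Re (z ord0 j)| <= enorm (y - z).
Proof.
have := Re_le_cmod ((y - z) ord0 j); have := cmod_coord (y - z) j.
rewrite !mxE raddfB /= => h1 h2; exact: le_trans h2 h1.
Qed.

Lemma slit_ball_open n (r c : R) z : @slit_ball n r c z ->
  exists2 e : R, 0 < e & forall y, enorm (y - z) < e -> slit_ball r c y.
Proof.
move=> [z1 h]; have [zr|zr] := eqVneq (enorm z) r.
  have zc : c < complex.Re (z ord0 ord_max) by rewrite ltNge; apply/negP => zc; apply: h.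
  exists (Num.min (1 - enorm z) (complex.Re (z ord0 ord_max) - c)).
    by rewrite lt_min !subr_gt0 z1.
  move=> y; rewrite lt_min => /andP[y1 y2]; split.
    by have := rn_dist rn_enorm y z; lra.
  move=> [_ yc]; have := Re_sub_le y z ord_max; rewrite ler_norml => /andP[]; lra.
exists (Num.min (1 - enorm z) `|enorm z - r|).
  by rewrite lt_min subr_gt0 z1 normr_gt0 subr_eq0.
move=> y; rewrite lt_min => /andP[y1 y2]; split.
  by have := rn_dist rn_enorm y z; lra.
move=> [yr _]; have := rn_dist_abs rn_enorm z y; rewrite yr (rn_distC rn_enorm z).
by rewrite leNgt y2.
Qed.

End Bridge.

(** * Hartogs extension across the rim *)

Section Rim.
Context {R : realType} {n : nat}.
Local Notation C := R[i].
Local Notation V := 'rV[C]_n.+1.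
Variables (r c : R) (a e : V).
Hypotheses (r0 : 0 < r) (r1 : r < 1) (rc : - r < c) (cr : c < r).
Hypotheses (ar : enorm a = r) (er : enorm e = r) (ea : hdot e a = 0).
Hypothesis ac : complex.Re (a ord0 ord_max) = c.
Local Notation D := (@slit_ball R n r c).

(** On the circle of radius [rho] the norm is at least r + r rho^2 / 4, and [delta] allows the
    centre to move by 2 delta = r rho^2 / 8. The factor 1/4 keeps discs of radius 3 rho in the unit
    ball: the mean value property on a circle asks for a disc of more than twice its radius. *)
Definition disc_radius : R := (1 - r) / 4.
Definition rim_radius : R := r * disc_radius ^+ 2 / 16.
Local Notation rho := disc_radius.
Local Notation delta := rim_radius.

Lemma disc_radius_gt0 : 0 < rho.
Proof. by rewrite /rho divr_gt0// subr_gt0. Qed.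

Lemma rim_radius_gt0 : 0 < delta.
Proof. by rewrite /delta divr_gt0// mulr_gt0// exprn_gt0// disc_radius_gt0. Qed.

Lemma rim_radius_le : [/\ 2 * delta < r * rho ^+ 2 / 4, r * (1 + 3 * rho) + 2 * delta < 1 & delta <= r / 16].
Proof.
have h0 := disc_radius_gt0; have h1 := r0; have h2 := r1.
have rE : rho = (1 - r) / 4 by [].
have p1 : rho ^+ 2 <= rho / 4 by rewrite expr2; nra.
have p2 : 0 < r * rho ^+ 2 by rewrite mulr_gt0// exprn_gt0.
have p3 : r * rho ^+ 2 <= r * (rho / 4) by rewrite ler_pM2l.
have p4 : r * rho <= rho by rewrite ger_pMl// ltW.
have p5 : r * rho ^+ 2 <= r by rewrite ger_pMr//; lra.
rewrite /delta; split; lra.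
Qed.

Lemma enorm_orth (l : C) : enorm (a + l *: e) ^+ 2 = r ^+ 2 * (1 + cmod l ^+ 2).
Proof.
rewrite enormD_sqr hdotC hdotZl ea mulr0 enormZ ar er /=.
by ring.
Qed.

Lemma enorm_orth_circle (l : C) : cmod l = rho -> r + r * rho ^+ 2 / 4 <= enorm (a + l *: e).
Proof.
move=> lr; have h0 := disc_radius_gt0; have h1 := r0; have h2 := r1.
rewrite -(@ler_pXn2r _ 2)// ?nnegrE ?enorm_ge0//; last first.
  by rewrite addr_ge0 ?ltW// divr_gt0// mulr_gt0// exprn_gt0.
have -> : r + r * rho ^+ 2 / 4 = r * (1 + rho ^+ 2 / 4) by ring.
rewrite enorm_orth lr exprMn ler_pM2l ?exprn_gt0//.
have p1 : rho ^+ 2 <= 1 by have rE : rho = (1 - r) / 4 by []; rewrite expr2; nra.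
have p2 : 0 <= rho ^+ 2 by rewrite sqr_ge0.
by nra.
Qed.

Lemma slit_ball_outer (z : V) : enorm z < 1 -> r < enorm z -> D z.
Proof. by move=> z1 zr; split=> // -[E _]; rewrite E ltxx in zr. Qed.

Lemma slit_ball_inner (z : V) : enorm z < r -> D z.
Proof.
by move=> z1; split=> [|[E _]]; [exact: lt_trans z1 r1 | rewrite E ltxx in z1].
Qed.

Lemma slit_ball_hole (z : V) : enorm z < 1 -> c < complex.Re (z ord0 ord_max) -> D z.
Proof. by move=> z1 zc; split=> // -[_]; rewrite leNgt zc. Qed.

Lemma circle_in_slit (y : V) t : enorm (y - (a + circ rho t *: e)) < 2 * delta -> D y.
Proof.
move=> yd; have h0 := disc_radius_gt0; have [d1 d2 d3] := rim_radius_le.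
have ct : cmod (circ rho t) = rho by exact: cmod_circle.
have := enorm_orth_circle ct.
have : enorm (a + circ rho t *: e) <= r + rho * r.
  by have := rnD rn_enorm a (circ rho t *: e); rewrite enormZ ct ar er.
have p0 : 0 < rho * r by rewrite mulr_gt0.
have := rn_dist_abs rn_enorm y (a + circ rho t *: e); rewrite ler_norml => /andP[*].
by apply: slit_ball_outer; lra.
Qed.

(** As e is orthogonal to a, the product with a is constant on the whole disc, and Re <y, a> > r^2 =
    r |a| forces the norm above r. *)
Lemma half_space_in_slit (y : V) (l : C) : enorm (y - a) < delta ->
  r ^+ 2 < complex.Re (hdot y a) -> cmod l < 3 * rho -> D (y + l *: e).
Proof.
move=> ya yr lr; have h0 := disc_radius_gt0; have [d1 d2 d3] := rim_radius_le.
apply: slit_ball_outer.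
  have := rnD rn_enorm y (l *: e); rewrite enormZ er.
  have := rn_dist rn_enorm y a; rewrite ar.
  have : cmod l * r < 3 * rho * r by rewrite ltr_pM2r.
  have := rim_radius_gt0; lra.
have E : hdot (y + l *: e) a = hdot y a by rewrite hdotDl hdotZl ea mulr0 addr0.
have := hdot_le (y + l *: e) a; rewrite E ar => h.
rewrite -(ltr_pM2r r0) -expr2.
apply: lt_le_trans yr _; apply: le_trans h.
exact: le_trans (ler_norm _) (Re_le_cmod _).
Qed.

Section Extension.
Variable f : V -> C.
Hypothesis hf : forall z, D z -> hol f z /\ cmod (f z) <= 1.

(** As y is the centre of the circle, the plain mean plays the part of the Cauchy integral. The
    factor 1 is the weight [w] of [mean_hol]. *)
Definition rim_ext (y : V) : C := cmean (fun t => 1 * f (y + circ rho t *: e)).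

Lemma contat_circle_line t :
  contat (fun x : R => `|x|) (@enorm R n.+1) (fun t => circ rho t *: e) t.
Proof.
move=> d d0; have [s s0 hs] := rcont_circle rho t (divr_gt0 d0 r0).
exists s => // y /hs; rewrite -scalerBl enormZ er.
by rewrite ltr_pdivlMr.
Qed.

Lemma rim_ext_circle (y : V) t : enorm (y - a) < delta -> D (y + circ rho t *: e).
Proof.
move=> ya; apply: (@circle_in_slit _ t).
have -> : y + circ rho t *: e - (a + circ rho t *: e) = y - a by rewrite opprD addrACA subrr addr0.
by have := rim_radius_gt0; lra.
Qed.

Lemma rim_ext_cont (y : V) t : enorm (y - a) < delta ->
  rcont (fun t => 1 * f (y + circ rho t *: e)) t.
Proof.
move=> ya; suff : rcont (fun t => f (y + circ rho t *: e)) t.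
  by under [X in _ -> contat _ _ X t]eq_fun do rewrite mul1r.
have h := hol_cont (hf (rim_ext_circle t ya)).1.
apply: (@contat_comp _ _ _ _ _ (@enorm R n.+1) _ (fun t => y + circ rho t *: e) f) => // d d0.
have [s s0 hs] := contat_circle_line t d0; exists s => // u /hs.
by rewrite opprD addrACA subrr add0r.
Qed.

Lemma rim_ext_hol : hol_ball rim_ext a delta 1.
Proof.
move=> y ya; split; last first.
  apply: cmean_le => t; first exact: rim_ext_cont.
  by rewrite mul1r; exact: (hf (rim_ext_circle t ya)).2.
apply: (@mean_hol R n.+1 f (fun t => circ rho t *: e) (fun=> 1) y delta 1 1).
- exact: rim_radius_gt0.
- exact: contat_circle_line.
- by move=> t; exact: (contat_cst rn_cmod).
- by move=> t; rewrite cmod1.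
move=> t z zy; apply: hf; apply: (@circle_in_slit _ t).
have := rn_dist3 rn_enorm z (y + circ rho t *: e) (a + circ rho t *: e).
have -> : y + circ rho t *: e - (a + circ rho t *: e) = y - a by rewrite opprD addrACA subrr addr0.
lra.
Qed.

Lemma rim_ext_outer (y : V) : enorm (y - a) < delta -> r ^+ 2 < complex.Re (hdot y a) ->
  rim_ext y = f y.
Proof.
move=> ya yr; have h0 := disc_radius_gt0.
have := @mean_value_circle R (fun l => f (y + l *: e)) 0 (3 * rho) rho h0.
rewrite scale0r addr0 => -> //.
- by rewrite /rim_ext; congr cmean; apply: funext => t; rewrite mul1r add0r.
- by lra.
move=> l; rewrite subr0 => lr; apply: hol_line.
exact: (hf (half_space_in_slit ya yr lr)).1.
Qed.

Lemma Re_hdotC (x y : V) : complex.Re (hdot x y) = complex.Re (hdot y x).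
Proof. by rewrite hdotC; case: (hdot _ _). Qed.

Lemma Re_hdot_delta (w : V) : complex.Re (hdot (delta_mx ord0 ord_max) w) = complex.Re (w ord0 ord_max).
Proof.
rewrite /hdot (bigD1 ord_max)//= big1 ?addr0.
  by rewrite mxE !eqxx mul1r; case: (w ord0 ord_max).
by move=> j jn; rewrite mxE (negbTE jn) mul0r.
Qed.

Let s := delta / 4.
(** [k = 1] moves a outwards along the radius and [k = -1] inwards; the second term raises the real
    part of the last coordinate to c + s (1 + k c / r), above c in both cases. *)
Let pp (k : R) : V := ((1 + k * s / r)%:C)%C *: a + ((s%:C)%C) *: delta_mx ord0 ord_max.

Let s0 : 0 < s.
Proof. by rewrite divr_gt0// rim_radius_gt0. Qed.

Let sr : s <= r / 64.
Proof. by have [_ _ h] := rim_radius_le; rewrite /s; lra. Qed.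

Let ppa k : `|k| <= 1 -> enorm (pp k - a) <= delta / 2.
Proof.
move=> k1; have E : pp k - a = ((k * s / r)%:C)%C *: a + ((s%:C)%C) *: delta_mx ord0 ord_max.
  by apply/rowP => j; rewrite !mxE rmorphD rmorph1; ring.
rewrite E; apply: le_trans (rnD rn_enorm _ _) _.
rewrite !enormZ enorm_delta !cmodR ar mulr1 (gtr0_norm s0).
rewrite (normrM (k * s)) (normrM k) normfV (gtr0_norm r0) (gtr0_norm s0) divfK ?gt_eqF//.
have h0 := s0; have : `|k| * s <= s by rewrite ger_pMl.
have : delta = 4 * s by rewrite /s; field.
lra.
Qed.

Let margin := s * (1 - `|c| / r).

Let margin0 : 0 < margin.
Proof.
rewrite mulr_gt0 ?s0// subr_gt0 ltr_pdivrMr// mul1r.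
by rewrite ltr_norml rc cr.
Qed.

Let margin_le : margin <= s.
Proof. by rewrite ger_pMr ?s0// gerBl divr_ge0// ltW. Qed.

Let pp_last k : `|k| <= 1 -> c + margin <= complex.Re (pp k ord0 ord_max).
Proof.
move=> k1; have -> : complex.Re (pp k ord0 ord_max) = c + s * (1 + k * c / r).
  rewrite /pp !mxE !eqxx mulr1 raddfD /= Re_mulR ac /=.
  by field; rewrite gt_eqF.
rewrite lerD2l /margin ler_pM2l ?s0// lerD2l.
have : `|k * c / r| <= `|c| / r.
  by rewrite !normrM normfV (gtr0_norm r0) ler_wpM2r ?invr_ge0 ?(ltW r0)// ler_piMl.
by rewrite ler_norml => /andP[].
Qed.

Let pp_inner : enorm (pp (-1)) < r.
Proof.
have h0 := s0; have hr := r0; have hsr := sr; have hc := cr.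
rewrite -(@ltr_pXn2r _ 2)// ?nnegrE ?enorm_ge0 ?(ltW r0)//.
rewrite enormD_sqr !enormZ enorm_delta !cmodR ar (gtr0_norm s0).
rewrite Re_hdotC hdotZl Re_mulR Re_hdotC hdotZl Re_mulR Re_hdotC Re_hdot_delta ac.
set k := 1 + _; have kE : k * r = r - s by rewrite /k; field; rewrite gt_eqF.
have k0 : 0 < k by rewrite -(pmulr_lgt0 _ r0) kE; lra.
rewrite gtr0_norm// kE mulr1; have : 0 < s * (k * (r - c)) by rewrite !mulr_gt0// subr_gt0.
have -> : s * (k * (r - c)) = s * (r - s) - s * (k * c) by rewrite mulrBr kE mulrBr.
lra.
Qed.

Let pp_hdot : complex.Re (hdot (pp 1) a) = r ^+ 2 + s * (r + c).
Proof.
rewrite /pp hdotDl (hdotZl _ a) hdotZl hdotzz ar raddfD /= Re_mulR Re_hdot_delta ac /=.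
by field; rewrite gt_eqF.
Qed.

(* [P] lies outside the sphere and [Q] inside it; the segment from [P] to [Q] passes through
   the hole. *)
Lemma rim_points : exists P Q : V, exists d m : R,
  [/\ [/\ 0 < d, 0 < m & m <= d], [/\ delta = 4 * d, 4 * d < r & r + 4 * d < 1],
      [/\ enorm (P - a) <= 2 * d, enorm (Q - a) <= 2 * d & enorm Q < r],
      c + m <= complex.Re (P ord0 ord_max) /\ c + m <= complex.Re (Q ord0 ord_max) &
      complex.Re (hdot P a) = r ^+ 2 + d * (r + c)].
Proof.
have ab (k : R) : k = 1 \/ k = -1 -> `|k| <= 1 by case=> ->; rewrite ?normrN normr1.
have n1 := ab _ (or_introl erefl); have n2 := ab _ (or_intror erefl).
have ds : delta = 4 * s by rewrite /s; field.
have d2 : 2 * s = delta / 2 by rewrite ds; field.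
have h0 := r0; have h1 := r1; have h2 := sr; have [_ h3 _] := rim_radius_le; have h4 := disc_radius_gt0.
have h5 : 0 < r * rho by rewrite mulr_gt0.
exists (pp 1), (pp (-1)), s, margin; split; [split|split|split|split|exact: pp_hdot].
- exact: s0.
- exact: margin0.
- exact: margin_le.
- exact: ds.
- lra.
- move: h3; rewrite ds; have := s0; lra.
- rewrite d2; exact: ppa.
- rewrite d2; exact: ppa.
- exact: pp_inner.
- exact: pp_last.
- exact: pp_last.
Qed.

Lemma rim_ext_inner (y : V) : enorm (y - a) < delta -> enorm y < r -> rim_ext y = f y.
Proof.
have [P [Q [d [m [[d0 m0 md] [dE dr dr1] [Pa Qa Qr] [Pc Qc] Ph]]]]] := rim_points.
move=> ya yr; apply/eqP; rewrite -subr_eq0; apply/eqP.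
pose G z := rim_ext z - f z; rewrite -[LHS]/(G y).
have hr := r0; have hc := rc.
have hG z : enorm (z - a) < delta -> D z -> contat (@enorm R n.+1) (@cmod R) G z /\ (G z != 0 -> hol G z).
  move=> za Dz; have h : hol G z.
    have [h1 _] := rim_ext_hol za; have [h2 _] := hf Dz.
    exact: hol_add h1 (hol_opp h2).
  by split=> //; exact: hol_cont.
have outer z : enorm (z - P) < Num.min d (d * (r + c) / r) -> G z = 0.
  rewrite lt_min => /andP[z1 z2].
  have za : enorm (z - a) < delta by have := rn_dist3 rn_enorm z P a; rewrite dE; lra.
  suff zh : r ^+ 2 < complex.Re (hdot z a) by rewrite /G (rim_ext_outer za zh) subrr.
  have -> : hdot z a = hdot (z - P) a + hdot P a by rewrite -hdotDl subrK.
  rewrite raddfD /= Ph.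
  have := hdot_le (z - P) a; rewrite ar.
  have := Re_le_cmod (hdot (z - P) a); rewrite ler_norml => /andP[h1 _] h2.
  have : enorm (z - P) * r < d * (r + c) by rewrite -ltr_pdivlMr.
  by lra.
(* Passing from Q to z, and from the segment to x, loses at most m / 2 each of the margin m, so the
   tube stays in the region Re z_n > c of the hole. *)
have inner z : enorm (z - Q) < m / 2 -> G z = 0.
  move=> zp; apply: (@tube_identity R n.+1 G P z (m / 2) _ _ _ _ outer).
  - by rewrite divr_gt0.
  - by rewrite lt_min d0 divr_gt0// mulr_gt0//; lra.
  move=> t x t01 xt.
  have za : enorm (z - a) + m / 2 <= delta.
    by have := rn_dist3 rn_enorm z Q a; rewrite dE; lra.
  have xa : enorm (x - a) < delta by apply: ball_tube t01 xt => //; rewrite dE; lra.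
  apply: hG => //; apply: slit_ball_hole.
    by have := rn_dist rn_enorm x a; rewrite ar; rewrite dE in xa; lra.
  have := Re_sub_le x (P + (t%:C)%C *: (z - P)) ord_max; rewrite ler_norml => /andP[+ _].
  have := Re_sub_le z Q ord_max; rewrite ler_norml => /andP[+ _].
  case/andP: t01 => t0 t1.
  have -> : complex.Re ((P + (t%:C)%C *: (z - P)) ord0 ord_max) =
     (1 - t) * complex.Re (P ord0 ord_max) + t * complex.Re (z ord0 ord_max).
    rewrite [in LHS]mxE [X in _ + X]mxE [X in _ * X]mxE [(- P) _ _]mxE.
    by rewrite raddfD /= Re_mulR raddfB /=; ring.
  move: (complex.Re (P _ _)) (complex.Re (Q _ _)) (complex.Re (z _ _)) Pc Qc.
  move: (complex.Re (x _ _)) => X P1 P2 Z *; nra.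
pose d' := Num.min (Num.min (r - enorm Q) (r - enorm y)) (Num.min (2 * d) (delta - enorm (y - a))).
have d'0 : 0 < d' by rewrite !lt_min !subr_gt0 Qr yr ya mulr_gt0.
have [[d1 d2] [d3 d4]] : (d' <= r - enorm Q /\ d' <= r - enorm y) /\
    (d' <= 2 * d /\ d' <= delta - enorm (y - a)).
  have : d' <= d' by [].
  by rewrite {2}/d' !le_min => /andP[/andP[-> ->] /andP[-> ->]].
(* From Q to y the tube stays in the ball of radius r about 0 and in the ball of radius [delta]
   about a, since both are convex. *)
apply: (@tube_identity R n.+1 G Q y d' _ _ _ _ inner) => //.
  by rewrite divr_gt0.
move=> t x t01 xt; apply: hG.
  by apply: ball_tube t01 xt; [rewrite dE; lra|lra].
apply: slit_ball_inner; rewrite -[x]subr0.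
by apply: ball_tube t01 xt; rewrite subr0; lra.
Qed.

End Extension.
End Rim.

(** * Upper bounds near the rim *)

Section SqueezingUpper.
Context {R : realType} {n : nat}.
Local Notation C := R[i].
Local Notation V := 'rV[C]_n.+1.
Variables (r c : R) (a e : V).
Hypotheses (r0 : 0 < r) (r1 : r < 1) (rc : - r < c) (cr : c < r).
Hypotheses (ar : enorm a = r) (er : enorm e = r) (ea : hdot e a = 0).
Hypothesis ac : complex.Re (a ord0 ord_max) = c.
Local Notation D := (@slit_ball R n r c).
Local Notation delta := (rim_radius r).

Lemma rim_notin : ~ D a.
Proof. by move=> [_ h]; apply: h; rewrite ar ac. Qed.

Lemma rim_ext_lip (f : V -> C) y : (forall z, D z -> hol f z /\ cmod (f z) <= 1) ->
  enorm (y - a) <= delta / 6 ->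
  cmod (rim_ext r e f y - rim_ext r e f a) <= 6 / delta * enorm (y - a).
Proof.
move=> hf ya; have := hol_lip (rim_radius_gt0 r0 r1) (rim_ext_hol r0 r1 ar er ea hf) ya.
by rewrite mulr1 (addrC a) subrK.
Qed.

Lemma squeezing_upper z (t : R) (f : V -> V) : enorm z < r -> enorm (z - a) <= delta / 6 ->
  (forall y, D y -> vhol f y /\ enorm (f y) < 1) -> f z = 0 -> set_inj D f ->
  eball 0 t `<=` f @` D -> t <= n.+1%:R * (6 / delta) * enorm (z - a).
Proof.
move=> zr za hf fz fi ft; rewrite leNgt; apply/negP => tlt.
have d0 := rim_radius_gt0 r0 r1.
have hfi i y : D y -> hol (fun y => f y ord0 i) y /\ cmod (f y ord0 i) <= 1.
  move=> /hf[h1 h2]; split; first exact: h1.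
  by apply: le_trans (cmod_coord _ _) (ltW h2).
pose F y : V := \row_i rim_ext r e (fun y => f y ord0 i) y.
have Fin y : enorm (y - a) < delta -> enorm y < r -> F y = f y.
  move=> ya yr; apply/rowP => i; rewrite mxE.
  exact: (rim_ext_inner r0 r1 rc cr ar er ea ac (hfi i) ya yr).
have Flip y : enorm (y - a) <= delta / 6 -> enorm (F y - F a) <= n.+1%:R * (6 / delta) * enorm (y - a).
  move=> ya; apply: le_trans (enorm_le_sum _) _.
  rewrite -mulrA [leRHS](_ : _ = \sum_(i < n.+1) (6 / delta * enorm (y - a))); last first.
    by rewrite sumr_const card_ord mulr_natl.
  apply: ler_sum => i _.
  by rewrite !mxE; exact: rim_ext_lip (hfi i) ya.
(* F(z) = f(z) = 0, so the Lipschitz bound for F(z) - F(a) puts F(a) in the ball of radius t. *)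
have [w1 Dw1 fw1] : (f @` D) (F a).
  apply: ft; rewrite /eball /= subr0 -enormN.
  by have := Flip z za; rewrite Fin// ?fz ?sub0r; [move=> h; exact: le_lt_trans h tlt|lra].
have [s s0 hs] := slit_ball_open Dw1.
have w1a : 0 < enorm (w1 - a).
  by rewrite enorm_gt0 subr_eq0; apply/eqP => E; apply: rim_notin; rewrite -E.
have [|||eta eta0 heta] := @injective_open R n.+1 f w1 s isT s0 _ _
    (Num.min s (enorm (w1 - a) / 2)).
- by move=> y /hs /hf[].
- by move=> x y /hs Dx /hs Dy; apply: fi; rewrite inE.
- by rewrite lt_min s0 divr_gt0.
pose L := n.+1%:R * (6 / delta).
have L0 : 0 < L by rewrite mulr_gt0// divr_gt0.
(* The point y = (1 - tau) a lies inside the sphere. The four bounds keep 1 - tau positive, allow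
   the Lipschitz estimate at y, give |f(y) - F(a)| < eta, and keep y within |w1 - a| / 2 of a; the
   last prevents y from being the preimage w near w1. *)
pose tau := Num.min (Num.min (1 / 2) (delta / 6)) (Num.min (eta / (2 * L)) (enorm (w1 - a) / 2)).
have tau0 : 0 < tau.
  have q1 : 0 < eta / (2 * L) by rewrite divr_gt0//; lra.
  have q2 : 0 < delta / 6 by lra.
  by rewrite !lt_min q1 q2; lra.
have [[t1 t2] [t3 t4]] : (tau <= 1 / 2 /\ tau <= delta / 6) /\
    (tau <= eta / (2 * L) /\ tau <= enorm (w1 - a) / 2).
  have : tau <= tau by [].
  by rewrite {2}/tau !le_min => /andP[/andP[-> ->] /andP[-> ->]].
pose y := (((1 - tau)%:C)%C) *: a.
have tr : 0 < tau * r by rewrite mulr_gt0.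
have tr1 : tau * r <= tau by rewrite ger_pMr// ltW.
have yr : enorm y < r by rewrite enormZ cmodR ar gtr0_norm ?subr_gt0; lra.
have ya : enorm (y - a) <= tau.
  have -> : y - a = - (((tau)%:C)%C *: a).
    by apply/rowP => j; rewrite !mxE rmorphB rmorph1; ring.
  by rewrite enormN enormZ cmodR ar gtr0_norm//.
have Dy : D y by exact: slit_ball_inner.
have [|w ww1 fw] := heta (f y).
  rewrite fw1 -Fin//; last by lra.
  have h := Flip y ltac:(lra).
  apply: le_lt_trans h _; rewrite -/L.
  have : L * enorm (y - a) <= L * tau by rewrite ler_pM2l.
  have : L * tau <= L * (eta / (2 * L)) by rewrite ler_pM2l.
  have -> : L * (eta / (2 * L)) = eta / 2 by field; rewrite gt_eqF.
  lra.
move: ww1; rewrite lt_min => /andP[ws ww].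
have E : w = y by apply: fi => //; rewrite inE//; exact: hs.
rewrite -E in ya; have := rn_dist3 rn_enorm w1 w a; rewrite (rn_distC rn_enorm w1 w).
lra.
Qed.

End SqueezingUpper.

(** * The inverse of an injective holomorphic map of the ball *)

Section BallInverse.
Context {R : realType} {n : nat}.
Local Notation C := R[i].
Local Notation V := 'rV[C]_n.+1.
Local Notation vvcont := (contat (@enorm R n.+1) (@enorm R n.+1)).
Local Notation vcont := (contat (@enorm R n.+1) (@cmod R)).

Lemma bernoulli (u : R) N : 0 <= u -> 1 + N%:R * u <= (1 + u) ^+ N.
Proof.
move=> u0; elim: N => [|N IH]; first by rewrite mul0r addr0 expr0.
rewrite exprS -natr1; have N0 : 0 <= N%:R * u ^+ 2 by rewrite mulr_ge0 ?ler0n ?sqr_ge0.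
apply: (@le_trans _ _ ((1 + u) * (1 + N%:R * u))); last by rewrite ler_wpM2l// addr_ge0.
by move: (N%:R) N0 => m N0; lra.
Qed.

(** An N-th root makes the fixed factors d and M disappear: by Bernoulli's inequality (x / S)^N is
    unbounded when x > S. *)
Lemma le_of_expn (x S d M : R) : 0 <= S -> 0 < d ->
  (forall N, x ^+ N * d <= S ^+ N * M) -> x <= S.
Proof.
move=> S0 d0 h; rewrite leNgt; apply/negP => Sx.
have [S1|S1] := eqVneq S 0.
  have := h 1; rewrite !expr1 S1 mul0r; rewrite S1 in Sx.
  by have := mulr_gt0 Sx d0; lra.
have Sp : 0 < S by rewrite lt_def S1.
pose u := x / S - 1; have u0 : 0 < u by rewrite subr_gt0 ltr_pdivlMr// mul1r.
have M0 : 0 < M by have := h 0; rewrite !expr0 !mul1r; lra.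
pose N := Num.bound (M / (u * d)).
have hN : M / (u * d) < N%:R by apply: archi_boundP; rewrite divr_ge0 ?mulr_ge0 ?(ltW u0)// ltW.
have := bernoulli N (ltW u0); have -> : 1 + u = x / S by rewrite /u addrC subrK.
have := h N; rewrite mulrC -ler_pdivlMl// exprMn exprVn.
have SN : 0 < S ^+ N by rewrite exprn_gt0.
move=> h1 h2; have h3 : 1 + N%:R * u <= M / d.
  apply: le_trans h2 _; rewrite ler_pdivrMr//; apply: le_trans h1 _.
  by rewrite le_eqVlt; apply/orP; left; apply/eqP; field; rewrite gt_eqF.
have : M / d < N%:R * u.
  move: hN; rewrite ltr_pdivrMr ?mulr_gt0// => hN.
  by rewrite ltr_pdivrMr// -mulrA.
lra.
Qed.

Lemma hol_linear (d : 'cV[C]_n.+1) z : hol (fun y : V => (y *m d) ord0 ord0) z.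
Proof.
exists d; apply: hderivP => e e0; exists 1 => // y _.
rewrite -mul_col_sub subrr cmod0 mulr_ge0 ?enorm_ge0 ?(ltW e0)//.
Qed.

Lemma hol_hdot (w z : V) : hol (fun y => hdot y w) z.
Proof.
apply: (hol_ext ltr01 _ (hol_linear (\col_j (w ord0 j)^*%C) z)) => y _.
by rewrite mxE; apply: eq_bigr => j _; rewrite mxE.
Qed.

Section Inverse.
Variable f : V -> V.
Hypothesis hf : forall w, enorm w < 1 -> vhol f w.
Hypothesis fi : forall w w', enorm w < 1 -> enorm w' < 1 -> f w = f w' -> w = w'.

Definition ball_inv (q : V) : V := xget 0 [set w | enorm w < 1 /\ f w = q].
Local Notation G := ball_inv.

Lemma ball_invK w : enorm w < 1 -> G (f w) = w.
Proof.
move=> w1; have [h1 h2] : [set w' | enorm w' < 1 /\ f w' = f w] (G (f w)).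
  by apply: xgetPex; exists w.
exact: fi.
Qed.

Lemma ball_inv_open w d : enorm w < 1 -> 0 < d -> exists2 eta : R, 0 < eta &
  forall q, enorm (q - f w) < eta -> exists w', [/\ enorm w' < 1, f w' = q & enorm (w' - w) < d].
Proof.
move=> w1 d0; have r0 : 0 < 1 - enorm w by rewrite subr_gt0.
have sub y : enorm (y - w) < 1 - enorm w -> enorm y < 1.
  by move=> yw; have := rn_dist rn_enorm y w; lra.
have m0 : 0 < Num.min d (1 - enorm w) by rewrite lt_min d0.
have [|x y /sub x1 /sub y1|eta eta0 h] := @injective_open R n.+1 f w _ isT r0 _ _ _ m0.
- by move=> y /sub /hf.
- exact: fi.
exists eta => // q /h[w']; rewrite lt_min => /andP[w'd /sub w'1] <-.
by exists w'.
Qed.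

Lemma ball_inv_cont w : enorm w < 1 -> vvcont G (f w).
Proof.
move=> w1 d d0; have [eta eta0 h] := ball_inv_open w1 d0.
by exists eta => // q /h[w' [w'1 <- ww]]; rewrite !ball_invK.
Qed.

Lemma ball_inv_hol (h : V -> C) w : enorm w < 1 -> jac f w \in unitmx -> hol h w ->
  hol (fun y => h (G y)) (f w).
Proof.
move=> w1 ju hh; have [eta eta0 ho] := ball_inv_open w1 ltr01.
apply: (@comp_inverse_hol R n.+1 f G h (f w) (1 - enorm w) eta); rewrite ?ball_invK ?subr_gt0//.
- by move=> y yw; apply: hf; have := rn_dist rn_enorm y w; lra.
- exact: ball_inv_cont.
by move=> y /ho[w' [w'1 <- _]]; rewrite ball_invK.
Qed.

(** Put h_N(w) = <w, nu>^N det f'(w), with nu the unit vector along G(p). Composed with G it is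
    holomorphic where it is not 0, although G may not be; on the circle it is at most S^N M with M
    independent of N. The maximum principle at the centre and an N-th root give the bound S. *)
Lemma ball_inv_max_principle (p e : V) (s S : R) : 0 < s -> 0 <= S ->
  (forall l : C, cmod l <= s -> exists2 w, enorm w < 1 & f w = p + l *: e) ->
  (forall l : C, cmod l = s -> enorm (G (p + l *: e)) <= S) ->
  \det (jac f (G p)) != 0 -> enorm (G p) <= S.
Proof.
move=> s0 S0 hd hS dp.
have [->|Gp] := eqVneq (G p) 0; first by rewrite (rn0 rn_enorm).
have g0 : 0 < enorm (G p) by rewrite enorm_gt0.
pose nu := (((enorm (G p))^-1)%:C)%C *: G p.
have nu1 : enorm nu = 1 by rewrite enormZ cmodR ger0_norm ?invr_ge0 ?enorm_ge0// mulVf// gt_eqF.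
pose h N (w : V) := hdot w nu ^+ N * \det (jac f w).
have hh N w : enorm w < 1 -> hol (h N) w.
  move=> w1; apply: hol_mul.
    have := @hol_prod R n.+1 'I_N (index_enum 'I_N) (fun _ y => hdot y nu) w (fun _ => hol_hdot nu w).
    by apply: hol_ext ltr01 _ => y _; rewrite prodr_const card_ord.
  apply: (@det_jac_hol R n.+1 f w (1 - enorm w)); first by rewrite subr_gt0.
  by move=> y yw; apply: hf; have := rn_dist rn_enorm y w; lra.
pose phi N (l : C) := h N (G (p + l *: e)).
have line_cont (l : C) : contat (@cmod R) (@enorm R n.+1) (fun l => p + l *: e) l.
  move=> d d0; have k0 : 0 < enorm e + 1 by rewrite ltr_pwDr ?enorm_ge0.
  exists (d / (enorm e + 1)); first by rewrite divr_gt0.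
  move=> y; rewrite ltr_pdivlMr// opprD addrACA subrr add0r -scalerBl enormZ.
  by apply: le_lt_trans; rewrite ler_wpM2l ?cmod_ge0// lerDl.
have cphi N l : cmod l <= s -> ccont (phi N) l.
  move=> /hd[w w1 fw]; rewrite /phi.
  apply: (@contat_comp _ _ _ _ _ (@enorm R n.+1) _ (fun l => G (p + l *: e)) (h N)).
    apply: (@contat_comp _ _ _ _ _ (@enorm R n.+1) _ (fun l => p + l *: e) G); first exact: line_cont.
    by rewrite -fw; exact: ball_inv_cont.
  by apply: hol_cont; apply: hh; rewrite -fw ball_invK.
have circne : [set l : C | cmod l = s] !=set0.
  by exists ((s%:C)%C); rewrite /= cmodR gtr0_norm.
have circc : seqcompact (@cmod R) [set l : C | cmod l = s].
  apply: (seqcompact_sub (@seqcompact_disc R 0 s)).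
    by move=> l /= ls; rewrite subr0 ls.
  move=> l /= /eqP ls; exists `|cmod l - s|; first by rewrite normr_gt0 subr_eq0.
  move=> y yl ys; have := rn_dist_abs rn_cmod l y.
  by rewrite ys (rn_distC rn_cmod l) leNgt yl.
have circ_le l : cmod l = s -> cmod l <= s by move=> ->.
have [l0 _ hl0] := @seqcompact_max R _ _ _ (fun l => cmod (phi 0 l)) circc circne
   (fun l (ls : cmod l = s) => contat_norm rn_cmod (cphi 0 l (circ_le l ls))).
have [M hM] : exists M, forall l, cmod l = s -> cmod (phi 0 l) <= M by exists (cmod (phi 0 l0)) => l /hl0.
have bound N l : cmod (l - 0) = s -> cmod (phi N l) <= S ^+ N * M.
  rewrite subr0 => ls; rewrite /phi /h cmodM cmodX.
  have := hM l ls; rewrite /phi /h expr0 mul1r => hl.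
  apply: ler_pM; rewrite ?exprn_ge0 ?cmod_ge0//.
  rewrite lerXn2r ?nnegrE ?cmod_ge0//.
  apply: le_trans (hdot_le _ _) _.
  by rewrite nu1 mulr1 hS.
have d0 : 0 < cmod (\det (jac f (G p))) by rewrite cmod_gt0.
apply: (le_of_expn (M := M) S0 d0) => N.
have := @max_principle R (phi N) 0 s (S ^+ N * M) s0 _ _ (bound N) 0.
rewrite subrr cmod0 /phi scale0r addr0 /h cmodM cmodX.
have -> : hdot (G p) nu = ((enorm (G p))%:C)%C.
  rewrite hdotC hdotZl hdotzz -rmorphM /=.
  have -> : (enorm (G p))^-1 * enorm (G p) ^+ 2 = enorm (G p) by field; rewrite gt_eqF.
  by rewrite oppr0.
rewrite cmodR ger0_norm ?enorm_ge0//; apply.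
- by move=> l; rewrite subr0; exact: cphi.
- move=> l; rewrite subr0 => /ltW ls ne.
  apply: (@hol_line _ _ (fun y => h N (G y))).
  have [w w1 fw] := hd _ ls.
  have {}ne : h N (G (f w)) != 0 by rewrite fw.
  apply: (@eq_ind _ (f w) (hol (fun y => h N (G y))) _ _ fw).
  apply: (@ball_inv_hol (h N) w w1 _ (hh N w w1)).
  rewrite (ball_invK w1) /h mulf_eq0 negb_or in ne; case/andP: ne => _ ne.
  rewrite unitmxE unitfE; exact: ne.
exact: ltW.
Qed.

End Inverse.
End BallInverse.

(** * Upper bound for the Fridman invariant *)

Section FridmanUpperBound.
Context {R : realType} {n : nat}.
Local Notation C := R[i].
Local Notation V := 'rV[C]_n.+1.
Variables (r c : R) (a e : V).
Hypotheses (r0 : 0 < r) (r1 : r < 1) (rc : - r < c) (cr : c < r).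
Hypotheses (ar : enorm a = r) (er : enorm e = r) (ea : hdot e a = 0).
Hypothesis ac : complex.Re (a ord0 ord_max) = c.
Local Notation D := (@slit_ball R n r c).
Local Notation delta := (rim_radius r).

Lemma ReD (x y : C) : complex.Re (x + y) = complex.Re x + complex.Re y.
Proof. by case: x y => [? ?] [? ?]. Qed.

Lemma ReN (x : C) : complex.Re (- x) = - complex.Re x.
Proof. by case: x. Qed.

Lemma hdot_aa : hdot a a = ((r ^+ 2)%:C)%C.
Proof. by rewrite hdotzz ar. Qed.

Lemma Re_hdot_add_radial y (t : R) :
  complex.Re (hdot (y + ((t%:C)%C) *: a) a) = complex.Re (hdot y a) + t * r ^+ 2.
Proof. by rewrite hdotDl hdotZl hdot_aa ReD Re_mulR. Qed.

(* Touching the sphere inside the closed half-space is only possible at [a]. *)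
Lemma half_space_outer y : r ^+ 2 <= complex.Re (hdot y a) -> y != a -> r < enorm y.
Proof.
move=> h ya; rewrite lt_neqAle; apply/andP; split; last first.
  rewrite -(ler_pM2l r0) -expr2; apply: le_trans h _.
  rewrite mulrC -{1}ar; apply: le_trans (hdot_le _ _).
  by apply: le_trans (Re_le_cmod _); exact: ler_norm.
apply: contraNneq ya => yr; rewrite -subr_eq0 -enorm_eq0 -sqrf_eq0 eq_le sqr_ge0 andbT.
rewrite enormD_sqr enormN ar -yr Re_hdotC hdotNl ReN Re_hdotC.
lra.
Qed.

Section Map.
Variables (z : V) (f : V -> V).
Hypotheses (zr : enorm z < r) (za : enorm (z - a) <= delta / 6).
Hypothesis hf : forall w, enorm w < 1 -> vhol f w /\ D (f w).
Hypothesis fi : forall w w', enorm w < 1 -> enorm w' < 1 -> f w = f w' -> w = w'.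
Hypothesis fball : forall y, D y ->
  (forall h : V -> C, (forall x, D x -> hol h x /\ cmod (h x) < 1) -> h z = 0 ->
     cmod (h y) <= 12 / delta * enorm (z - a)) ->
  exists2 w, enorm w < 1 & f w = y.

(** Half the distance leaves room to push a point within s of a out to distance at most 2 s = |z -
    a|. Discs with parameter radius [sg] along e have Euclidean radius s / 2. *)
Let s := enorm (z - a) / 2.
Let sg := s / (2 * r).
Local Notation G := (ball_inv f).

Let s0 : 0 < s.
Proof.
rewrite divr_gt0// enorm_gt0 subr_eq0; apply/eqP => E.
by move: zr; rewrite E ar ltxx.
Qed.

Let d0 : 0 < delta. Proof. exact: rim_radius_gt0. Qed.

Let sd : 2 * s <= delta / 6.
Proof. by rewrite /s mulrC divfK. Qed.

Let sd2 : 2 * s < delta.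
Proof. by apply: le_lt_trans sd _; rewrite ltr_pdivrMr// ltr_pMr// ltr1n. Qed.

Let zd : enorm (z - a) < delta.
Proof. by apply: le_lt_trans za _; rewrite ltr_pdivrMr// ltr_pMr// ltr1n. Qed.

Let sgr : sg * r = s / 2.
Proof. by rewrite /sg; field; rewrite gt_eqF. Qed.

Let small : r + 2 * s < 1.
Proof.
have [_ h _] := rim_radius_le r0 r1; have h1 := d0; have h2 := disc_radius_gt0 r1.
have h3 : 0 < r * disc_radius r by rewrite mulr_gt0.
have h4 := sd; lra.
Qed.

(** The extension of h vanishes at z, and z and y are both within |z - a| of a; the Lipschitz
    constant 6 / delta, used twice, gives 12 / delta. Since y may lie on the tangent hyperplane
    itself, where the extension is not known to equal h, it is first pushed outwards to y + t a, and
    continuity of h at y absorbs the change. *)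
Lemma in_range_near y : enorm (y - a) <= s -> r ^+ 2 <= complex.Re (hdot y a) -> D y ->
  exists2 w, enorm w < 1 & f w = y.
Proof.
move=> ya yh Dy; apply: fball => // h hh hz.
have hh' x : D x -> hol h x /\ cmod (h x) <= 1 by move=> /hh[? /ltW].
rewrite leNgt; apply/negP => hy.
have [d dp hd] := hol_cont (hh y Dy).1 (e := cmod (h y) - 12 / delta * enorm (z - a)) ltac:(by rewrite subr_gt0).
pose t := Num.min d s / (2 * r).
have t0 : 0 < t by rewrite divr_gt0 ?mulr_gt0// lt_min dp s0.
have tr : t * r = Num.min d s / 2 by rewrite /t; field; rewrite gt_eqF.
have [m1 m2] : Num.min d s <= d /\ Num.min d s <= s by rewrite !ge_min !lexx orbT.
have m0 : 0 < Num.min d s by rewrite lt_min dp s0.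
pose y' := y + ((t%:C)%C) *: a.
have yy : enorm (y' - y) = t * r by rewrite /y' addrC addKr enormZ cmodR ar gtr0_norm.
have y'a : enorm (y' - a) <= 2 * s by have := rn_dist3 rn_enorm y' y a; have h1 := s0; lra.
have y'h : r ^+ 2 < complex.Re (hdot y' a).
  rewrite Re_hdot_add_radial; have : 0 < t * r ^+ 2 by rewrite mulr_gt0// exprn_gt0.
  lra.
have trd : t * r < d by rewrite tr; lra.
have hlt : cmod (h y - h y') < cmod (h y) - 12 / delta * enorm (z - a).
  by rewrite (rn_distC rn_cmod); apply: hd; rewrite yy.
have y'd := le_lt_trans y'a sd2.
have E1 := rim_ext_outer r0 r1 ar er ea hh' y'd y'h.
have E2 := rim_ext_inner r0 r1 rc cr ar er ea ac hh' zd zr.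
have y'6 := le_trans y'a sd.
have L1 := rim_ext_lip r0 r1 ar er ea hh' y'6.
have L2 := rim_ext_lip r0 r1 ar er ea hh' za.
rewrite E1 in L1; rewrite E2 hz sub0r (rnN rn_cmod) in L2.
have := rn_dist rn_cmod (h y') (rim_ext r e h a).
have := rn_dist rn_cmod (h y) (h y').
have kle : 6 / delta * enorm (y' - a) <= 6 / delta * enorm (z - a).
  have k0 : 0 < 6 / delta by rewrite divr_gt0.
  by rewrite (ler_pM2l k0); apply: le_trans y'a _; rewrite /s mulrC divfK.
have E : 12 / delta * enorm (z - a) = 2 * (6 / delta * enorm (z - a)).
  by field; rewrite gt_eqF.
move: hlt L1 L2 kle; rewrite E.
move: (6 / delta * enorm (z - a)) (6 / delta * enorm (y' - a)) => K1 K2.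
move: (cmod _) (cmod _) (cmod _) (cmod _) (cmod _) => X1 X2 X3 X4 X5; lra.
Qed.

Lemma half_space_range y : enorm (y - a) <= s -> r ^+ 2 <= complex.Re (hdot y a) -> y != a ->
  exists2 w, enorm w < 1 & f w = y.
Proof.
move=> ya yh yna; apply: in_range_near => //; apply: slit_ball_outer.
  by have := rn_dist rn_enorm y a; have h := small; have h1 := s0; rewrite ar; lra.
exact: half_space_outer.
Qed.

(** A compact set that contains the circles f(w) + l e, |l| = [sg], for f(w) close to a beyond the
    hyperplane. The third condition excludes a, where <a, e> = 0, so that the set lies in the range
    of f. *)
Definition rim_compact : set V := [set y | [/\ enorm (y - a) <= s,
  r ^+ 2 <= complex.Re (hdot y a) & sg * r ^+ 2 / 2 <= cmod (hdot y e)]].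

Let sg0 : 0 < sg.
Proof. by rewrite divr_gt0// mulr_gt0. Qed.

Lemma rim_compact_range y : rim_compact y -> exists2 w, enorm w < 1 & f w = y.
Proof.
move=> [ya yh ye]; apply: half_space_range => //; apply: contraTneq ye => ->.
rewrite hdotC ea rmorph0 cmod0 -ltNge divr_gt0// mulr_gt0// exprn_gt0//.
Qed.

Lemma seqcompact_rim_compact : seqcompact (@enorm R n.+1) rim_compact.
Proof.
apply: (seqcompact_sub (@seqcompact_eball R n.+1 a s)); first by move=> y [].
have near y u x : enorm (x - y) < u / r -> forall b : V, enorm b = r ->
    cmod (hdot x b - hdot y b) < u.
  move=> xy b br; rewrite -hdotNl -hdotDl.
  by apply: le_lt_trans (hdot_le _ _) _; rewrite br -ltr_pdivlMr.
move=> y; rewrite /rim_compact /= => hy.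
have [ya|ya] := leP (enorm (y - a)) s; last first.
  exists (enorm (y - a) - s); first by rewrite subr_gt0.
  move=> x xy [xa _ _]; have := rn_dist3 rn_enorm y x a; rewrite (rn_distC rn_enorm y x); lra.
have [yh|yh] := leP (r ^+ 2) (complex.Re (hdot y a)); last first.
  exists ((r ^+ 2 - complex.Re (hdot y a)) / r); first by rewrite divr_gt0// subr_gt0.
  move=> x /near/(_ _ ar) xy [_ xh _].
  have := Re_le_cmod (hdot x a - hdot y a); rewrite ReD ReN ler_norml => /andP[]; lra.
have [ye|ye] := leP (sg * r ^+ 2 / 2) (cmod (hdot y e)); first by case: hy.
exists ((sg * r ^+ 2 / 2 - cmod (hdot y e)) / r); first by rewrite divr_gt0// subr_gt0.
move=> x /near/(_ _ er) xy [_ _ xe].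
have := rn_dist rn_cmod (hdot x e) (hdot y e); lra.
Qed.

Let Gcont y : (exists2 w, enorm w < 1 & f w = y) -> contat (@enorm R n.+1) (@enorm R n.+1) G y.
Proof. by move=> [w w1 <-]; apply: ball_inv_cont => // u /hf[]. Qed.

Lemma rim_compact_bound : exists2 S, 0 <= S < 1 & forall y, rim_compact y -> enorm (G y) <= S.
Proof.
have ne : rim_compact !=set0.
  exists (a + ((sg%:C)%C) *: e); split.
  - rewrite addrC addKr enormZ er cmodR gtr0_norm// sgr; have h0 := s0; lra.
  - by rewrite hdotDl hdotZl ea mulr0 addr0 hdot_aa.
  rewrite hdotDl hdotZl hdotC ea rmorph0 add0r hdotzz er cmodM !cmodR !gtr0_norm ?exprn_gt0//.
  have : 0 < sg * r ^+ 2 by rewrite mulr_gt0// exprn_gt0.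
  lra.
have [y0 Ky0 hy0] := @seqcompact_max R _ _ _ (fun y => enorm (G y)) seqcompact_rim_compact ne
   (fun y Ky => contat_norm rn_enorm (Gcont (rim_compact_range Ky))).
exists (enorm (G y0)) => //; rewrite enorm_ge0.
have [w w1 <-] := rim_compact_range Ky0.
by rewrite ball_invK.
Qed.

Lemma no_fridman_map : False.
Proof.
have [S /andP[S0 S1] hS] := rim_compact_bound.
have hs := s0; have hsg := sg0; have hsgr := sgr.
(* The first bound keeps the closed disc of radius [sg] about f(w) within s of a; the second leaves
   |<y, e>| >= sg r^2 / 2 on its boundary. *)
pose eta := Num.min (s / 2) (sg * r / 2).
have sgr0 : 0 < sg * r by rewrite mulr_gt0.
have eta0 : 0 < eta by rewrite lt_min; apply/andP; split; lra.
have [e1 e2] : eta <= s / 2 /\ eta <= sg * r / 2 by rewrite !ge_min !lexx orbT.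
have near_a w : enorm w < 1 -> enorm (f w - a) < eta -> r ^+ 2 < complex.Re (hdot (f w) a) ->
    \det (jac f w) != 0 -> enorm w <= S.
  move=> w1 wa wh dw; have GK := ball_invK fi w1.
  have hE (l : C) : complex.Re (hdot (f w + l *: e) a) = complex.Re (hdot (f w) a).
    by rewrite hdotDl hdotZl ea mulr0 addr0.
  have near_disc (l : C) : cmod l <= sg -> enorm (f w + l *: e - a) <= s.
    move=> ls; have := rnD rn_enorm (f w - a) (l *: e); rewrite enormZ er addrAC.
    have : cmod l * r <= sg * r by rewrite ler_pM2r.
    lra.
  have := @ball_inv_max_principle R n f (fun u u1 => (hf u1).1) fi (f w) e sg S hsg S0.
  rewrite GK; apply; last exact: dw.
  - move=> l ls; apply: half_space_range; rewrite ?hE ?(ltW wh)//; first exact: near_disc.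
    by apply: contraTneq wh => E; rewrite -(hE l) E hdot_aa /= ltxx.
  - move=> l ls; apply: hS; split; rewrite ?hE ?(ltW wh)//.
      by apply: near_disc; rewrite ls.
    have -> : hdot (f w + l *: e) e = hdot (f w - a) e + l * ((r ^+ 2)%:C)%C.
      by rewrite !hdotDl hdotZl hdotNl (hdotC e a) ea rmorph0 subr0 hdotzz er.
    have := rn_dist rn_cmod (l * ((r ^+ 2)%:C)%C) (hdot (f w - a) e + l * ((r ^+ 2)%:C)%C).
    rewrite opprD addrCA subrr addr0 (rnN rn_cmod) cmodM cmodR ls gtr0_norm ?exprn_gt0//.
    have := hdot_le (f w - a) e; rewrite er.
    have : enorm (f w - a) * r < sg * r / 2 * r by rewrite ltr_pM2r//; lra.
    have -> : sg * r / 2 * r = sg * r ^+ 2 / 2 by rewrite expr2; field.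
    lra.
have dense (ep : R) : 0 < ep -> exists w, enorm w <= S /\ enorm (f w - a) < ep.
  move=> ep0; pose m := Num.min ep eta; have m0 : 0 < m by rewrite lt_min ep0.
  have /andP[m1 m2] : (m <= ep) && (m <= eta) by rewrite -le_min.
  pose t := m / (2 * r); have tr : t * r = m / 2 by rewrite /t; field; rewrite gt_eqF.
  have t0 : 0 < t by rewrite divr_gt0// mulr_gt0.
  pose p := a + ((t%:C)%C) *: a.
  have pa : enorm (p - a) = m / 2 by rewrite /p addrC addKr enormZ ar cmodR gtr0_norm.
  have ph : complex.Re (hdot p a) = r ^+ 2 + t * r ^+ 2 by rewrite Re_hdot_add_radial hdot_aa.
  have tr2 : 0 < t * r ^+ 2 by rewrite mulr_gt0// exprn_gt0.
  have [||| w0 w01 fw0] := @half_space_range p; try lra.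
    by rewrite -subr_eq0 -enorm_eq0 pa gt_eqF// divr_gt0.
  have [d dp hd] := vhol_cont (hf w01).1 (e := Num.min (m / 2) (t * r)) ltac:(by rewrite lt_min divr_gt0//= mulr_gt0).
  pose d1 := Num.min d (1 - enorm w0).
  have d10 : 0 < d1 by rewrite lt_min dp subr_gt0.
  have sub y : enorm (y - w0) < d1 -> enorm (y - w0) < d /\ enorm y < 1.
    rewrite lt_min => /andP[h1 h2]; split=> //.
    by have := rn_dist rn_enorm y w0; lra.
  (* The determinant may vanish at the preimage [w0] of p; a point with nonzero determinant replaces
     it, so near that its value stays beyond the hyperplane. *)
  have [||w ww dw] := @injective_det_jac R n.+1 f w0 d1 isT d10.
  - by move=> y /sub[_ /hf[]].
  - by move=> x y /sub[_ x1] /sub[_ y1]; exact: fi.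
  have [wd w1] := sub _ ww; have := hd _ wd; rewrite lt_min fw0 => /andP[h1 h2].
  have wa : enorm (f w - a) < m by have := rn_dist3 rn_enorm (f w) p a; lra.
  exists w; split; last by lra.
  apply: near_a => //; first by lra.
  have -> : hdot (f w) a = hdot (f w - p) a + hdot p a by rewrite -hdotDl subrK.
  rewrite ReD ph; have := Re_le_cmod (hdot (f w - p) a); rewrite ler_norml => /andP[h3 _].
  have := hdot_le (f w - p) a; rewrite ar.
  have : enorm (f w - p) * r < t * r * r by rewrite ltr_pM2r.
  rewrite -mulrA -expr2; lra.
have hw k : exists w, enorm w <= S /\ enorm (f w - a) < (k.+1%:R)^-1 by apply: dense.
have [u hu] := choice hw.
have [w hwu] := bolzano_weierstrass (fun k => (hu k).1).
have wS : enorm w <= S.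
  apply/ler_addgt0Pr => d dp; have [k _ hk] := hwu d 0 dp.
  have := rn_dist rn_enorm w (u k); have := (hu k).1; rewrite (rn_distC rn_enorm w); lra.
have w1 : enorm w < 1 by exact: le_lt_trans wS S1.
have fw : f w = a.
  apply/eqP; rewrite -subr_eq0 -enorm_eq0 eq_le enorm_ge0 andbT.
  apply/ler_addgt0Pr => d dp; rewrite add0r.
  have [d1 d10 hd1] := vhol_cont (hf w1).1 (divr_gt0 dp (ltr0n _ 2)).
  pose N := Num.bound (2 / d).
  have [k Nk hk] := hwu d1 N d10.
  have h1 := hd1 _ hk; have h2 := (hu k).2.
  have h3 : (k.+1%:R)^-1 <= d / 2.
    rewrite -(invf_div 2 d) lef_pV2 ?posrE ?divr_gt0// ?ltr0n//.
    apply: ltW; apply: (@lt_le_trans _ _ N%:R); first by apply: archi_boundP; rewrite divr_ge0// ltW.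
    by rewrite ler_nat; exact: leqW.
  have {}h2 := lt_le_trans h2 h3; clear h3.
  by have := rn_dist3 rn_enorm (f w) (f (u k)) a; rewrite (rn_distC rn_enorm (f w) (f _)); lra.
by have [_] := hf w1; rewrite fw; exact: rim_notin.
Qed.

End Map.
End FridmanUpperBound.

(** * The two invariants *)

Section Invariants.
Context {R : realType}.
Local Notation C := R[i].

Lemma tanhE (t : R) : tanh t = 1 - 2 / (expR (2 * t) + 1).
Proof.
have p : 0 < expR t by exact: expR_gt0.
rewrite /tanh expRN (_ : 2 * t = t + t) ?expRD; last by ring.
by field; rewrite !gt_eqF ?addr_gt0 ?mulr_gt0 ?invr_gt0.
Qed.

Lemma tanh_lt1 (t : R) : tanh t < 1.
Proof. by rewrite tanhE ltrBlDr ltrDl divr_gt0// addr_gt0// expR_gt0. Qed.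

Lemma artanh_le (x y : R) : 0 <= x -> x <= y -> y < 1 -> artanh x <= artanh y.
Proof.
move=> x0 xy y1; rewrite ler_pM2r ?invr_gt0// ler_ln ?posrE ?divr_gt0//; try lra.
have y0 : 0 < 1 - y by lra.
have x1 : 0 < 1 - x by lra.
rewrite ler_pdivrMr// mulrAC ler_pdivlMr//; lra.
Qed.

Lemma artanh_lt_tanh (x t : R) : 0 <= x -> x < tanh t -> artanh x < t.
Proof.
move=> x0 xt; have x1 := lt_trans xt (tanh_lt1 t).
rewrite ltr_pdivrMr// -ltr_expR lnK ?posrE ?divr_gt0//; try lra.
have p := expR_gt0 (t * 2); rewrite tanhE (mulrC 2 t) in xt.
have {}xt : 2 / (expR (t * 2) + 1) < 1 - x by lra.
rewrite ltr_pdivrMr in xt; last by lra.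
by rewrite ltr_pdivrMr ?subr_gt0//; lra.
Qed.

Lemma tanh_artanh (x : R) : 0 <= x -> x < 1 -> tanh (artanh x) = x.
Proof.
move=> x0 x1; rewrite tanhE /artanh (_ : 2 * (ln ((1 + x) / (1 - x)) / 2) = ln ((1 + x) / (1 - x))); last by field.
rewrite lnK ?posrE ?divr_gt0//; try lra.
by field; rewrite !gt_eqF//; lra.
Qed.

Lemma differentiable_affine n (k : C) (p z : 'rV[C]_n) : differentiable (fun y : 'rV[C]_n => k *: (y - p)) z.
Proof.
apply: differentiableZ; apply: differentiableB; [exact: ex_diff|exact: differentiable_cst].
Qed.

Lemma differentiable_hdot n (k : C) (p w z : 'rV[C]_n) :
  differentiable (fun y : 'rV[C]_n => k * hdot (y - p) w : C) z.
Proof.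
have E : (fun y : 'rV[C]_n => k * hdot (y - p) w : C) =
    \sum_(j < n) (fun y : 'rV[C]_n => (k * (w ord0 j)^*%C) *: ((y ord0 j : C) - p ord0 j)).
  apply: funext => y; rewrite fct_sumE /hdot mulr_sumr; apply: eq_bigr => j _.
  by rewrite !mxE -[RHS]mulrA (mulrC (_ - _)).
rewrite E; apply: differentiable_sum => j; apply: differentiableZ; apply: differentiableB.
  exact: differentiable_coord.
exact: differentiable_cst.
Qed.

Section Slit.
Context {n : nat}.
Local Notation V := 'rV[C]_n.+1.
Variables (r c : R).
Hypotheses (r0 : 0 < r) (r1 : r < 1) (rc : - r < c) (cr : c < r).
Local Notation D := (@slit_ball R n r c).
Local Notation delta := (rim_radius r).

Section Upper.
Variables (a e z : V).
Hypotheses (ar : enorm a = r) (er : enorm e = r) (ea : hdot e a = 0).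
Hypothesis ac : complex.Re (a ord0 ord_max) = c.
Hypotheses (zr : enorm z < r) (za : enorm (z - a) <= delta / 6).

Lemma squeezing_le : (squeezing D z <= (n.+1%:R * (6 / delta) * enorm (z - a))%:E)%E.
Proof.
apply: ge_ereal_sup => _ [t [t0 [f [[fd fB] fz fi ft]]] <-]; rewrite lee_fin.
apply: (squeezing_upper r0 r1 rc cr ar er ea ac zr za _ fz fi ft) => y Dy; split.
  exact: differentiable_vhol (fd _ Dy).
by have := fB _ (imageP f Dy); rewrite /eball /= subr0.
Qed.

Lemma fridman_le : (fridman D z <= (12 / delta * enorm (z - a))%:E)%E.
Proof.
apply: ge_ereal_sup => _ [t [t0 [f [[fd fD] fi ft]]] <-]; rewrite lee_fin leNgt; apply/negP => tM.
have B1 (w : V) : enorm w < 1 -> eball 0 1 w by rewrite /eball /= subr0.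
have d0 := rim_radius_gt0 r0 r1.
have M0 : 0 <= 12 / delta * enorm (z - a) by rewrite mulr_ge0 ?enorm_ge0// divr_ge0// ltW.
apply: (@no_fridman_map R n r c a e r0 r1 rc cr ar er ea ac z f zr za).
- move=> w /B1 w1; split; first exact: differentiable_vhol (fd _ w1).
  exact: fD (imageP f w1).
- by move=> w w' /B1 w1 /B1 w'1; apply: fi; rewrite inE.
move=> y Dy hy; have [|w w1 <-] := ft y; last first.
  by exists w => //; move: w1; rewrite /eball /= subr0.
split=> //; apply: (@le_lt_trans _ _ (artanh (12 / delta * enorm (z - a)))%:E); last first.
  by rewrite lte_fin artanh_lt_tanh.
apply: ge_ereal_sup => _ [h [[hd hD] hz] <-]; rewrite lee_fin.
apply: artanh_le; rewrite ?cmod_ge0//; last exact: lt_trans tM (tanh_lt1 t).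
apply: hy => // x Dx; split; first exact: differentiable_hol (hd _ Dx).
exact: hD (imageP h Dx).
Qed.

End Upper.

Let p0 : V := ((c%:C)%C) *: delta_mx ord0 ord_max.
Let kappa := r - `|c|.

Let p0E : enorm p0 = `|c|.
Proof. by rewrite enormZ enorm_delta cmodR mulr1. Qed.

Let kappa0 : 0 < kappa.
Proof. by rewrite subr_gt0 ltr_norml rc. Qed.

(** Translation by p0 followed by halving: |y - p0| < 2 on the unit ball, and D contains the ball of
    radius r - |c| about p0, which lies inside the sphere. *)
Lemma squeezing_ge : ((kappa / 2)%:E <= squeezing D p0)%E.
Proof.
have hk := kappa0; have c0 := normr_ge0 c; have kE : kappa = r - `|c| by [].
apply: ereal_sup_ubound; exists (kappa / 2) => //; split; first by rewrite divr_gt0.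
exists (fun y => ((2^-1)%:C)%C *: (y - p0)); split.
- split; first by move=> *; exact: differentiable_affine.
  move=> _ [y [y1 _] <-]; rewrite /eball /= subr0 enormZ cmodR ger0_norm//.
  have := rnD rn_enorm y (- p0); rewrite enormN p0E; have h1 := r1; lra.
- by rewrite subrr scaler0.
- move=> x y _ _ /scalerI/addIr; apply.
  by rewrite -cmod_eq0 cmodR normr_eq0 invr_eq0 pnatr_eq0.
move=> w; rewrite /eball /= subr0 => wk.
exists (p0 + (2%:C)%C *: w).
  apply: slit_ball_inner => //.
  have := rnD rn_enorm p0 ((2%:C)%C *: w); rewrite p0E enormZ cmodR (@gtr0_norm _ 2)//; lra.
by rewrite addrC addKr scalerA -rmorphM mulVf ?pnatr_eq0// rmorph1 scale1r.
Qed.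

(** The map takes the unit ball onto the ball of radius kappa about p0. For w at distance at least
    kappa from p0, the function <y - p0, w - p0> / (2 |w - p0|) is bounded by 1 on D and has modulus
    at least kappa / 2 at w, so w is outside the Caratheodory ball. *)
Lemma fridman_ge : ((kappa / 2)%:E <= fridman D p0)%E.
Proof.
have hk := kappa0; have c0 := normr_ge0 c; have kE : kappa = r - `|c| by []; have h1 := r1.
have k1 : kappa / 2 < 1 by lra.
have k0 : 0 < kappa / 2 by lra.
apply: ereal_sup_ubound; exists (artanh (kappa / 2)); last by rewrite tanh_artanh// ltW.
split.
  by rewrite divr_gt0// ln_gt0// ltr_pdivlMr; lra.
exists (fun y => ((kappa%:C)%C *: (y - ((- kappa^-1)%:C)%C *: p0))).
have fE y : (kappa%:C)%C *: (y - ((- kappa^-1)%:C)%C *: p0) = (kappa%:C)%C *: y + p0.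
  by rewrite scalerBr scalerA -rmorphM mulrN mulfV ?gt_eqF// rmorphN rmorph1 scaleN1r opprK.
split.
- split; first by move=> *; exact: differentiable_affine.
  move=> _ [y y1 <-]; rewrite /eball /= subr0 in y1; rewrite fE; apply: slit_ball_inner => //.
  have := rnD rn_enorm ((kappa%:C)%C *: y) p0; rewrite p0E enormZ cmodR (gtr0_norm hk).
  have : kappa * enorm y < kappa by rewrite gtr_pMr.
  lra.
- move=> x y _ _ /scalerI/addIr; apply.
  by rewrite -cmod_eq0 cmodR normr_eq0 gt_eqF.
move=> w [[w1 Dw] hw].
have [->|wp] := eqVneq w p0.
  exists 0; first by rewrite /eball /= subrr (rn0 rn_enorm).
  by rewrite fE scaler0 add0r.
have N0 : 0 < enorm (w - p0) by rewrite enorm_gt0 subr_eq0.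
suff wk : enorm (w - p0) < kappa.
  exists (((kappa^-1)%:C)%C *: (w - p0)).
    by rewrite /eball /= subr0 enormZ cmodR gtr0_norm ?invr_gt0// mulrC ltr_pdivrMr ?mul1r.
  by rewrite fE scalerA -rmorphM mulfV ?gt_eqF// rmorph1 scale1r subrK.
pose k := (2 * enorm (w - p0))^-1; have k0' : 0 < k by rewrite invr_gt0 mulr_gt0.
pose h (y : V) : C := (k%:C)%C * hdot (y - p0) (w - p0).
have hE y : cmod (h y) <= enorm (y - p0) / 2.
  rewrite /h cmodM cmodR gtr0_norm//; have := hdot_le (y - p0) (w - p0).
  rewrite -(ler_pM2l k0') => /le_trans; apply; rewrite /k.
  by rewrite le_eqVlt; apply/orP; left; apply/eqP; field; rewrite gt_eqF.
have hw' : cmod (h w) = enorm (w - p0) / 2.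
  rewrite /h hdotzz cmodM !cmodR !gtr0_norm ?exprn_gt0//.
  by rewrite /k; field; rewrite gt_eqF.
have dist y : D y -> enorm (y - p0) / 2 < 1.
  by move=> [y1 _]; have := rnD rn_enorm y (- p0); rewrite enormN p0E; lra.
have lt : artanh (cmod (h w)) < artanh (kappa / 2).
  rewrite -lte_fin; apply: le_lt_trans hw; apply: ereal_sup_ubound.
  exists h => //; split; last by rewrite /h subrr /hdot big1 ?mulr0// => j _; rewrite mxE mul0r.
  split; first by move=> *; exact: differentiable_hdot.
  by move=> _ [y Dy <-]; apply: le_lt_trans (hE y) (dist y Dy).
rewrite ltNge; apply/negP => kw; move: lt; rewrite ltNge hw'; apply/negP; rewrite negbK.
apply: artanh_le; rewrite ?(ltW k0)//; first by lra.
exact: dist.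
Qed.

End Slit.
End Invariants.

(** * Failure of the sub-mean value inequality *)

Section Contradiction.
Context {R : realType}.
Local Notation C := R[i].

(** [g] may fail to be measurable, so the comparison is made from the definition: the integral of
    the positive part is a supremum over simple functions below it, and these are below K as
    well. *)
Lemma integral_le_cst (g : R -> \bar R) (a b K : R) : a < b -> 0 <= K -> (forall t, (g t <= K%:E)%E) ->
  (\int[lebesgue_measure]_(t in `[a, b]) g t <= (K * (b - a))%:E)%E.
Proof.
move=> ab K0 gK; have gp t : (g^\+%E t <= K%:E)%E.
  by rewrite funeposE ge_max gK lee_fin.
rewrite integralE; apply: (@le_trans _ _ (\int[lebesgue_measure]_(t in `[a, b]) g^\+%E t)%E).
  by rewrite -[leRHS]sube0; apply: leeB => //; apply: integral_ge0.
have -> : (K * (b - a))%:E = (\int[lebesgue_measure]_(t in `[a, b]) cst K%:E t)%E.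
  by rewrite integral_cst//= lebesgue_measure_itv/= lte_fin ab -EFinD -EFinM.
rewrite !ge0_integralE//.
apply: ge_ereal_sup => _ [h /= hg <-]; apply: ereal_sup_ubound; exists h => //= t.
apply: le_trans (hg t) _.
by rewrite !patchE; case: ifP.
Qed.

Lemma hdot_delta n (j : 'I_n) (w : 'rV[C]_n) : hdot (delta_mx ord0 j) w = (w ord0 j)^*%C.
Proof.
rewrite /hdot (bigD1 j)//= big1 ?addr0; first by rewrite mxE !eqxx mul1r.
by move=> k kj; rewrite mxE (negbTE kj) mul0r.
Qed.

Context {n : nat}.
Local Notation V := 'rV[C]_n.+2.

(** The plane of the first and last coordinates, which are distinct in dimension [n.+2]. *)
Definition plane_pt (x y : C) : V := y *: delta_mx ord0 ord_max + x *: delta_mx ord0 ord0.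

Lemma plane_pt0 x y : plane_pt x y ord0 ord0 = x.
Proof. by rewrite /plane_pt !mxE /= mulr0 mulr1 add0r. Qed.

Lemma plane_pt_last x y : plane_pt x y ord0 ord_max = y.
Proof. by rewrite /plane_pt !mxE /= eqxx mulr0 mulr1 addr0. Qed.

Lemma hdot_plane_pt x y x' y' :
  hdot (plane_pt x y) (plane_pt x' y') = y * y'^*%C + x * x'^*%C.
Proof.
by rewrite {1}/plane_pt hdotDl !hdotZl !hdot_delta plane_pt0 plane_pt_last.
Qed.

Lemma enorm_plane_pt x y : enorm (plane_pt x y) ^+ 2 = cmod x ^+ 2 + cmod y ^+ 2.
Proof.
have := hdotzz (plane_pt x y); rewrite hdot_plane_pt => /(congr1 (@complex.Re R)).
rewrite ReD /= => <-; rewrite !cmod_sqr addrC; case: x => a b; case: y => a' b' /=.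
ring.
Qed.

Section Rim.
Variables (r c : R).
Hypotheses (r0 : 0 < r) (r1 : r < 1) (rc : - r < c) (cr : c < r).
Local Notation D := (@slit_ball R n.+1 r c).

Lemma not_plurisubharmonic (u : V -> \bar R) (L : R) : 0 < L ->
  (forall a e z, enorm a = r -> enorm e = r -> hdot e a = 0 ->
     complex.Re (a ord0 ord_max) = c -> enorm z < r -> enorm (z - a) <= rim_radius r / 6 ->
     (u z <= (L * enorm (z - a))%:E)%E) ->
  (((r - `|c|) / 2)%:E <= u (((c%:C)%C) *: delta_mx ord0 ord_max))%E ->
  ~ plurisubharmonic D u.
Proof.
move=> L0 upper lower [_ /(_ (((c%:C)%C) *: delta_mx ord0 ord_max) (delta_mx ord0 ord0))[_ sub]].
pose kap := r - `|c|; have kap0 : 0 < kap by rewrite subr_gt0 ltr_norml rc.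
have d0 := rim_radius_gt0 r0 r1.
have rc2 : 0 < r ^+ 2 - c ^+ 2 by have h1 := rc; have h2 := cr; rewrite subr_sqr mulr_gt0//; lra.
(* In the plane of z_1 through p0 the sphere |z| = r is the circle |z_1| = h, all of it on the
   rim. *)
pose h := Num.sqrt (r ^+ 2 - c ^+ 2); have h0 : 0 < h by rewrite sqrtr_gt0.
have hE : h ^+ 2 = r ^+ 2 - c ^+ 2 by rewrite sqr_sqrtr// ltW.
(* The distance from the circle of integration to the rim: at most h / 2 to keep the radius
   positive, at most a sixth of the rim radius for [upper], and at most kap / (4 L) so that the mean
   is at most half of the lower bound kap / 2. *)
pose d := Num.min (h / 2) (Num.min (rim_radius r / 6) (kap / (4 * L))).
have dp : 0 < d.
  have q1 : 0 < kap / (4 * L) by rewrite divr_gt0// mulr_gt0.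
  by rewrite !lt_min q1; lra.
have [d1 d2 d3] : [/\ d <= h / 2, d <= rim_radius r / 6 & d <= kap / (4 * L)].
  have : d <= d by [].
  by rewrite {2}/d !le_min => /and3P[].
have Ld : L * d <= kap / 4.
  apply: (@le_trans _ _ (L * (kap / (4 * L)))); first by rewrite ler_pM2l.
  by rewrite le_eqVlt; apply/orP; left; apply/eqP; field; rewrite gt_eqF.
pose rho := h - d; have rho0 : 0 < rho by rewrite /rho; lra.
have inner x : cmod x <= rho -> enorm (plane_pt x (c%:C)%C) < r.
  move=> xr; rewrite -(@ltr_pXn2r _ 2)// ?nnegrE ?enorm_ge0 ?(ltW r0)//.
  rewrite enorm_plane_pt cmodR (real_normK (num_real c)) -ltrBrDr -hE.
  by rewrite ltr_pXn2r// ?nnegrE ?cmod_ge0 ?(ltW h0)//; rewrite /rho in xr; lra.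
have := sub 0 rho rho0; rewrite scale0r addr0.
have inD : [set x : C | cmod (x - 0) <= rho] `<=`
    [set x : C | D ((c%:C)%C *: delta_mx ord0 ord_max + x *: delta_mx ord0 ord0)].
  by move=> x; rewrite /= subr0 => xr; apply: slit_ball_inner => //; exact: inner.
move=> /(_ inD) hsub.
pose v (t : R) : \bar R := u ((c%:C)%C *: delta_mx ord0 ord_max +
   (0 + Complex (rho * cos t) (rho * sin t)) *: delta_mx ord0 ord0).
have vle t : (v t <= (kap / 4)%:E)%E.
  pose x : C := 0 + Complex (rho * cos t) (rho * sin t).
  have xE : cmod x = rho.
    rewrite /x add0r cmodE !exprMn -mulrDr cos2Dsin2 mulr1 sqrtr_sqr gtr0_norm//.
  (* The rim point on the ray through x, at distance d from it. *)
  pose x1 := ((h / rho)%:C)%C * x.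
  have x1E : cmod x1 = h by rewrite /x1 cmodM xE cmodR gtr0_norm ?divr_gt0// divfK// gt_eqF.
  have sqrE (z : V) : enorm z ^+ 2 = r ^+ 2 -> enorm z = r.
    by move=> E; apply/eqP; rewrite -(@eqrXn2 _ 2)// ?enorm_ge0 ?(ltW r0)//; apply/eqP.
  have dist : enorm (plane_pt x (c%:C)%C - plane_pt x1 (c%:C)%C) = d.
    have -> : plane_pt x (c%:C)%C - plane_pt x1 (c%:C)%C = (x - x1) *: delta_mx ord0 ord0.
      by rewrite /plane_pt opprD addrACA subrr add0r -scalerBl.
    rewrite enormZ enorm_delta mulr1 /x1 -{1}[x]mul1r -mulrBl cmodM xE.
    have -> : 1 - ((h / rho)%:C)%C = ((1 - h / rho)%:C)%C by rewrite rmorphB rmorph1.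
    rewrite cmodR distrC.
    have -> : h / rho - 1 = d / rho by rewrite /rho; field; rewrite gt_eqF.
    by rewrite gtr0_norm ?divr_gt0// divfK// gt_eqF.
  (* The vector with first coordinate c and last coordinate - conj(x1) is orthogonal to the rim
     point, whose coordinates are x1 and c, and has the same norm r. *)
  have := upper (plane_pt x1 (c%:C)%C) (plane_pt (c%:C)%C (- x1^*%C)) (plane_pt x (c%:C)%C).
  rewrite dist => /(_ _ _ _ _ _ d2) H; apply: le_trans (H _ _ _ _ _) _.
  - by apply: sqrE; rewrite enorm_plane_pt x1E cmodR (real_normK (num_real c)) hE subrK.
  - by apply: sqrE; rewrite enorm_plane_pt (rnN rn_cmod) cmodJ x1E cmodR (real_normK (num_real c)) hE addrC subrK.
  - by rewrite hdot_plane_pt conjc_real mulNr mulrC addNr.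
  - by rewrite plane_pt_last.
  - by apply: inner; rewrite xE.
  by rewrite lee_fin.
have p2 : 0 < 2 * pi :> R by rewrite mulr_gt0// pi_gt0.
have k4 : 0 <= kap / 4 by rewrite divr_ge0// ltW.
have := integral_le_cst p2 k4 vle; rewrite subr0 => hI.
have : ((kap / 2)%:E <= (kap / 4)%:E)%E.
  apply: (le_trans lower); apply: (le_trans hsub).
  have -> : (kap / 4)%:E = ((2 * pi)^-1%:E * (kap / 4 * (2 * pi))%:E)%E.
    by rewrite -EFinM mulrCA mulVf ?mulr1// gt_eqF.
  by apply: lee_wpmul2l => //; rewrite lee_fin invr_ge0 ltW.
rewrite lee_fin; lra.
Qed.

End Rim.
End Contradiction.

Theorem theorem4p1 (R : realType) (n : nat) (r eps : R) :
  (2 <= n)%N -> 0 < r -> r < 1 ->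
  let Q : 'rV[R[i]]_n :=
    \row_(j < n) (if j.+1 == n then Complex r 0 else 0) in
  0 < eps -> eps < 2 * r -> eball Q eps `<=` eball 0 1 ->
  let A := frontier (eball (0 : 'rV[R[i]]_n) r) `\` eball Q eps in
  let D := eball 0 1 `\` A in
  ~ plurisubharmonic D (squeezing D) /\ ~ plurisubharmonic D (fridman D).
Proof.
case: n => [//|[//|n]] _ r0 r1 Q eps0 epsr _ A D.
rewrite /D /A /Q slit_ballE//; set c := r - _.
have cE : c = r - eps * (eps / (2 * r)) by rewrite /c expr2 mulrA.
have e1 : 0 < eps / (2 * r) by rewrite divr_gt0// mulr_gt0.
have e2 : eps / (2 * r) < 1 by rewrite ltr_pdivrMr ?mulr_gt0// mul1r.
(* The bound [eps < 2 * r] amounts to c > -r, so that the rim is a sphere of positive radius. *)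
have rc : - r < c by rewrite cE; nra.
have cr : c < r by rewrite cE ltrBlDr ltrDl mulr_gt0.
have d0 := rim_radius_gt0 r0 r1.
split.
  apply: (not_plurisubharmonic (L := n.+2%:R * (6 / rim_radius r)) r0 r1 rc cr _ _ (squeezing_ge r1 rc cr)).
    by apply: mulr_gt0; [rewrite ltr0n|rewrite divr_gt0].
  by move=> a e z ar er ea ac zr za; have := squeezing_le r0 r1 rc cr ar er ea ac zr za.
apply: (not_plurisubharmonic (L := 12 / rim_radius r) r0 r1 rc cr _ _ (fridman_ge r1 rc cr)).
  by rewrite divr_gt0.
by move=> a e z ar er ea ac zr za; have := fridman_le r0 r1 rc cr ar er ea ac zr za.
Qed.
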